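(* Let $1<p<\infty$. Let $(X,d,m)$ be a locally compact, connected, separable uniform local tree with a Radon measure $m$ of full support satisfying the uniform volume control with volume function $\Phi$ (see context). Then $KS^{\Psi_p,p}(X,m)=W^{1,p}(X,m)$, and there exist constants $c,C>0$ and $r_1\in(0,r_0]$ such that for every $f\in KS^{\Psi_p,p}(X,m)$ $$c\,\sup_{r\in(0,r_1]}E_{p,\Psi_p}(f,r)\le \int_{\mathcal S}|\partial f|^p\,d\nu\le C\,\liminf_{r\to0}E_{p,\Psi_p}(f,r).$$
   Context: Balls are $B(x,r)=\{y:d(x,y)<r\}$. A metric space $(T,d)$ is a (real) tree if (1) for all $u,v\in T$ there is a unique isometric embedding $\phi_{u,v}:[0,d(u,v)]\to T$ with $\phi_{u,v}(0)=u$, $\phi_{u,v}(d(u,v))=v$; (2) every injective continuous $\kappa:[0,1]\to T$ satisfies $\kappa([0,1])=\phi_{\kappa(0),\kappa(1)}([0,d(\kappa(0),\kappa(1))])$. A metric space $(X,d)$ is a local tree if for every $x\in X$ there is $\iota(x)>0$ such that $B(x,\iota(x))$ is a tree. Standing assumption: $(X,d)$ is a locally compact, connected, separable local tree. For $u,v\in B(x,\iota(x))$, $[u,v]=\phi_{u,v}([0,d(u,v)])$ and $]u,v[=\phi_{u,v}(]0,d(u,v)[)$, geodesics being taken in the tree $B(x,\iota(x))$. The skeleton is $\mathcal S=\bigcup_{x\in X}\bigcup_{y\in B(x,\iota(x))}]x,y[$. Let $\mathcal V$ be a countable dense subset of $\mathcal S$. The length measure $\nu$ is the unique measure on the $\sigma$-field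 generated by the sets $]x,y[$ ($x,y\in\mathcal V$, $d(x,y)<\iota(x)$) with $\nu(]x,y[)=d(x,y)$ for all $x,y\in\mathcal S$ with $d(x,y)<\iota(x)$. Weak gradient: $f\in C(X)$ is absolutely continuous in $B(x,\iota(x))$ if there is $g\in L^1_{loc}(\mathcal S\cap B(x,\iota(x)),\nu)$ (integrable on segments) with $f(u)-f(x)=\int_{]x,u[}g\,d\nu$ for every $u\in B(x,\iota(x))$; $g=:\partial_xf$ is unique $\nu$-a.e. $f\in AC(X)$ means $f$ is absolutely continuous in $B(x,\iota(x))$ for all $x\in X$; then $|\partial_xf|=|\partial_yf|$ $\nu$-a.e. on common domains, and one writes $|\partial f|$. $AC^p(X)$ is the set of $f\in AC(X)$ with $|\partial f|\in L^p(\mathcal S,\nu)$. $m$ is a Radon measure on $X$ with full support. $W^{1,p}(X,m)$ is the set of $f\in L^p(X,m)$ having an $m$-representative $\tilde f\in AC^p(X)$, with $|\partial f|:=|\partial\tilde f|$ and norm $\|f\|_{L^p(X,m)}+\|\partial f\|_{L^p(\mathcal S,\nu)}$. Uniform volume control: there are $r_0>0$, an increasing function $\Phi:[0,r_0]\to[0,+\infty)$, $\alpha\ge1$ and constants $c,C>0$ with $c\frac Rr\le\frac{\Phi(R)}{\Phi(r)}\le C(\frac Rr)^\alpha$ for $0<r\le R\le r_0$, and $c\,\Phi(r)\le m(B(x,r))\le C\,\Phi(r)$ for all $x\in X$, $0<r<r_0$. Uniform local tree: there is $0<\underline\iota\le\mathrm{diam}(X)$ such that $B(x,\underline\iota)$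 is a tree for every $x\in X$. $\Psi_p(r)=r^{p-1}\Phi(r)$, $E_{p,\Psi_p}(f,r)=\frac1{\Psi_p(r)}\int_X\frac1{m(B(x,r))}\int_{B(x,r)}|f(y)-f(x)|^p\,dm(y)\,dm(x)$, and $KS^{\Psi_p,p}(X,m)=\{f\in L^p(X,m):\limsup_{r\to0}E_{p,\Psi_p}(f,r)<+\infty\}$. *)

(* Defs.v *)
From HB Require Import structures.
From mathcomp Require Import all_boot all_order all_algebra.
From mathcomp Require Import all_classical all_reals all_analysis.

Set Implicit Arguments.
Unset Strict Implicit.
Unset Printing Implicit Defensive.
Import Order.TTheory GRing.Theory Num.Theory.
Import numFieldNormedType.Exports.

Local Open Scope classical_set_scope.
Local Open Scope ring_scope.

(* The library's measurable types are pointed, hence the base point; it carries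
   no other content than nonemptiness. *)
#[short(type="pointedMetricType")]
HB.structure Definition PointedMetric (K : numDomainType) :=
  {M of Pointed M & Metric K M}.

Section metric_space.
Context {R : realType} {X : pointedMetricType R}.
Implicit Types (A : set X) (u v x y : X).

Definition separable := exists2 D : set X, countable D & dense D.

Definition diam : \bar R :=
  ereal_sup [set e | exists x y : X, e = (mdist x y)%:E].

(* phi is only relevant on `[0, mdist u v]. *)
Definition isometric_embedding A u v (phi : R -> X) :=
  [/\ phi 0 = u, phi (mdist u v) = v,
      {in `[0, mdist u v], forall t, A (phi t)} &
      {in `[0, mdist u v] &, forall s t, mdist (phi s) (phi t) = `|s - t|}].

(* In a tree the isometric embedding is unique, so that these unions are the
   images [u, v] and ]u, v[ of phi_{u,v}. *)
Definition closed_segment A u v : set X :=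
  \bigcup_(phi in isometric_embedding A u v) (phi @` `[0, mdist u v]).

Definition open_segment A u v : set X :=
  \bigcup_(phi in isometric_embedding A u v) (phi @` `]0, mdist u v[).

(* The subset A, with the restricted distance, is a real tree. *)
Definition is_tree A :=
  (forall u v, A u -> A v ->
     (exists phi, isometric_embedding A u v phi) /\
     (forall phi psi, isometric_embedding A u v phi ->
        isometric_embedding A u v psi -> {in `[0, mdist u v], phi =1 psi})) /\
  (forall kappa : R -> X,
     {within `[0, 1], continuous kappa} ->
     {in `[0, 1] &, injective kappa} ->
     kappa @` `[0, 1] `<=` A ->
     kappa @` `[0, 1] = closed_segment A (kappa 0) (kappa 1)).

Definition local_tree (iota : X -> R) :=
  forall x, 0 < iota x /\ is_tree (ball x (iota x)).

Definition uniform_local_tree (iota0 : R) :=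
  [/\ 0 < iota0, (iota0%:E <= diam)%E & forall x, is_tree (ball x iota0)].

End metric_space.
Arguments separable {R} X.
Arguments diam {R} X.
Arguments uniform_local_tree {R} X iota0.

Section length_structure.
Context {R : realType} {X : pointedMetricType R}.
Variable iota : X -> R.
Implicit Types (x y u v : X).

(* ]u, v[ in the tree B(x, iota x) *)
Definition segment_at x u v : set X := open_segment (ball x (iota x)) u v.

Definition skeleton : set X :=
  \bigcup_x \bigcup_(y in ball x (iota x)) segment_at x x y.

Definition countable_dense_in_skeleton (V : set X) :=
  [/\ V `<=` skeleton, countable V & skeleton `<=` closure V].

Definition segments (V : set X) : set (set X) :=
  [set A | exists x y,
     [/\ V x, V y, mdist x y < iota x & A = segment_at x x y]].

Definition segment_space (V : set X) := g_sigma_algebraType (segments V).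

End length_structure.

Section weak_gradient.
Context {R : realType} {X : pointedMetricType R}.
Variables (iota : X -> R) (V : set X).
Variable nu : {measure set (segment_space iota V) -> \bar R}.
Local Notation S := (skeleton iota).
Implicit Types (f g h : X -> R).

(* The length measure lives on the skeleton; it is encoded as a measure on X
   carried by the skeleton. *)
Definition is_length_measure :=
  nu (~` S) = 0%E /\
  forall x y, S x -> S y -> mdist x y < iota x ->
    nu (segment_at iota x x y) = (mdist x y)%:E.

(* g belongs to L^1_loc(S `&` B(x, iota x), nu) *)
Definition L1loc_at x g :=
  measurable_fun (S `&` ball x (iota x) : set (segment_space iota V)) g /\
  forall u v, ball x (iota x) u -> ball x (iota x) v ->
    nu.-integrable (segment_at iota x u v) (EFin \o g).

(* g is a version of the weak gradient of f in B(x, iota x) *)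
Definition is_gradient_at f x g :=
  L1loc_at x g /\
  forall u, ball x (iota x) u ->
    ((f u - f x)%:E = \int[nu]_(z in segment_at iota x x u) (g z)%:E)%E.

Definition AC f :=
  continuous f /\ forall x, exists g, is_gradient_at f x g.

(* h is a version of the global function |\partial f|, obtained by gluing the
   functions |\partial_x f|. *)
Definition is_abs_gradient f h :=
  [/\ measurable_fun (S : set (segment_space iota V)) h,
      (forall z, S z -> 0 <= h z) &
      forall x, exists2 g, is_gradient_at f x g &
        {ae nu, forall z, (S `&` ball x (iota x)) z -> `|g z| = h z}].

Definition ACp (p : R) f :=
  AC f /\ exists2 h, is_abs_gradient f h &
    (\int[nu]_(z in S) (h z `^ p)%:E < +oo)%E.

End weak_gradient.

Definition borel {R : realType} (X : pointedMetricType R) :=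
  g_sigma_algebraType (@open X).

Section function_spaces.
Context {R : realType} {X : pointedMetricType R}.
Variable m : {measure set (borel X) -> \bar R}.
Implicit Types (f : X -> R) (p r : R).

Definition radon :=
  (forall K : set X, compact K -> (m K < +oo)%E) /\
  (forall A : set (borel X), measurable A ->
     m A = ereal_sup [set m K | K in [set K : set X | compact K /\ K `<=` A]]).

Definition full_support := forall U : set X, open U -> U !=set0 -> (0 < m U)%E.

Definition uniform_volume_control (r0 : R) (Phi : R -> R) :=
  [/\ 0 < r0,
      {in `[0, r0], forall r, 0 <= Phi r},
      {in `[0, r0] &, {homo Phi : r s / r <= s}} &
      exists alpha c C : R,
        [/\ 1 <= alpha, 0 < c, 0 < C,
            (forall r s, 0 < r -> r <= s -> s <= r0 ->
               c * (s / r) <= Phi s / Phi r <= C * (s / r) `^ alpha) &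
            (forall x r, 0 < r < r0 ->
               ((c * Phi r)%:E <= m (ball x r) <= (C * Phi r)%:E)%E)]].

Definition Psi (Phi : R -> R) p r : R := r `^ (p - 1) * Phi r.

Definition KS_energy (Phi : R -> R) p f r : \bar R :=
  ((Psi Phi p r)^-1%:E *
   \int[m]_x ((m (ball x r))^-1 *
              \int[m]_(y in ball x r) (`|f y - f x| `^ p)%:E))%E.

(* L^p functions are represented by everywhere defined Borel functions; this
   set and the next one are invariant under m-a.e. equality. *)
Definition KS (Phi : R -> R) p : set (X -> R) :=
  [set f | (f : borel X -> R) \in Lfun m p%:E /\
           (limf_esup (KS_energy Phi p f) (0 : R)^'+ < +oo)%E].

Variables (iota : X -> R) (V : set X).
Variable nu : {measure set (segment_space iota V) -> \bar R}.

Definition W1p p : set (X -> R) :=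
  [set f | (f : borel X -> R) \in Lfun m p%:E /\
           exists2 ft, {ae m, forall x, ft x = f x} & ACp nu p ft].

(* |\partial f| for f having an m-representative in AC^p(X) *)
Definition abs_gradient p f : X -> R :=
  get [set h | exists ft, [/\ {ae m, forall x, ft x = f x}, ACp nu p ft &
                              is_abs_gradient nu ft h]].

End function_spaces.

(* Main.v *)
Require Import Defs.
From HB Require Import structures.
From mathcomp Require Import all_boot all_order all_algebra.
From mathcomp Require Import all_classical all_reals all_analysis.
From mathcomp Require Import measurable_realfun zify ring lra.
Set Implicit Arguments.
Unset Strict Implicit.
Unset Printing Implicit Defensive.
Import Order.TTheory GRing.Theory Num.Theory.
Import numFieldNormedType.Exports.

Local Open Scope classical_set_scope.
Local Open Scope ring_scope.

(** Both inequalities are one-dimensional statements along geodesics of the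
tree, carried to the space by two averaging devices.

The gradient controls the energy. Two points at distance less than r are
joined by a geodesic inside a ball of radius r, and Hoelder's inequality bounds
|f y - f x|^p by r^(p-1) times the integral of |df|^p over the skeleton in
B(x,r) ([dist_energy]). Integrating in y and x and exchanging the integrals,
a point z of the skeleton is counted with weight at most of order Phi(r)^2,
which is exactly what the normalization of the energy divides by
([energy_le_gradient]).

The energy controls oscillations along arcs. Cover a geodesic of length l by
about l/r disjoint balls of radius r/8 and choose in each of them a point whose
inner energy is at most the mean. Neighbouring chosen points are compared
through a common ball ([two_point]), and the power mean inequality bounds the
p-th power of the oscillation of f by l^(p-1) times the energy carried by the
r-tube around the geodesic ([chain]). Tubes around disjoint compact arcs are
disjoint for small r, so these bounds add up: the sum of |df_i|^p / l_i^(p-1)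
over any finite family of disjoint arcs, with l_i the length of the i-th arc
and df_i the difference of f between its endpoints, is at most a constant times
the lower limit of the energies ([open_arcs_energy]). Comparing
well-chosen points at consecutive dyadic scales in the same way shows that a
function of bounded energy has a continuous representative
([continuous_representative]), so that its values along arcs make sense.

From arcs to the gradient. For consecutive arcs of one geodesic, the bound is
the criterion of F. Riesz for being the primitive of a p-integrable function
([riesz_density]). The skeleton is a countable union of short geodesics, and
the absolute value of the derivative of f along the first of them through a
point defines |df| there. This does not depend on the geodesic, almost
everywhere: in a tree two geodesics overlap along an interval, on which one is
a shift or a flip of the other ([ae_transition]). Choosing signs by the
direction that leads away from x yields the gradient seen from x
([glued_gradientP]). Finally the bound on |df| in L^p applies the arc estimate
to the small cells that meet compact pieces of different geodesics; these cells
are disjoint as soon as the mesh is small, and Fatou's lemma turns the slopes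
of f over the cells into derivatives ([slopes_fatou], [abs_gradient_energy]). *)

(** * Power inequalities and geometric sequences *)

Section riesz.
Context {R : realType}.
Implicit Types (p t a b K : R).

(** Splits |x| at the level a; above it, |x|^(p-1) is at least a^(p-1). With a large,
    this turns p-th moments into uniform integrability. *)
Lemma norm_le_powR p a (x : R) : 1 < p -> 0 < a ->
  `|x| <= a + `|x| `^ p / a `^ (p - 1).
Proof.
move=> p1 a0; have apos : 0 < a `^ (p - 1) by rewrite powR_gt0.
have [xa|ax] := leP `|x| a.
  by rewrite ler_wpDr// divr_ge0// ?powR_ge0// ltW.
rewrite ler_wpDl ?(ltW a0)// ler_pdivlMr//.
have x0 : 0 < `|x| by apply: lt_trans ax.
rewrite -[leRHS]mulr_powRB1 ?(ltW x0) ?(lt_trans _ p1)// ler_pM2l//.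
by rewrite ge0_ler_powR ?nnegrE ?subr_ge0 ?ltW.
Qed.

(** Convexity of the p-th power: the graph lies above its tangent at a. Being
    linear in x, the bound survives limits where the p-th power itself would need
    a continuity argument. *)
Lemma powR_tangent p (x a : R) : 1 < p -> 0 <= x -> 0 <= a ->
  p * a `^ (p - 1) * x <= x `^ p + (p - 1) * a `^ p.
Proof.
move=> p1 x0 a0; have p0 : 0 < p by apply: lt_trans p1.
have pm : 0 < p - 1 by rewrite subr_gt0.
pose q := p / (p - 1).
have q0 : 0 < q by rewrite divr_gt0.
have pq : p^-1 + q^-1 = 1.
  by rewrite /q invf_div -{1}[p^-1]mul1r -mulrDl addrC subrK divff// gt_eqF.
have := conjugate_powR x0 (powR_ge0 a (p - 1)) p0 q0 pq.
rewrite -powRrM /q mulrCA divff ?gt_eqF// mulr1.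
rewrite -(ler_pM2l p0) (_ : p * (_ + _) = x `^ p + (p - 1) * a `^ p); last first.
  by field; rewrite !gt_eqF.
by rewrite (mulrC x) mulrA.
Qed.

Lemma powR_slope p (x h : R) : 1 < p -> 0 <= x -> 0 < h ->
  (x / h) `^ p * h = x `^ p / h `^ (p - 1).
Proof.
move=> p1 x0 h0; rewrite powRM// ?invr_ge0 ?ltW// -powR_inv1 ?ltW// -powRrM mulN1r powRN.
rewrite -(mulr_powRB1 (ltW h0) (lt_trans ltr01 p1)).
by field; rewrite !gt_eqF ?powR_gt0.
Qed.

Lemma exists_powR_large p K (e : R) : 1 < p -> 0 < e ->
  exists2 a, 0 < a & K / a `^ (p - 1) <= e.
Proof.
move=> p1 e0; pose b := (`|K| + 1) / e.
have b0 : 0 < b by rewrite divr_gt0// ltr_wpDl.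
exists (b `^ (p - 1)^-1); first by rewrite powR_gt0.
rewrite -powRrM mulVf ?powRr1 ?(ltW b0)//; last by rewrite gt_eqF ?subr_gt0.
rewrite ler_pdivrMr// /b mulrCA divff ?gt_eqF// mulr1.
by rewrite (le_trans (ler_norm _))// lerDl.
Qed.

(** Sum the tangent inequalities taken at the mean of the |u j|. *)
Lemma sum_powR_le p n (u : nat -> R) : 1 < p -> (0 < n)%N ->
  (\sum_(j < n) `|u j|) `^ p <= n%:R `^ (p - 1) * \sum_(j < n) `|u j| `^ p.
Proof.
move=> p1 n0; have p0 : 0 < p by apply: lt_trans p1.
have nn0 : 0 < n%:R :> R by rewrite ltr0n.
set S := \sum_(j < n) `|u j|.
have S0 : 0 <= S by apply: sumr_ge0.
pose a := S / n%:R.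
have a0 : 0 <= a by rewrite divr_ge0// ltW.
have : \sum_(j < n) (p * a `^ (p - 1) * `|u j|) <=
       \sum_(j < n) (`|u j| `^ p + (p - 1) * a `^ p).
  by apply: ler_sum => j _; apply: powR_tangent.
rewrite -mulr_sumr big_split/= sumr_const card_ord -/S.
have -> : S = n%:R * a by rewrite /a mulrCA divff ?gt_eqF// mulr1.
move=> H; rewrite powRM ?(ltW nn0)//.
have apE : a `^ p = a `^ (p - 1) * a by rewrite mulrC mulr_powRB1.
have npE : n%:R `^ p = n%:R `^ (p - 1) * n%:R :> R.
  by rewrite mulrC mulr_powRB1.
rewrite npE -mulrA ler_pM2l ?powR_gt0//.
move: H; rewrite -mulr_natl apE; nra.
Qed.

Lemma powR_exprn (x a : R) k : 0 <= x -> (x ^+ k) `^ a = (x `^ a) ^+ k.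
Proof.
move=> x0; elim: k => [|k IH]; first by rewrite !expr0 powR1.
by rewrite !exprS powRM ?IH ?exprn_ge0.
Qed.

(** The sequences u k - K / (1 - q) q^k and u k + K / (1 - q) q^k are monotone and
    squeeze the limit, which comes with its rate. *)
Lemma geometric_limit (u : nat -> R) (K q : R) : 0 < q < 1 -> 0 <= K ->
  (forall k, `|u k - u k.+1| <= K * q ^+ k) ->
  exists l, forall k, `|u k - l| <= K / (1 - q) * q ^+ k.
Proof.
move=> /andP[q0 q1] K0 H; pose T := K / (1 - q).
have q1' : 0 < 1 - q by rewrite subr_gt0.
have T0 : 0 <= T by rewrite divr_ge0// ltW.
have TK : T * (1 - q) = K by rewrite divfK// gt_eqF.
pose a k := u k - T * q ^+ k; pose b' k := u k + T * q ^+ k.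
have qk k : 0 <= q ^+ k by rewrite exprn_ge0// ltW.
have aS k : a k <= a k.+1.
  have := H k; rewrite ler_norml /a exprS => /andP[_]; rewrite -TK.
  by move: (q ^+ k) => w; lra.
have bS k : b' k.+1 <= b' k.
  have := H k; rewrite ler_norml /b' exprS => /andP[+ _]; rewrite -TK.
  by move: (q ^+ k) => w; lra.
have ab k : a k <= b' k.
  have : 0 <= T * q ^+ k by rewrite mulr_ge0.
  by rewrite /a /b'; move: (T * _) => w; lra.
have mono i j : (i <= j)%N -> a i <= a j /\ b' j <= b' i.
  elim: j => [|j IH]; first by rewrite leqn0 => /eqP ->.
  rewrite leq_eqVlt => /predU1P[->//|]; rewrite ltnS => /IH[h1 h2].
  by split; [exact: le_trans (aS j)|exact: le_trans (bS j) _].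
have cross i j : a i <= b' j.
  case/orP: (leq_total i j) => ij; have [h1 h2] := mono _ _ ij.
    exact: le_trans (ab j).
  exact: le_trans (ab i) _.
exists (sup (range a)) => k; rewrite -/T ler_distlC.
have up : has_sup (range a).
  by split; [exists (a 0%N), 0%N|exists (b' 0%N) => _ [i _ <-]].
apply/andP; split.
  by apply: (ub_le_sup up.2); exists k.
by apply: ge_sup; [exact: up.1|move=> _ [i _ <-]; exact: cross].
Qed.

End riesz.

(** * Primitives of p-integrable functions *)

Section riesz_density.
Context {R : realType}.
Variables (F : R -> R) (l p K : R).
Hypotheses (l0 : 0 < l) (p1 : 1 < p) (Fc : continuous F).
Let h n : R := l / n.+1%:R.
Hypothesis FK : forall n, \sum_(j < n.+1)
  `|F (j.+1%:R * h n) - F (j%:R * h n)| `^ p / h n `^ (p - 1) <= K.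

Local Notation mu := (@lebesgue_measure R).
Let lam (A : set R) : R := fine (mu (A `&` `[0, l])).
Let J n j : set R := `[j%:R * h n, j.+1%:R * h n[%classic.
Let c n j : R := (F (j.+1%:R * h n) - F (j%:R * h n)) / h n.
(** m_ n is the signed measure whose density is the step function of the slopes of
    F over the partition of [0, l] into n.+1 cells. *)
Let m_ n (A : set R) : R := \sum_(j < n.+1) c n j * lam (A `&` J n j).

Let h0 n : 0 < h n. Proof. by rewrite divr_gt0// ltr0n. Qed.

Let mu_fin (A : set R) : measurable A -> mu (A `&` `[0, l]) \is a fin_num.
Proof.
move=> mA; rewrite ge0_fin_numE//.
apply: (@le_lt_trans _ _ (mu `[0, l]%classic)).
  by apply: le_measure; rewrite ?inE//; exact: measurableI.
by rewrite lebesgue_measure_itv/= lte_fin l0 -EFinB ltry.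
Qed.

Let lamD (A B : set R) : measurable A -> measurable B -> A `&` B = set0 ->
  lam (A `|` B) = lam A + lam B.
Proof.
move=> mA mB AB; rewrite /lam setIUl measureU.
- by rewrite fineD// mu_fin.
- exact: measurableI.
- exact: measurableI.
- by rewrite setIACA AB set0I.
Qed.

Let lam0 : lam set0 = 0. Proof. by rewrite /lam set0I measure0. Qed.

Let lam_ge0 A : 0 <= lam A. Proof. exact: fine_ge0. Qed.

Let le_lam (A B : set R) : measurable A -> measurable B -> A `<=` B ->
  lam A <= lam B.
Proof.
move=> mA mB AB; apply: fine_le; rewrite ?mu_fin//.
by apply: le_measure; rewrite ?inE; [exact: measurableI..|exact: setSI].
Qed.

Let mI n j : measurable (J n j). Proof. exact: measurable_itv. Qed.

Let lam_I n (A : set R) j : measurable A -> lam (A `&` J n j) <= h n.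
Proof.
move=> mA; rewrite -lee_fin /lam fineK ?mu_fin//; last exact: measurableI.
apply: (@le_trans _ _ (mu (J n j))).
  apply: le_measure; rewrite ?inE; last by move=> x [[]].
    by apply: measurableI => //; apply: measurableI => //; exact: mI.
  exact: mI.
rewrite /J lebesgue_measure_itv/= lte_fin ltr_pM2r// ltr_nat ltnSn.
by rewrite -EFinB lee_fin/= -mulrBl -natrB// subSnn mul1r.
Qed.

Let sum_lam n (A : set R) N : measurable A ->
  \sum_(j < N) lam (A `&` J n j) = lam (A `&` `[0, N%:R * h n[%classic).
Proof.
move=> mA; elim: N => [|N IH].
  by rewrite big_ord0 mul0r set_itv_ge ?setI0 ?lam0//= bnd_simp ltxx.
rewrite big_ord_recr/= IH -lamD.
- have NS : N%:R * h n <= N.+1%:R * h n by rewrite ler_pM2r// ler_nat.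
  have N0 : 0 <= N%:R * h n by rewrite mulr_ge0// ltW.
  rewrite -setIUr; congr (lam (_ `&` _)); apply/seteqP; split => x /=.
    by rewrite /J/= !in_itv/= => -[]/andP[]; lra.
  rewrite /J/= !in_itv/= => /andP[-> ->]; rewrite andbT/=.
  by case: (ltP x (N%:R * h n)) => _; [left|right].
- exact: measurableI.
- by apply: measurableI => //; exact: mI.
- rewrite setIACA setIid; apply/seteqP; split => // x /= [_].
  by rewrite /J/= !in_itv/=; lra.
Qed.

Let sum_lam_le n (A : set R) N : measurable A ->
  \sum_(j < N) lam (A `&` J n j) <= lam A.
Proof.
by move=> mA; rewrite sum_lam//; apply: le_lam => //; exact: measurableI.
Qed.

Let cK n : \sum_(j < n.+1) `|c n j| `^ p * h n <= K.
Proof.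
apply: le_trans (FK n); apply: ler_sum => j _.
by rewrite normrM normfV (ger0_norm (ltW (h0 n))) powR_slope.
Qed.

(** Uniform absolute continuity in n, by [norm_le_powR]. *)
Let m_bound n (A : set R) a : measurable A -> 0 < a ->
  `|m_ n A| <= a * lam A + K / a `^ (p - 1).
Proof.
move=> mA a0; apply: (le_trans (ler_norm_sum _ _ _)).
apply: (@le_trans _ _ (\sum_(j < n.+1) (a * lam (A `&` J n j) +
    `|c n j| `^ p * h n / a `^ (p - 1)))).
  apply: ler_sum => j _; rewrite normrM (ger0_norm (lam_ge0 _)).
  apply: le_trans (ler_wpM2r (lam_ge0 _) (norm_le_powR _ p1 a0)) _.
  rewrite mulrDl lerD2l mulrAC ler_wpM2r ?invr_ge0 ?powR_ge0//.
  by rewrite ler_wpM2l ?powR_ge0// lam_I.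
rewrite big_split/= -mulr_sumr -mulr_suml lerD// ?ler_wpM2l ?(ltW a0)//.
  exact: sum_lam_le.
by apply: ler_wpM2r (cK n); rewrite invr_ge0 powR_ge0.
Qed.

Let m_D n (A B : set R) : measurable A -> measurable B -> A `&` B = set0 ->
  m_ n (A `|` B) = m_ n A + m_ n B.
Proof.
move=> mA mB AB; rewrite /m_ -big_split/=; apply: eq_bigr => j _.
rewrite -mulrDr -lamD ?setIUl//; [exact: measurableI..|].
by rewrite setIACA AB set0I.
Qed.

(** The limits are taken along an ultrafilter, so that all of them exist and no
    subsequence has to be extracted. *)
Let ultra : exists G : set_system nat, UltraFilter G /\ \oo `<=` G.
Proof. exact: ultraFilterLemma. Qed.

Let U := sval (cid ultra).
Let Uu : UltraFilter U. Proof. by rewrite /U; case: cid => ? []. Qed.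
Let Uoo : \oo `<=` U. Proof. by rewrite /U; case: cid => ? []. Qed.
Let UP : ProperFilter U. Proof. exact: ultra_proper. Qed.
Local Existing Instance UP.

Let m (A : set R) : R := lim (m_ n A @[n --> U]).

Let m_cvg (A : set R) : measurable A -> m_ n A @[n --> U] --> m A.
Proof.
move=> mA; apply/cvg_ex => /=.
have := @segment_compact R (- (lam A + K)) (lam A + K).
case/(_ (m_ n A @[n --> U]) _ _).
  apply: Uoo; exists 0%N => // n _ /=; rewrite in_itv/= -ler_norml.
  by have := m_bound n mA ltr01; rewrite mul1r powR1 divr1.
move=> x [_ clx]; exists x => B Bx.
have [//|nB] := in_ultra_setVsetC (m_^~ A @^-1` B) Uu.
by have [y []] := clx (~` B) B nB Bx.
Qed.

Let mD (A B : set R) : measurable A -> measurable B -> A `&` B = set0 ->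
  m (A `|` B) = m A + m B.
Proof.
move=> mA mB AB; apply: cvg_lim => //.
under eq_fun do rewrite m_D//.
by apply: cvgD; exact: m_cvg.
Qed.

Let m_le (A : set R) a : measurable A -> 0 < a ->
  `|m A| <= a * lam A + K / a `^ (p - 1).
Proof.
move=> mA a0; have H : `|m_ n A| @[n --> U] --> `|m A| by apply: cvg_norm; exact: m_cvg.
rewrite -(cvg_lim _ H)//; apply: limr_le; first by apply/cvg_ex; exists `|m A|.
by apply: nearW => n; exact: m_bound.
Qed.

Let m0 : m set0 = 0.
Proof.
have := mD measurable0 measurable0 (setI0 _).
by rewrite setU0 => /eqP; rewrite -subr_eq subrr eq_sym => /eqP.
Qed.

(** Additivity up to a tail; the tail is small by [m_le], whence
    sigma-additivity of the limit. *)
Let m_bigcup (A : (set R)^nat) n : (forall i, measurable (A i)) ->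
  trivIset setT A ->
  m (\bigcup_i A i) = \sum_(0 <= i < n) m (A i) + m (\bigcup_i A (n + i)%N).
Proof.
move=> mA tA; elim: n => [|n ->].
  by rewrite big_geq// add0r; congr m; apply: eq_bigcupr.
rewrite big_nat_recr//= -addrA; congr (_ + _).
rewrite -mD//; last 2 first.
- exact: bigcupT_measurable.
- apply/seteqP; split => // x [Anx [i _ Ani]].
  have /trivIsetP/(_ n (n.+1 + i)%N I I) := tA.
  rewrite (_ : n != n.+1 + i)%N => [/(_ isT) E|]; last by rewrite addSnnS -[X in X != _]addn0 eqn_add2l.
  by rewrite -E.
congr m; apply/seteqP; split => [x [[|i] _]|x [Anx|[i _ Ani]]].
- by rewrite addn0; left.
- by right; exists i => //; rewrite addSnnS.
- by exists 0%N => //; rewrite addn0.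
- by exists i.+1 => //; rewrite -addSnnS.
Qed.

Let lam_tail (A : (set R)^nat) : (forall i, measurable (A i)) ->
  trivIset setT A -> lam (\bigcup_i A (n + i)%N) @[n --> \oo] --> 0.
Proof.
move=> mA tA; apply: fine_cvg.
have -> : 0%:E = mu (\bigcap_n ((\bigcup_i A (n + i)%N) `&` `[0, l]))%classic.
  rewrite (_ : \bigcap__ _ = set0) ?measure0//.
  apply/seteqP; split => // x Ax.
  have [[i _ Ai] _] := Ax 0%N I; have [[j _ Aj] _] := Ax i.+1 I.
  have /trivIsetP/(_ _ _ I I) := tA.
  move=> /(_ i (i.+1 + j)%N); rewrite lt_eqF//; last by rewrite ltEnat/= addSn ltnS leq_addr.
  by move=> /(_ isT) E; rewrite -E; split=> //; move: Ai; rewrite add0n.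
have mtail n : measurable (\bigcup_i A (n + i)%N) by exact: bigcupT_measurable.
have mtail' n : measurable ((\bigcup_i A (n + i)%N) `&` `[0, l]%classic).
  exact: measurableI.
apply: nonincreasing_cvg_mu => //.
- by have := mu_fin (mtail 0%N); rewrite ge0_fin_numE.
- exact: bigcapT_measurable.
- move=> n k nk; apply/subsetPset; apply: setSI => x [i _ Ai].
  by exists (k - n + i)%N => //; rewrite addnA subnKC.
Qed.

Let mE (A : set R) : \bar R := (m A)%:E.

Let mE_charge : semi_sigma_additive (mE : set (measurableTypeR R) -> \bar R).
Proof.
move=> A mA tA mUA; rewrite /mE.
under eq_fun do rewrite sumEFin.
apply: cvg_EFin; first by near=> n.
apply/cvgrPdist_le => /= e e0.
have [a a0 Ka] : exists2 a, 0 < a & K / a `^ (p - 1) <= e / 2.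
  by apply: exists_powR_large => //; rewrite divr_gt0.
have := lam_tail mA tA.
move=> /cvgrPdist_le/(_ (e / 2 / a)) -[|N _ HN]; first by rewrite !divr_gt0.
exists N => // n /HN/=; rewrite (m_bigcup n mA tA) sub0r normrN (ger0_norm (lam_ge0 _)) => le1.
rewrite addrAC subrr add0r.
have mt : measurable (\bigcup_i A (n + i)%N) by exact: bigcupT_measurable.
apply: le_trans (m_le mt a0) _.
rewrite [leRHS]splitr lerD//.
by rewrite mulrC -ler_pdivlMr.
Unshelve. all: by end_near. Qed.

Let lam_itv (x y : R) : x <= y -> lam `[x, y]%classic <= y - x.
Proof.
move=> xy; rewrite -lee_fin /lam fineK ?mu_fin//.
apply: (@le_trans _ _ (mu `[x, y]%classic)).
  by apply: le_measure; rewrite ?inE; [exact: measurableI|exact: measurable_itv|exact: subIsetl].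
rewrite lebesgue_measure_itv/= lte_fin; case: ltP => // _; by rewrite lee_fin subr_ge0.
Qed.

Let hN n N : (N <= n.+1)%N -> N%:R * h n <= l.
Proof.
move=> Nn; rewrite /h mulrCA ler_piMr ?(ltW l0)// ler_pdivrMr ?ltr0n//.
by rewrite mul1r ler_nat.
Qed.

Let lam_J n N : (N < n.+1)%N -> lam (J n N) = h n.
Proof.
move=> Nn; rewrite /lam (_ : J n N `&` `[0, l]%classic = J n N); last first.
  apply/seteqP; split => x; first by case.
  rewrite /J/= !in_itv/= => /andP[x1 x2]; split; first by rewrite x1.
  have N0 : 0 <= N%:R * h n by rewrite mulr_ge0// ltW.
  have := hN Nn; lra.
rewrite /J lebesgue_measure_itv/= lte_fin ltr_pM2r// ltr_nat ltnSn/=.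
by rewrite -mulrBl -natrB// subSnn mul1r.
Qed.

Let m_J n N : (N < n.+1)%N -> m_ n (J n N) = F (N.+1%:R * h n) - F (N%:R * h n).
Proof.
move=> Nn; rewrite /m_ (bigD1 (Ordinal Nn))//= setIid lam_J// /c divfK ?gt_eqF//.
rewrite big1 ?addr0// => j jN; rewrite (_ : J n N `&` J n j = set0) ?lam0 ?mulr0//.
have {}jN : (j : nat) != N by [].
apply/seteqP; split => // x; rewrite /J/= !in_itv/= => -[/andP[a1 a2] /andP[b1 b2]].
have := le_lt_trans a1 b2; have := le_lt_trans b1 a2.
rewrite !ltr_pM2r// !ltr_nat !ltnS => jN1 Nj1.
by move: jN; rewrite eqn_leq jN1 Nj1.
Qed.

Let m_grid n N : (N <= n.+1)%N ->
  m_ n `[0, N%:R * h n[%classic = F (N%:R * h n) - F 0.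
Proof.
elim: N => [_|N IH Nn].
  rewrite mul0r set_itv_ge ?bnd_simp ?ltxx// subrr.
  by rewrite /m_ big1// => j _; rewrite set0I lam0 mulr0.
rewrite (_ : `[0, N.+1%:R * h n[%classic = `[0, N%:R * h n[%classic `|` J n N).
  rewrite m_D ?IH ?m_J//; [lra|exact: ltnW|].
  by apply/seteqP; split => // x; rewrite /J/= !in_itv/=; lra.
have NS : N%:R * h n <= N.+1%:R * h n by rewrite ler_pM2r// ler_nat.
have N0 : 0 <= N%:R * h n by rewrite mulr_ge0// ltW.
apply/seteqP; split => x /=; rewrite /J/= !in_itv/=.
  by case: (ltP x (N%:R * h n)) => ? ?; [left|right]; lra.
by case; lra.
Qed.

Let h_cvg (e : R) : 0 < e -> \forall n \near \oo, h n < e.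
Proof.
move=> e0; near=> n; rewrite /h ltr_pdivrMr ?ltr0n// mulrC -ltr_pdivrMr//.
rewrite (lt_le_trans (truncnS_gt _))// ler_nat ltnS.
by near: n; exists (Num.truncn (l / e)).
Unshelve. all: by end_near. Qed.

(** Up to one partial cell, [0, t] is a union of cells, over which the slopes
    telescope; the partial cell is negligible by uniform absolute continuity. *)
Let m_itv t : 0 <= t <= l -> m `[0, t]%classic = F t - F 0.
Proof.
move=> /andP[t0 tl]; apply: cvg_lim => //; apply: cvg_trans (_ : m_ n `[0, t]%classic @[n --> \oo] --> _).
  by move=> A HA; apply: Uoo.
apply/cvgrPdist_le => e e0.
have e3 : 0 < e / 3 by rewrite divr_gt0.
have [a a0 Ka] := exists_powR_large K p1 e3.
have Ft : F x @[x --> t] --> F t by exact: Fc.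
move: Ft => /cvgrPdist_le/(_ _ e3)/nbhs_ballP[d /= d0 Hd].
near=> n.
pose N := Num.truncn (t / h n).
have Nt : N%:R * h n <= t.
  by rewrite -ler_pdivlMr// /N truncn_le ?divr_ge0// ltW.
have tN : t < N.+1%:R * h n by rewrite -ltr_pdivrMr// truncnS_gt.
have Nn : (N <= n.+1)%N.
  rewrite -(ler_nat R) -(ler_pM2r (h0 n)) (le_trans Nt)//.
  by rewrite /h mulrCA divff ?mulr1// pnatr_eq0.
have N0 : 0 <= N%:R * h n by rewrite mulr_ge0// ltW.
rewrite (_ : `[0, t]%classic = `[0, N%:R * h n[%classic `|` `[N%:R * h n, t]%classic); last first.
  apply/seteqP; split => x /=; rewrite !in_itv/=; last by case; lra.
  by case: (ltP x (N%:R * h n)) => ? ?; [left|right]; lra.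
rewrite m_D ?m_grid//; last first.
  by apply/seteqP; split => // x; rewrite /= !in_itv/=; lra.
have tNh : t - N%:R * h n <= h n.
  by move: tN; rewrite -natr1 mulrDl mul1r; lra.
rewrite (_ : _ - _ = (F t - F (N%:R * h n)) - m_ n `[N%:R * h n, t]%classic); last by lra.
apply: (le_trans (ler_normB _ _)).
have FN : `|F t - F (N%:R * h n)| <= e / 3.
  apply: Hd; rewrite /ball/= ger0_norm ?subr_ge0// (le_lt_trans tNh)//.
  by near: n; exact: h_cvg.
have := m_bound n (measurable_itv `[N%:R * h n, t]) a0.
have : a * lam `[N%:R * h n, t]%classic <= e / 3.
  rewrite -ler_pdivlMl// (le_trans (lam_itv Nt))// (le_trans tNh)// ltW//.
  by near: n; apply: h_cvg; rewrite mulr_gt0 ?invr_gt0.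
lra.
Unshelve. all: by end_near. Qed.

(** The slopes of F are bounded in L^p, so the measures having them as densities
    are uniformly absolutely continuous; their limit gives mass F t - F 0 to [0, t]
    and k is its Radon-Nikodym density. *)
Lemma riesz_density : exists k : R -> R, mu.-integrable setT (EFin \o k) /\
  forall t, 0 <= t <= l -> F t - F 0 = \int[mu]_(x in `[0, t]) k x.
Proof.
have mE0 : mE set0 = 0%E by rewrite /mE m0.
have mEfin (A : set (measurableTypeR R)) : measurable A -> mE A \is a fin_num by [].
pose nu : {charge set (measurableTypeR R) -> \bar R} :=
  HB.pack (mE : set (measurableTypeR R) -> \bar R)
    (isCharge.Build _ _ _ (mE : set (measurableTypeR R) -> \bar R) mE0 mEfin mE_charge).
have numu : nu `<< mu.
  apply/null_content_dominatesP => A mA A0; rewrite /nu/= /mE; congr EFin.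
  apply/eqP; rewrite -normr_le0; apply/ler_addgt0Pl => e e0.
  have [a a0 Ka] := exists_powR_large K p1 e0.
  rewrite addr0 (le_trans (m_le mA a0))// [X in a * X](_ : _ = 0) ?mulr0 ?add0r//.
  apply/eqP; rewrite eq_le lam_ge0 andbT -lee_fin /lam fineK ?mu_fin//.
  apply: (@le_trans _ _ (mu A)); last by rewrite [mu A]A0.
  by apply: le_measure; rewrite ?inE//; exact: measurableI.
have kfin x : Radon_Nikodym nu mu x \is a fin_num by exact: Radon_Nikodym_fin_num.
have kE : EFin \o (fine \o Radon_Nikodym nu mu) = Radon_Nikodym nu mu.
  by apply/funext => x /=; rewrite fineK.
exists (fine \o Radon_Nikodym nu mu); split; first by rewrite kE; exact: Radon_Nikodym_integrable.
move=> t tl; rewrite -m_itv//.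
have := Radon_Nikodym_integral numu (measurable_itv `[0, t]).
rewrite -kE /nu/= /mE => E; rewrite /Rintegral -[LHS]/(fine (m `[0, t]%classic)%:E).
by rewrite E.
Qed.
End riesz_density.

Section derivative.
Context {R : realType}.
Implicit Types (F G k : R -> R) (t d l : R).
Local Notation mu := (@lebesgue_measure R).

(** Differentiability in the epsilon form, which passes directly through the
    reparametrizations of [has_deriv_flip] and to the slopes over intervals that
    merely contain t. *)
Definition has_deriv F t d := forall e, 0 < e -> exists2 r, 0 < r &
  forall s, `|s - t| < r -> `|F s - F t - d * (s - t)| <= e * `|s - t|.

Lemma has_deriv_slope F t d : has_deriv F t d -> forall e, 0 < e ->
  exists2 r, 0 < r & forall a b, a <= t <= b -> a < b -> b - a < r ->
    `|(F b - F a) / (b - a) - d| <= e.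
Proof.
move=> Fd e e0; have [r r0 Hr] := Fd e e0; exists r => // a b /andP[at' tb] ab abr.
have ba0 : 0 < b - a by rewrite subr_gt0.
have Ha : `|F a - F t - d * (a - t)| <= e * (t - a).
  by have := Hr a; rewrite (distrC a) (ger0_norm (_ : 0 <= t - a)) ?subr_ge0//; apply; lra.
have Hb : `|F b - F t - d * (b - t)| <= e * (b - t).
  by have := Hr b; rewrite (ger0_norm (_ : 0 <= b - t)) ?subr_ge0//; apply; lra.
rewrite (_ : _ - d = (F b - F a - d * (b - a)) / (b - a)); last first.
  by field; rewrite gt_eqF.
rewrite normrM normfV (gtr0_norm ba0) ler_pdivrMr//.
rewrite (_ : _ - _ = (F b - F t - d * (b - t)) - (F a - F t - d * (a - t))); last by ring.
by rewrite (le_trans (ler_normB _ _))//; lra.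
Qed.

Lemma has_deriv_unique F t d1 d2 : has_deriv F t d1 -> has_deriv F t d2 -> d1 = d2.
Proof.
move=> H1 H2; apply/eqP; rewrite -subr_eq0 -normr_le0; apply/ler_addgt0Pl => e e0.
rewrite addr0; have e2 : 0 < e / 2 by rewrite divr_gt0.
have [r1 r10 {}H1] := has_deriv_slope H1 e2.
have [r2 r20 {}H2] := has_deriv_slope H2 e2.
pose r := Num.min r1 r2 / 2; have r0 : 0 < r by rewrite divr_gt0// lt_min r10.
have rr1 : r < r1 by rewrite /r ltr_pdivrMr// (@le_lt_trans _ _ r1) ?ge_min ?lexx//; lra.
have rr2 : r < r2 by rewrite /r ltr_pdivrMr// (@le_lt_trans _ _ r2) ?ge_min ?lexx ?orbT//; lra.
have tr : t <= t <= t + r by rewrite lexx/= lerDl ltW.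
have tr' : t < t + r by rewrite ltrDl.
have rE : t + r - t = r by rewrite addrAC subrr add0r.
have := H1 _ _ tr tr'; have := H2 _ _ tr tr'; rewrite !rE => /(_ rr2) A2 /(_ rr1) A1.
rewrite (_ : d1 - d2 = ((F (t + r) - F t) / r - d2) - ((F (t + r) - F t) / r - d1)); last by ring.
by rewrite (le_trans (ler_normB _ _))//; lra.
Qed.

(** Overlapping geodesics are related by such a change of parameter, with sg the
    relative direction. *)
Lemma has_deriv_flip F G t t0 d sg r : `|sg| = 1 -> 0 < r ->
  (forall s, `|s - t| < r -> G s = F (t0 + sg * (s - t))) ->
  has_deriv F t0 d -> has_deriv G t (sg * d).
Proof.
move=> sg1 r0 GF Fd e e0; have [r1 r10 Hr] := Fd e e0.
exists (Num.min r r1); first by rewrite lt_min r0.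
move=> s; rewrite lt_min => /andP[sr sr1].
rewrite !GF//; last by rewrite subrr normr0.
rewrite subrr mulr0 addr0; have := Hr (t0 + sg * (s - t)).
rewrite [t0 + _]addrC addrK normrM sg1 mul1r => /(_ sr1).
by rewrite mulrA (mulrC d).
Qed.

(** Lebesgue's differentiation theorem. *)
Lemma ae_has_deriv F k l : mu.-integrable setT (EFin \o k) ->
  (forall t, 0 <= t <= l -> F t - F 0 = \int[mu]_(x in `[0, t]) k x) ->
  {ae mu, forall t, 0 < t < l -> has_deriv F t (k t)}.
Proof.
move=> ik Fk.
have lk : locally_integrable setT k by have := integrable_locally measurableT ik; rewrite patch_setT.
have := lebesgue_differentiation lk; apply: filterS; first exact: (ae_filter_ringOfSetsType mu).
move=> t kt /andP[t0 tl].
have ik' : mu.-integrable [set` Interval (BLeft 0) (BRight (t + 1))] (EFin \o k).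
  exact: integrableS ik.
have tt1 : t < t + 1 by rewrite ltrDl.
have [|Gd GE] := @FTC1_lebesgue_pt R k (BLeft 0) t (t + 1) tt1 ik' _ kt.
  by rewrite (@lte_fin R).
set G := (fun y : R => _) in Gd GE.
have Gk : h^-1 *: (G (h *: 1 + t) - G t) @[h --> 0^'] --> k t.
  by rewrite -GE derive1E; exact: Gd.
move=> e e0.
move/cvgrPdist_le : Gk => /(_ e e0); rewrite /dnbhs/= => /nbhs_ballP[r /= r0 Hr].
pose d := Num.min r (Num.min t (l - t)).
have d0 : 0 < d by rewrite !lt_min r0 t0/= subr_gt0.
exists d => // s; rewrite !lt_min => /andP[sr /andP[st sl]].
have FG u : 0 <= u <= l -> F u - F 0 = G u by exact: Fk.
have s0l : 0 <= s <= l.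
  by move: st sl; rewrite !ltr_norml; lra.
have t0l : 0 <= t <= l by rewrite !ltW.
rewrite (_ : F s - F t = G s - G t); last by rewrite -!FG//; ring.
have [->|sNt] := eqVneq s t; first by rewrite !subrr mulr0 subrr normr0 mulr0.
have st0 : s - t != 0 by rewrite subr_eq0.
have := Hr (s - t); rewrite /ball/= sub0r normrN => /(_ sr st0).
rewrite /GRing.scale/= mulr1 subrK distrC => H.
rewrite (_ : _ - _ = (((s - t)^-1 * (G s - G t)) - k t) * (s - t)); last by field.
by rewrite normrM ler_wpM2r.
Qed.

End derivative.

(** * From slopes over fine partitions to the integral of the derivative *)

Section power_mean_integral.
Context d (T : measurableType d) (R : realType) (mu : {measure set T -> \bar R}).

(** Jensen's inequality for the normalized restriction of mu, by integrating the
    tangent inequality at the mean of h. *)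
Lemma integral_powR_mean (p l : R) (A : set T) (h : T -> R) : 1 < p ->
  measurable A -> mu A = l%:E -> (forall x, A x -> 0 <= h x) ->
  mu.-integrable A (EFin \o h) ->
  (((\int[mu]_(x in A) h x) `^ p)%:E <=
   (l `^ (p - 1))%:E * \int[mu]_(x in A) (h x `^ p)%:E)%E.
Proof.
move=> p1 mA Al h0 ih; have p0 : 0 < p by apply: lt_trans p1.
have [mh _] := integrableP _ _ _ ih.
have mh' : measurable_fun A h by apply/measurable_EFinP.
have l0 : 0 <= l by rewrite -lee_fin -Al.
have H0 : 0 <= \int[mu]_(x in A) h x by exact: Rintegral_ge0.
have [l00|ln0] := eqVneq l 0.
  suff -> : \int[mu]_(x in A) h x = 0 by rewrite powR0 ?gt_eqF// mule_ge0// ?lee_fin ?powR_ge0// integral_ge0// => x _; rewrite lee_fin powR_ge0.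
  by rewrite /Rintegral null_set_integral// Al l00.
have lp : 0 < l by rewrite lt_neqAle eq_sym ln0.
set H := \int[mu]_(x in A) h x in H0 *.
pose a := H / l; have a0 : 0 <= a by rewrite divr_ge0.
have HE : H = l * a by rewrite /a mulrCA divff ?mulr1.
have mhp : measurable_fun A (fun x => (h x `^ p)%:E).
  by apply/measurable_EFinP; exact: (measurableT_comp (measurable_powR p) mh').
have : (\int[mu]_(x in A) (p * a `^ (p - 1) * h x)%:E <=
        \int[mu]_(x in A) ((h x `^ p)%:E + ((p - 1) * a `^ p)%:E))%E.
  apply: ge0_le_integral => //.
  - by move=> x Ax; rewrite lee_fin !mulr_ge0 ?powR_ge0 ?h0// ltW.
  - by apply/measurable_EFinP; apply: measurable_funM.
  - by apply: emeasurable_funD.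
  - by move=> x Ax; rewrite -EFinD lee_fin powR_tangent ?h0.
rewrite ge0_integralD//; last 2 first.
- by move=> x _; rewrite lee_fin powR_ge0.
- by move=> x _; rewrite lee_fin mulr_ge0 ?powR_ge0// subr_ge0 ltW.
under eq_integral do rewrite EFinM.
rewrite ge0_integralZl//; last first.
  by rewrite lee_fin mulr_ge0 ?powR_ge0// ltW.
have -> : (\int[mu]_(x in A) (h x)%:E)%E = H%:E.
  by rewrite /H /Rintegral fineK//; exact: integrable_fin_num.
rewrite integral_cst// Al -!EFinM => le1.
have : (((l * a `^ p)%:E <= \int[mu]_(x in A) (h x `^ p)%:E)%E).
  rewrite -(@leeD2rE _ ((p - 1) * a `^ p * l)%:E)//.
  apply: le_trans le1; rewrite -EFinD lee_fin HE.
  rewrite -(mulr_powRB1 a0 p0); lra.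
move=> le2; apply: (@le_trans _ _ ((l `^ (p - 1))%:E * (l * a `^ p)%:E)%E).
  rewrite -EFinM lee_fin HE powRM// -(mulr_powRB1 l0 p0); lra.
by rewrite lee_wpmul2l// lee_fin powR_ge0.
Qed.
End power_mean_integral.

Section liminf.
Context {R : realType}.
Implicit Type u : (\bar R)^nat.

Lemma limn_einf_le u (B : \bar R) : (\forall n \near \oo, (u n <= B)%E) ->
  (limn_einf u <= B)%E.
Proof.
move=> uB; rewrite limn_einf_lim; apply: lime_le; first exact: is_cvg_einfs.
apply: filterS uB => n; apply: le_trans; apply: ereal_inf_lbound.
by exists n => //=.
Qed.

Lemma limn_einf_ge u (a : R^nat) (l : R) : a n @[n --> \oo] --> l ->
  (forall n, ((a n)%:E <= u n)%E) -> (l%:E <= limn_einf u)%E.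
Proof.
move=> al au; apply/lee_addgt0Pr => e e0; rewrite -leeBlDr// limn_einf_lim.
apply: lime_ge; first exact: is_cvg_einfs.
move/cvgrPdist_le : al => /(_ e e0)[N _ HN]; exists N => // n Nn.
apply: le_ereal_inf_tmp => _ [m /= nm <-]; apply: le_trans (au m).
rewrite -EFinB lee_fin; have := HN m (leq_trans Nn nm); rewrite /= ler_norml; lra.
Qed.

End liminf.

Section step_slopes.
Context {R : realType}.
Local Notation mu := (@lebesgue_measure R).

Definition mesh (l : R) (n : nat) : R := l / n.+1%:R.

Definition cell (l : R) (n j : nat) : set R :=
  `[j%:R * mesh l n, j.+1%:R * mesh l n[%classic.

Definition slope_energy (p : R) (F : R -> R) (l : R) (n j : nat) : R :=
  `|F (j.+1%:R * mesh l n) - F (j%:R * mesh l n)| `^ p / mesh l n `^ (p - 1).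

(** The p-th powers of the slopes, put on the cells meeting K i, form functions
    whose lower limit at t in K i is at least |k i t|^p, since the cell around t
    shrinks to t; Fatou's lemma concludes. Only cells that meet the sets are
    counted, so that arcs which overlap outside these sets do not interfere. *)
Lemma slopes_fatou (p : R) N (F k : 'I_N -> R -> R) (l : 'I_N -> R)
    (K : 'I_N -> set R) (B : R) : 1 < p ->
  (forall i, 0 < l i) -> (forall i, measurable (K i)) ->
  (forall i, K i `<=` `]0, l i[) ->
  (forall i, measurable_fun setT (k i)) ->
  (forall i, {ae mu, forall t, K i t -> has_deriv (F i) t (k i t)}) ->
  (\forall n \near \oo, \sum_(i < N)
     \sum_(j < n.+1 | `[< cell (l i) n j `&` K i !=set0 >])
        slope_energy p (F i) (l i) n j <= B) ->
  (\sum_(i < N) \int[mu]_(t in K i) (`|k i t| `^ p)%:E <= B%:E)%E.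
Proof.
move=> p1 l0 mK Kl mk Fk HB.
pose c i n j := `|(F i (j.+1%:R * mesh (l i) n) - F i (j%:R * mesh (l i) n)) / mesh (l i) n| `^ p.
pose w i n j := if `[< cell (l i) n j `&` K i !=set0 >] then c i n j else 0.
pose u i n t : R := \sum_(j < n.+1) w i n j * \1_(cell (l i) n j) t.
have m0 i n : 0 < mesh (l i) n by rewrite divr_gt0// ltr0n.
have w0 i n j : 0 <= w i n j by rewrite /w; case: ifP => // _; rewrite powR_ge0.
have mcell i n j : measurable (cell (l i) n j) by exact: measurable_itv.
have muc i n j : mu (cell (l i) n j) = (mesh (l i) n)%:E.
  rewrite /cell lebesgue_measure_itv/= lte_fin ltr_pM2r// ltr_nat ltnSn.
  by rewrite -EFinB -mulrBl -natrB// subSnn mul1r.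
have u0 i n t : 0 <= u i n t by apply: sumr_ge0 => j _; rewrite mulr_ge0.
have mi i n j : measurable_fun setT (\1_(cell (l i) n j) : R -> R).
  exact: measurable_indic.
have mw i n j : measurable_fun setT (fun t => w i n j * \1_(cell (l i) n j) t).
  by apply: measurable_funM => //; exact: measurable_indic.
have mu_ i n : measurable_fun setT (u i n) by exact: measurable_sum.
have iu i n : (\int[mu]_t (u i n t)%:E =
    (\sum_(j < n.+1 | `[< cell (l i) n j `&` K i !=set0 >])
        slope_energy p (F i) (l i) n j)%:E)%E.
  under eq_integral do rewrite -sumEFin.
  rewrite ge0_integral_sum//; last 2 first.
  - by move=> j; apply/measurable_EFinP; exact: mw.
  - by move=> j t _; rewrite lee_fin mulr_ge0.
  rewrite [in RHS]big_mkcond -sumEFin/=; apply: eq_bigr => j _.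
  under eq_integral do rewrite EFinM.
  rewrite ge0_integralZl_EFin//; last by apply/measurable_EFinP; exact: mi.
  rewrite integral_indic; [|exact: measurableT|exact: mcell].
  rewrite setIT [X in (_ * X)%E]muc -EFinM /w; congr EFin.
  case: ifP => _; last by rewrite mul0r.
  by rewrite /c normrM normfV (gtr0_norm (m0 i n)) powR_slope.
pose s i n t := let j := Num.truncn (t / mesh (l i) n) in
  (F i (j.+1%:R * mesh (l i) n) - F i (j%:R * mesh (l i) n)) / mesh (l i) n.
have us i n t : K i t -> `|s i n t| `^ p <= u i n t.
  move=> Kt; pose j := Num.truncn (t / mesh (l i) n).
  have := Kl i t Kt; rewrite /= in_itv/= => /andP[t0 tl].
  have jt : j%:R * mesh (l i) n <= t.
    by rewrite -ler_pdivlMr// /j truncn_le ?divr_ge0// ltW.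
  have tj : t < j.+1%:R * mesh (l i) n by rewrite -ltr_pdivrMr// truncnS_gt.
  have jn : (j < n.+1)%N.
    rewrite -(ltr_nat R) -(ltr_pM2r (m0 i n)) (le_lt_trans jt)//.
    by rewrite /mesh mulrCA divff ?mulr1// pnatr_eq0.
  rewrite /u (bigD1 (Ordinal jn))//= ler_wpDr//.
    by apply: sumr_ge0 => ? _; rewrite mulr_ge0.
  have ct : cell (l i) n j t by rewrite /cell/= in_itv/= jt.
  rewrite indicE mem_set// mulr1 /w asboolT//.
  by exists t.
have scvg i t : K i t -> has_deriv (F i) t (k i t) -> s i n t @[n --> \oo] --> k i t.
  move=> Kt Fd; apply/cvgrPdist_le => e e0.
  have [r r0 Hr] := has_deriv_slope Fd e0.
  have := Kl i t Kt; rewrite /= in_itv/= => /andP[t0 tl].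
  near=> n; rewrite distrC /s; set j := Num.truncn _.
  have jt : j%:R * mesh (l i) n <= t.
    by rewrite -ler_pdivlMr// /j truncn_le ?divr_ge0// ltW.
  have tj : t < j.+1%:R * mesh (l i) n by rewrite -ltr_pdivrMr// truncnS_gt.
  have jE : j.+1%:R * mesh (l i) n - j%:R * mesh (l i) n = mesh (l i) n.
    by rewrite -mulrBl -natrB// subSnn mul1r.
  rewrite -{3}jE; apply: Hr; rewrite ?jE ?jt ?(ltW tj)//.
    exact: le_lt_trans tj.
  rewrite /mesh ltr_pdivrMr ?ltr0n// mulrC -ltr_pdivrMr//.
  rewrite (lt_le_trans (truncnS_gt _))// ler_nat ltnS.
  by near: n; exists (Num.truncn (l i / r)).
pose v n t := \sum_(i < N) u i n t.
have v0 n t : 0 <= v n t by exact: sumr_ge0.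
have mv n : measurable_fun setT (fun t => (v n t)%:E).
  by apply/measurable_EFinP; exact: measurable_sum.
have := fatou mu measurableT mv (fun n t _ => v0 n t).
have Fae : {ae mu, forall t i, K i t -> has_deriv (F i) t (k i t)}.
  apply: filter_forall => //; exact: (ae_filter_ringOfSetsType mu).
have : (\sum_(i < N) \int[mu]_(t in K i) (`|k i t| `^ p)%:E <=
    \int[mu]_t limn_einf (fun n => (v n t)%:E))%E.
  have mk' i : measurable_fun setT (fun t => (`|k i t| `^ p)%:E).
    apply/measurable_EFinP; apply: (measurableT_comp (measurable_powR p)).
    exact: measurableT_comp.
  under eq_bigr do rewrite integral_mkcond.
  rewrite -ge0_integral_sum//; last 2 first.
  - by move=> i; apply/(measurable_restrictT _ (mK i)); exact: measurable_funTS.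
  - by move=> i t _; rewrite patchE; case: ifP => // _; rewrite lee_fin powR_ge0.
  apply: ae_ge0_le_integral => //.
  - move=> t _; apply: sume_ge0 => i _.
    by rewrite patchE; case: ifP => // _; rewrite lee_fin powR_ge0.
  - apply: emeasurable_sum => i; apply/(measurable_restrictT _ (mK i)); exact: measurable_funTS.
  - move=> t _; apply: (@limn_einf_ge _ _ (cst 0) 0); first exact: cvg_cst.
    by move=> n; rewrite lee_fin.
  - apply: (measurableT_comp (@oppe_measurable R setT)).
    apply: measurable_fun_limn_esup => n; apply: (measurableT_comp (@oppe_measurable R setT)).
    exact: mv.
  - apply: filterS Fae; first exact: (ae_filter_ringOfSetsType mu).
    move=> t Ft _.
    pose a n := \sum_(i < N) if t \in K i then `|k i t| `^ p + p * `|k i t| `^ (p - 1) * (`|s i n t| - `|k i t|) else 0.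
    rewrite (_ : (\sum_(i < N) _)%E = (\sum_(i < N) if t \in K i then `|k i t| `^ p else 0)%:E); last first.
      by rewrite -sumEFin; apply: eq_bigr => i _; rewrite patchE; case: ifP.
    apply: (@limn_einf_ge _ _ a).
      apply: (cvg_big add_continuous) => i _; case: ifPn => [/set_mem Kt|_]; last exact: cvg_cst.
      rewrite -[X in _ --> X]addr0; apply: cvgD; first exact: cvg_cst.
      rewrite -[X in _ --> X](mulr0 (p * `|k i t| `^ (p - 1))); apply: cvgMr.
      by rewrite -(subrr `|k i t|); apply: cvgB; [apply: cvg_norm; exact: scvg (Ft i Kt)|exact: cvg_cst].
    move=> n; rewrite lee_fin; apply: ler_sum => i _; case: ifPn => // /set_mem Kt.
    apply: le_trans (us i n t Kt).
    have := powR_tangent p1 (normr_ge0 (s i n t)) (normr_ge0 (k i t)).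
    rewrite -[X in _ <= _ + (p - 1) * X](mulr_powRB1 (normr_ge0 (k i t)) (lt_trans ltr01 p1)).
    rewrite -[X in X + _ <= _](mulr_powRB1 (normr_ge0 (k i t)) (lt_trans ltr01 p1)).
    lra.
move=> H1 H2; apply: (le_trans H1); apply: (le_trans H2).
apply: limn_einf_le; apply: filterS HB => n; rewrite /v.
under eq_integral do rewrite -sumEFin.
rewrite ge0_integral_sum//; last 2 first.
- by move=> i; apply/measurable_EFinP; exact: mu_.
- by move=> i t _; rewrite lee_fin.
rewrite (eq_bigr _ (fun i _ => iu i n)).
by rewrite sumEFin lee_fin.
Unshelve. all: by end_near. Qed.
End step_slopes.

Section compact_approximation.
Context {R : realType}.
Local Notation mu := (@lebesgue_measure R).

(** Inner regularity of Lebesgue measure, carried over to the measure of density w. *)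
Lemma integral_compact_approx (D : set R) (w : R -> \bar R) : measurable D ->
  (mu D < +oo)%E -> measurable_fun D w -> (forall t, D t -> (0 <= w t)%E) ->
  exists K : nat -> set R, [/\ forall j, compact (K j), forall j, K j `<=` D &
    (\int[mu]_(t in K j) w t)%E @[j --> \oo] --> (\int[mu]_(t in D) w t)%E].
Proof.
move=> mD fD mw w0.
have e0 j : 0 < j.+1%:R^-1 :> R by rewrite invr_gt0.
have [C HC] := choice (fun j => lebesgue_regularity_inner mD fD (e0 j)).
pose K j := \big[setU/set0]_(i < j.+1) C i.
have cK j : compact (K j) by apply: bigsetU_compact => i _; have [] := HC i.
have KD j : K j `<=` D.
  by rewrite /K -bigcup_mkord => t [i _ Ct]; have [_ + _] := HC i; apply.
have mK j : measurable (K j) by exact: compact_measurable.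
have mU : measurable (\bigcup_j K j) by exact: bigcup_measurable.
have UD : \bigcup_j K j `<=` D by apply: bigcup_sub => j _.
exists K; split => //.
have -> : (\int[mu]_(t in D) w t = \int[mu]_(t in \bigcup_j K j) w t)%E.
  pose N := D `\` \bigcup_j K j.
  have mN : measurable N by exact: measurableD.
  have N0 : mu N = 0%E.
    apply/eqP; rewrite eq_le measure_ge0 andbT; apply/lee_addgt0Pr => e ep.
    rewrite add0e; have [j _ /(_ j (leqnn j)) je] := near_infty_natSinv_lt (PosNum ep).
    have [_ _ H] := HC j; apply: (@le_trans _ _ (mu (D `\` C j))).
      apply: le_measure; rewrite ?inE//.
        by apply: measurableD => //; apply: compact_measurable; have [] := HC j.
      apply: setDS => t Ct; exists j => //; rewrite /K -bigcup_mkord.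
      by exists j => //=.
    by apply: (le_trans (ltW H)); rewrite lee_fin ltW.
  rewrite (@ge0_negligible_integral _ _ R mu D N w mN mD mw w0)//.
  by congr (integral _ _ _); rewrite /N setDD; apply/setIidPr.
apply: ge0_nondecreasing_set_cvg_integral => //.
- by move=> i j ij; apply/subsetPset; apply: subset_bigsetU.
- by move=> j; exact: measurable_funS mw.
- by move=> j t /KD; exact: w0.
Qed.

End compact_approximation.

(** * Lower and upper limits at zero from the right *)

Section limits_near_zero.
Context {R : realType}.
Implicit Types (E : R -> \bar R) (M : \bar R).

(** Energies are only compared at small scales. *)
Lemma limf_einf_mono E E' : (\forall r \near 0^'+, (E r <= E' r)%E) ->
  (limf_einf E 0^'+ <= limf_einf E' 0^'+)%E.
Proof.
move=> EE; rewrite !limf_einfE; apply: ge_ereal_sup => _ [W nW <-].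
apply: le_trans (ereal_sup_ubound _); last first.
  by exists (W `&` [set r | (E r <= E' r)%E]); [exact: filterI|reflexivity].
apply: le_ereal_inf_tmp => _ [r [Wr Er] <-]; apply: le_trans Er.
by apply: ereal_inf_lbound; exists r.
Qed.

Lemma limf_einf_ge E M : (\forall r \near 0^'+, (M <= E r)%E) ->
  (M <= limf_einf E 0^'+)%E.
Proof.
move=> ME; rewrite limf_einfE; apply: le_trans (ereal_sup_ubound _); last first.
  by exists [set r | (M <= E r)%E]; [exact: ME|reflexivity].
by apply: le_ereal_inf_tmp => _ [r Mr <-].
Qed.

Lemma limf_einf_le E M : (\forall r \near 0^'+, (E r <= M)%E) ->
  (limf_einf E 0^'+ <= M)%E.
Proof.
move=> EM; rewrite limf_einfE; apply: ge_ereal_sup => _ [W nW <-].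
have [r [Wr Er]] := filter_ex (filterI nW EM).
by apply: le_trans Er; apply: ereal_inf_lbound; exists r.
Qed.

Lemma limf_esup_le E M : (\forall r \near 0^'+, (E r <= M)%E) ->
  (limf_esup E 0^'+ <= M)%E.
Proof.
move=> EM; rewrite limf_esupE.
apply: (@le_trans _ _ (ereal_sup [set E r | r in [set r | (E r <= M)%E]])).
  by apply: ereal_inf_lbound; exists [set r | (E r <= M)%E].
by apply: ge_ereal_sup => _ [r Er <-].
Qed.

Lemma limsup_bound (E : R -> \bar R) : (limf_esup E 0^'+ < +oo)%E ->
  exists (M r1 : R), [/\ 0 < M, 0 < r1 & forall r, 0 < r < r1 -> (E r <= M%:E)%E].
Proof.
rewrite limf_esupE => /ereal_inf_lt[_ [V [e /= e0 He] <-]] sfin.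
have Ve r : 0 < r < e -> V r.
  move=> /andP[rp re]; apply: He => //=.
  by rewrite sub0r normrN gtr0_norm.
have up r : 0 < r < e -> (E r <= ereal_sup [set E x | x in V])%E.
  by move=> re; apply: ereal_sup_ubound; exists r => //; exact: Ve.
case: (ereal_sup _) sfin up => [s _ up|//|_ up].
  exists (`|s| + 1), e; split => //.
  move=> r re; apply: le_trans (up r re) _; rewrite lee_fin.
  by rewrite (le_trans (ler_norm s))// lerDl.
by exists 1, e; split => // r re; apply: le_trans (up r re) _; rewrite leNye.
Qed.

(** A lower limit is approached at scales where finitely many other conditions,
    valid near zero, hold as well. *)
Lemma liminf_lt_ex (E : R -> \bar R) L L' (W : set R) : (limf_einf E 0^'+ <= L)%E ->
  (L < L')%E -> (\forall r \near 0^'+, W r) -> exists2 r, W r & (E r < L')%E.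
Proof.
move=> EL LL nW; apply: contrapT => nex.
have : (L' <= limf_einf E 0^'+)%E.
  rewrite limf_einfE; apply: le_trans (ereal_sup_ubound _); last by exists W.
  apply: le_ereal_inf_tmp => _ [r Wr <-]; rewrite leNgt; apply/negP => H.
  by apply: nex; exists r.
by rewrite leNgt (le_lt_trans EL LL).
Qed.

End limits_near_zero.

(** * Geodesics in metric spaces and in real trees *)

Section metric.
Context {R : realType} {X : pointedMetricType R}.
Implicit Types (x y z u v : X) (phi psi gam : R -> X) (l s t r : R).

Lemma mball x r y : ball x r y = (mdist x y < r).
Proof. by rewrite ballEmdist. Qed.

Definition geodesic phi l := forall s t, 0 <= s <= l -> 0 <= t <= l ->
  mdist (phi s) (phi t) = `|s - t|.

Lemma geodesic_dist0 phi l t : geodesic phi l -> 0 <= t <= l ->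
  mdist (phi 0) (phi t) = t.
Proof.
move=> g /andP[t0 tl]; rewrite g ?lexx ?t0 ?(le_trans t0)//.
by rewrite sub0r normrN ger0_norm.
Qed.

Lemma geodesic_rev phi l : geodesic phi l -> geodesic (fun t => phi (l - t)) l.
Proof.
move=> g s t s0 t0; rewrite g; [|lra|lra].
by rewrite (_ : l - s - (l - t) = t - s) 1?distrC//; ring.
Qed.

Lemma geodesic_shift phi l a b : geodesic phi l -> 0 <= a -> b <= l ->
  geodesic (fun t => phi (a + t)) (b - a).
Proof.
move=> g a0 bl s t s0 t0; rewrite g; [|lra|lra].
by congr (`|_|); ring.
Qed.

Lemma isom_geodesic (A : set X) u v phi : isometric_embedding A u v phi ->
  [/\ geodesic phi (mdist u v), phi 0 = u, phi (mdist u v) = v &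
      forall t, 0 <= t <= mdist u v -> A (phi t)].
Proof.
by move=> [p0 p1 pA pd]; split.
Qed.

Lemma geodesic_isom (A : set X) phi l : geodesic phi l -> 0 <= l ->
  (forall t, 0 <= t <= l -> A (phi t)) ->
  isometric_embedding A (phi 0) (phi l) phi.
Proof.
move=> g l0 gA; have dl : mdist (phi 0) (phi l) = l.
  by rewrite (geodesic_dist0 g)// l0 lexx.
by split; rewrite ?dl.
Qed.

Lemma geodesic_ball phi l r : geodesic phi l -> l < r ->
  forall t, 0 <= t <= l -> ball (phi 0) r (phi t).
Proof.
move=> g lr t tl; rewrite mball (geodesic_dist0 g)//.
by case/andP: tl => _ /le_lt_trans; apply.
Qed.

(** Composing with clamp l extends a geodesic continuously beyond its endpoints. *)
Definition clamp l t : R := Num.max 0 (Num.min l t).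

Lemma clamp_itv l t : 0 <= l -> 0 <= clamp l t <= l.
Proof.
by move=> l0; rewrite /clamp le_max lexx/= ge_max l0 ge_min lexx.
Qed.

Lemma clamp_id l t : 0 <= t <= l -> clamp l t = t.
Proof. by move=> /andP[t0 tl]; rewrite /clamp min_r// max_r. Qed.

Lemma clamp_lip l s t : 0 <= l -> `|clamp l s - clamp l t| <= `|s - t|.
Proof.
move=> l0; rewrite /clamp /Num.max /Num.min.
have := ler_norm (s - t); have := ler_norm (t - s); rewrite (distrC t) ler_norml.
by case: (ltP l s) => ?; case: (ltP l t) => ?; do 2?case: ltP => ?; lra.
Qed.

Lemma lipschitz_continuous phi : (forall s t, mdist (phi s) (phi t) <= `|s - t|) ->
  continuous phi.
Proof.
move=> H t; apply/cvg_ballP => e e0.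
by apply/nbhs_ballP; exists e => //= s st; rewrite mball (le_lt_trans (H _ _)).
Qed.

Lemma geodesic_clamp_continuous phi l : geodesic phi l -> 0 <= l ->
  continuous (phi \o clamp l).
Proof.
move=> g l0; apply: lipschitz_continuous => s t /=.
by rewrite g ?clamp_itv// clamp_lip.
Qed.

(** Let gam run from v to the starting point a of phi. If v is closer to a than z =
    phi t0 is, follow gam until it first hits phi and then follow phi: this is an
    injective path from v to the end of phi, it contains z because the hitting
    point is nearer to a than z, and in a tree the geodesic has the same image. *)
Lemma tree_geodesic_through (A : set X) phi gam l d1 t0 : is_tree A ->
  geodesic phi l -> (forall t, 0 <= t <= l -> A (phi t)) ->
  geodesic gam d1 -> (forall t, 0 <= t <= d1 -> A (gam t)) ->
  gam d1 = phi 0 -> 0 <= d1 -> d1 < t0 -> t0 <= l ->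
  exists psi, isometric_embedding A (gam 0) (phi l) psi /\
    exists2 t1, 0 <= t1 <= mdist (gam 0) (phi l) & psi t1 = phi t0.
Proof.
move=> [_ tA] gp pA gg gA gp0 d10 d1t0 t0l.
pose E := [set t | 0 <= t <= d1 /\ gam t = phi (d1 - t)].
have Ed1 : E d1 by split; rewrite ?d10 ?lexx// subrr.
have Elb : lbound E 0 by move=> t [/andP[]].
have infE : has_inf E by split; [exists d1|exists 0].
pose tau := inf E.
have tau0 : 0 <= tau by apply: lb_le_inf => //; exists d1.
have taud : tau <= d1 by apply: inf_lbound => //; exists 0.
have Ehit t s : 0 <= t <= d1 -> 0 <= s <= l -> gam t = phi s -> E t /\ s = d1 - t.
  move=> td sl gt; have sE : s = d1 - t.
    rewrite -(geodesic_dist0 gp sl) -gt -gp0 gg//; last by rewrite d10 lexx.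
    by rewrite ger0_norm//; lra.
  by split=> //; split=> //; rewrite -sE.
have Etau : gam tau = phi (d1 - tau).
  apply: mdist_positivity; apply/eqP; rewrite eq_le mdist_ge0 andbT.
  apply/ler_addgt0Pl => e e0; rewrite addr0.
  have [t Et tt] := inf_adherent (divr_gt0 e0 (ltr0n _ 2)) infE.
  have taut : tau <= t by apply: inf_lbound => //; exists 0.
  case: Et => /andP[t_0 td] gt.
  rewrite (le_trans (metric_triangle _ (gam t) _))//.
  rewrite gg ?tau0 ?t_0// gt gp; [|lra|lra].
  rewrite (_ : d1 - t - (d1 - tau) = - (t - tau)); last by ring.
  by rewrite normrN (distrC tau) ger0_norm ?subr_ge0//; rewrite -/tau in tt; lra.
(* the path follows gam up to time tau and then phi from d1 - tau to l *)
pose L := l - d1 + 2 * tau.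
have L0 : 0 < L by rewrite /L; lra.
pose k0 t := if t <= tau then gam t else phi (d1 - 2 * tau + t).
pose k := k0 \o (fun t => L * t) \o clamp 1.
have k0lip s t : 0 <= s <= L -> 0 <= t <= L -> s <= t -> mdist (k0 s) (k0 t) <= t - s.
  move=> sL tL st; rewrite /k0; case: (leP s tau) => st1; case: (leP t tau) => tt1.
  - by rewrite gg ?(distrC s) ?ger0_norm//; lra.
  - rewrite (le_trans (metric_triangle _ (gam tau) _))// gg; [|lra|lra].
    rewrite Etau gp; [|rewrite /L in tL; lra|rewrite /L in tL; lra].
    by rewrite distrC ger0_norm ?subr_ge0// distrC ger0_norm; lra.
  - lra.
  - rewrite gp; [|rewrite /L in sL; lra|rewrite /L in tL; lra].
    by rewrite distrC ger0_norm; lra.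
have kcont : continuous k.
  have : continuous (k0 \o clamp L).
    apply: lipschitz_continuous => s t; apply: le_trans (clamp_lip s t (ltW L0)).
    have cs := clamp_itv s (ltW L0); have ct := clamp_itv t (ltW L0).
    case/orP: (le_total (clamp L s) (clamp L t)) => st.
      by rewrite distrC ger0_norm ?subr_ge0//; exact: k0lip.
    by rewrite metric_sym ger0_norm ?subr_ge0//; exact: k0lip.
  move=> cont; have -> : k = (k0 \o clamp L) \o (fun t => L * t).
    apply/funext => t; rewrite /k/= /clamp; congr k0.
    by rewrite maxr_pMr ?(ltW L0)// minr_pMr ?(ltW L0)// mulr0 mulr1.
  move=> t; apply: continuous_comp; last exact: cont.
  exact: mulrl_continuous.
have kE t : 0 <= t <= 1 -> k t = k0 (L * t) by move=> t01; rewrite /k/= clamp_id.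
have LI t : 0 <= t <= 1 -> 0 <= L * t <= L.
  by move=> /andP[t_0 t1]; rewrite mulr_ge0 ?(ltW L0)//= ler_piMr// ltW.
have k0A t : 0 <= t <= L -> A (k0 t).
  by move=> tL; rewrite /k0; case: leP => tt; [apply: gA|apply: pA]; rewrite /L in tL; lra.
have k0inj' s t : 0 <= s <= tau -> tau < t <= L -> gam s <> phi (d1 - 2 * tau + t).
  move=> st tt /Ehit[||Es]; rewrite /L in tt; [lra|lra|].
  have : tau <= s by apply: inf_lbound => //; exists 0.
  by lra.
have k0inj s t : 0 <= s <= L -> 0 <= t <= L -> k0 s = k0 t -> s = t.
  move=> sL tL; rewrite /k0; case: (leP s tau) => st1; case: (leP t tau) => tt1.
  - move=> E1; apply/eqP; rewrite -subr_eq0 -normr_eq0 -gg ?E1 ?mdistxx//; lra.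
  - move=> E1; exfalso; apply: (k0inj' s t) => //; lra.
  - move=> E1; exfalso; apply: (k0inj' t s) => //; lra.
  - move=> E1; apply/eqP; rewrite -subr_eq0 -normr_eq0.
    rewrite (_ : s - t = (d1 - 2 * tau + s) - (d1 - 2 * tau + t)); last by ring.
    rewrite -gp ?E1 ?mdistxx//; rewrite /L in sL tL; lra.
have := tA k (continuous_subspaceT kcont).
have k0E : k 0 = gam 0 by rewrite kE ?lexx ?ler01// mulr0 /k0 tau0.
have k1E : k 1 = phi l.
  rewrite kE ?lexx ?ler01// mulr1 /k0 leNgt (_ : tau < L) /=; last by rewrite /L; lra.
  by congr phi; rewrite /L; lra.
rewrite k0E k1E => kA.
have : closed_segment A (gam 0) (phi l) (phi t0).
  rewrite -kA.
  - pose w := (t0 - d1 + 2 * tau) / L.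
    have Lw : L * w = t0 - d1 + 2 * tau by rewrite /w mulrC divfK// gt_eqF.
    have w01 : 0 <= w <= 1.
      by rewrite divr_ge0 ?(ltW L0)//=; [rewrite ler_pdivrMr// mul1r /L|]; lra.
    exists w; first by rewrite /= in_itv.
    rewrite kE// Lw /k0 leNgt (_ : tau < _)/=; last by lra.
    by congr phi; lra.
  - move=> s t; rewrite !in_itv/= => s01 t01; rewrite !kE// => /k0inj E1.
    by apply: (mulfI (lt0r_neq0 L0)); apply: E1; exact: LI.
  - by move=> x [t tI <-]; move: tI; rewrite /= in_itv/= => t01; rewrite kE//; apply: k0A; exact: LI.
move=> [psi ipsi [t1 t1I t1E]]; move: t1I; rewrite /= in_itv/= => t1l.
by exists psi; split => //; exists t1.
Qed.

Lemma mdist_continuous x : continuous (mdist x).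
Proof.
move=> y; apply/cvgrPdist_lt => e e0; apply/nbhs_ballP; exists e => //= z.
rewrite mball => yz; apply: le_lt_trans yz; rewrite ler_norml.
have := metric_triangle x y z; have := metric_triangle x z y.
by rewrite (metric_sym z y); lra.
Qed.

End metric.

Section compact_arcs.
Context {R : realType} {X : pointedMetricType R}.
Implicit Types (A B : set X) (phi : R -> X) (K : set R).

(** The distance is continuous and positive on the compact product of A and B. *)
Lemma compacts_separated A B : compact A -> compact B -> A `&` B = set0 ->
  exists2 e, 0 < e & forall x y, A x -> B y -> e <= mdist x y.
Proof.
move=> cA cB dis; pose D (w : X * X) : R := mdist w.1 w.2.
have cD : continuous D.
  move=> w; apply/cvgrPdist_lt => e e0.
  have e2 : 0 < e / 2 by rewrite divr_gt0.
  exists (ball w.1 (e / 2), ball w.2 (e / 2)); first by split; exact: nbhsx_ballx.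
  move=> v [/=]; rewrite !mball => H1 H2.
  have T1 := metric_triangle w.1 v.1 w.2.
  have T2 := metric_triangle v.1 v.2 w.2.
  have T3 := metric_triangle v.1 w.1 v.2.
  have T4 := metric_triangle w.1 w.2 v.2.
  rewrite (metric_sym v.2) in T2; rewrite (metric_sym v.1 w.1) in T3.
  by rewrite /D ltr_norml; lra.
have cK : compact (D @` (A `*` B)).
  by apply: continuous_compact; [exact: continuous_subspaceT|exact: compact_setX].
have oK : open (~` (D @` (A `*` B))).
  by apply: closed_openC; apply: compact_closed => //.
have [|e /= e0 He] := (nbhs_ballP (0 : R) (~` (D @` (A `*` B)))).1 (open_nbhs_nbhs (conj oK _)).
  move=> [[x y] [/= Ax By]] /mdist_positivity /= xy.
  by rewrite -[False]/(set0 x) -dis; split=> //; rewrite xy.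
exists e => // x y Ax By; rewrite leNgt; apply/negP => xy.
apply: (He (D (x, y))); last by exists (x, y).
by rewrite /ball/= sub0r normrN ger0_norm ?mdist_ge0.
Qed.

Lemma geodesic_image_compact phi l K : geodesic phi l -> 0 <= l -> compact K ->
  K `<=` `[0, l] -> compact (phi @` K).
Proof.
move=> gp l0 cK Kl; rewrite (_ : phi @` K = (phi \o clamp l) @` K).
  apply: continuous_compact cK.
  by apply: continuous_subspaceT; exact: geodesic_clamp_continuous.
by apply: eq_imagel => t /Kl; rewrite /= in_itv/= => tl; rewrite clamp_id.
Qed.

End compact_arcs.

(** The default value x0 makes the enumeration total when A is empty. *)
Lemma countable_enum (T : Type) (x0 : T) (A : set T) : countable A ->
  exists e : nat -> T, A `<=` range e.
Proof.
move=> /pfcard_geP[->|[e]]; first by exists (fun=> x0).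
by exists e => x Ax; have [n _ <-] := 'surj_e Ax; exists n.
Qed.

(** * Complements of measure theory *)

Section almost_everywhere.
Context d (T : measurableType d) (R : realType) (mu : {measure set T -> \bar R}).

Lemma ae_imp (P Q : T -> Prop) : (forall x, P x -> Q x) ->
  {ae mu, forall x, P x} -> {ae mu, forall x, Q x}.
Proof.
move=> PQ [N [mN N0 PN]]; exists N; split => // x nQ; apply: PN => Px.
exact/nQ/PQ.
Qed.

Lemma ae_imp2 (P Q W : T -> Prop) : (forall x, P x -> Q x -> W x) ->
  {ae mu, forall x, P x} -> {ae mu, forall x, Q x} -> {ae mu, forall x, W x}.
Proof.
move=> PQW [N [mN N0 PN]] [M [mM M0 QM]]; exists (N `|` M); split.
- exact: measurableU.
- by rewrite measureU0.
- move=> x nW; have [Px|nP] := pselect (P x); last by left; exact: PN.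
  by right; apply: QM => Qx; exact/nW/PQW.
Qed.

End almost_everywhere.

Section good_points.
Context d (T : measurableType d) (R : realType) (mu : {measure set T -> \bar R}).

(** Otherwise the integral of h over B would exceed itself. *)
Lemma exists_le_mean (B : set T) (b : R) (h : T -> \bar R) : measurable B ->
  0 < b -> (b%:E <= mu B)%E -> measurable_fun B h ->
  (forall x, B x -> (0 <= h x)%E) ->
  exists2 x, B x & (h x * b%:E <= \int[mu]_(y in B) h y)%E.
Proof.
move=> mB b0 bB mh h0; apply: contrapT => nex.
have lt_h x : B x -> (\int[mu]_(y in B) h y < h x * b%:E)%E.
  by move=> Bx; rewrite ltNge; apply/negP => H; apply: nex; exists x.
have B0 : B !=set0.
  apply/set0P; apply/eqP => B0; move: bB; rewrite B0 measure0 lee_fin; lra.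
have I0 : (0 <= \int[mu]_(y in B) h y)%E by exact: integral_ge0.
have [x0 Bx0] := B0.
have Ifin : (\int[mu]_(y in B) h y)%E \is a fin_num.
  by rewrite ge0_fin_numE// (lt_le_trans (lt_h _ Bx0))// leey.
pose a := fine (\int[mu]_(y in B) h y)%E / b.
have a0 : 0 <= a by rewrite divr_ge0 ?fine_ge0// ltW.
have aI : (\int[mu]_(y in B) h y = (a * b)%:E)%E by rewrite /a divfK ?gt_eqF// fineK.
have ah x : B x -> (a%:E < h x)%E.
  move=> Bx; have := lt_h x Bx; rewrite aI EFinM lte_pmul2r//.
pose k x := (h x - a%:E)%E.
have k0 x : B x -> (0 <= k x)%E by move=> Bx; rewrite /k sube_ge0// ltW// ah.
have mk : measurable_fun B k by apply: emeasurable_funB.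
have hk : (\int[mu]_(y in B) h y = \int[mu]_(y in B) k y + a%:E * mu B)%E.
  rewrite -integral_cst// -ge0_integralD//.
  by apply: eq_integral => x _; rewrite /k subeK.
have ik0 : (\int[mu]_(y in B) k y = 0)%E.
  apply/eqP; rewrite eq_le integral_ge0// andbT.
  have H : (\int[mu]_(y in B) k y + (a * b)%:E <= 0 + (a * b)%:E)%E.
    by rewrite add0e -{2}aI hk leeD2l// EFinM lee_wpmul2l ?lee_fin.
  by rewrite leeD2rE in H.
have : (\int[mu]_(y in B) `|k y| = 0)%E.
  by rewrite -ik0; apply: eq_integral => x; rewrite inE => Bx; rewrite gee0_abs// k0.
move=> /(ae_eq_integral_abs _ mB mk) [N [mN N0 BN]].
have : (mu B <= mu N)%E.
  apply: le_measure; rewrite ?inE// => x Bx; apply: BN => /=.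
  move=> /(_ Bx) kx; have := ah x Bx; rewrite -sube_gt0 -/(k x) kx ltxx//.
by rewrite N0 => /(le_trans bB); rewrite lee_fin; lra.
Qed.

End good_points.

Section product_distance.
Context {R : realType} {X : pointedMetricType R}.

Lemma mball_open (x : X) r : open (ball x r).
Proof.
rewrite (_ : ball x r = mdist x @^-1` [set t | t < r]).
  by apply: open_comp; [move=> y _; exact: mdist_continuous|exact: open_lt].
by apply/seteqP; split => y; rewrite /= mball.
Qed.

(** Without separability the distance may fail to be measurable for a product
    sigma-algebra; with it, the set is a countable union of products of balls
    centred on a dense sequence. The maps i1 and i2 allow the two factors to carry
    different sigma-algebras, Borel sets on one side and segments on the other. *)
Lemma mdist_lt_measurable d1 d2 (T1 : measurableType d1) (T2 : measurableType d2)
    (i1 : T1 -> X) (i2 : T2 -> X) (D : set T2) (r : R) : separable X ->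
  (forall x q, measurable (i1 @^-1` ball x q)) ->
  (forall x q, measurable (D `&` i2 @^-1` ball x q)) ->
  measurable [set w : T1 * T2 | D w.2 /\ mdist (i1 w.1) (i2 w.2) < r].
Proof.
move=> [E cE dE] m1 m2; have [e Ee] := countable_enum point cE.
rewrite (_ : [set _ | _] = \bigcup_(u : nat * rat)
    ((i1 @^-1` ball (e u.1) (ratr u.2)) `*` (D `&` i2 @^-1` ball (e u.1) (r - ratr u.2)))).
  apply: countable_bigcupT_measurable; first exact: countableP.
  by move=> u; apply: measurableX; [exact: m1|exact: m2].
apply/seteqP; split => [[x y] /= [Dy xy]|[x y] [[n q] _]].
  pose g := r - mdist (i1 x) (i2 y).
  have g0 : 0 < g / 4 by rewrite divr_gt0 ?subr_gt0.
  have [z [xz Ez]] := dE _ (ex_intro _ (i1 x) (ballxx _ g0)) (mball_open _ _).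
  have {}xz : mdist (i1 x) z < g / 4 by rewrite -mball.
  have [n _ nz] := Ee z Ez.
  pose a := mdist (i1 x) z.
  have ag : a < a + g / 4 by rewrite ltrDl.
  have [q] := rat_in_itvoo ag.
  rewrite in_itv/= => /andP[aq qa].
  exists (n, q) => //=; rewrite nz !mball; split; first by rewrite metric_sym.
  split=> //; have := metric_triangle z (i1 x) (i2 y).
  rewrite (metric_sym z (i1 x)) -/a; move: qa xz; rewrite -/a /g; lra.
rewrite /= !mball => -[xz [Dy yz]]; split => //.
apply: le_lt_trans (metric_triangle _ (e n) _) _.
by rewrite (metric_sym _ (e n)); lra.
Qed.

End product_distance.

Section sigma_finite_measures.
Context d (T : measurableType d) (R : realType) (mu : {measure set T -> \bar R}).

(** A copy of mu on which the sigma-finite structure, required for exchanging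
    integrals, is canonical. *)
Definition sigma_finite_of (_ : sigma_finite setT mu) : set T -> \bar R := mu.

Variable sf : sigma_finite setT mu.

HB.instance Definition _ := Measure.copy (sigma_finite_of sf) mu.

HB.instance Definition _ := @Measure_isSigmaFinite.Build _ _ _ (sigma_finite_of sf) sf.

End sigma_finite_measures.

Section disjoint_integrals.
Local Open Scope ereal_scope.
Context d (T : measurableType d) (R : realType) (mu : {measure set T -> \bar R}).

Lemma sum_integral_le (I : choiceType) (s : seq I) (F : I -> set T) (W : set T)
    (h : T -> \bar R) : uniq s -> (forall i, measurable (F i)) -> measurable W ->
  trivIset [set` s] F -> (forall i, i \in s -> F i `<=` W) ->
  measurable_fun W h -> (forall x, W x -> 0 <= h x) ->
  \sum_(i <- s) \int[mu]_(x in F i) h x <= \int[mu]_(x in W) h x.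
Proof.
move=> us mF mW tF FW mh h0.
have UW : \big[setU/set0]_(i <- s) F i `<=` W.
  by rewrite -bigcup_seq => x [i /= si]; exact: FW.
have mU : measurable (\big[setU/set0]_(i <- s) F i) by exact: bigsetU_measurable.
rewrite -ge0_integral_bigsetU//.
- exact: ge0_subset_integral.
- exact: measurable_funS mh.
- by move=> x /UW; exact: h0.
Qed.

End disjoint_integrals.

Section borel_sets.
Context {R : realType} {X : pointedMetricType R}.
Implicit Types (x : X) (r : R) (U : set X).

Lemma open_borel U : open U -> measurable (U : set (borel X)).
Proof. by move=> oU; exact: sub_sigma_algebra. Qed.

Lemma ball_borel x r : measurable (ball x r : set (borel X)).
Proof. by apply: open_borel; exact: mball_open. Qed.

Lemma continuous_borel (f : X -> R) : continuous f ->
  measurable_fun setT (f : borel X -> R).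
Proof.
move=> cf; apply: (measurability _ (RGenOpens.measurableE R)).
move=> _ [_ [a [b ->]] <-]; rewrite setTI; apply: open_borel.
apply: open_comp; last exact: interval_open.
by move=> x _; exact: cf.
Qed.

End borel_sets.

(** * The Korevaar-Schoen energy and oscillations along arcs *)

Section energy.
Context {R : realType} {X : pointedMetricType R}.
Hypothesis hsep : separable X.
Variable m : {measure set (borel X) -> \bar R}.
Variables (r0 : R) (Phi : R -> R) (alpha c C p : R).
Hypotheses (r00 : 0 < r0) (Phi0 : {in `[0, r0], forall r, 0 <= Phi r})
  (Phind : {in `[0, r0] &, {homo Phi : r s / r <= s}})
  (c0 : 0 < c) (C0 : 0 < C)
  (doubling : forall r s, 0 < r -> r <= s -> s <= r0 ->
     c * (s / r) <= Phi s / Phi r <= C * (s / r) `^ alpha)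
  (mballP : forall x r, 0 < r < r0 ->
     ((c * Phi r)%:E <= m (ball x r) <= (C * Phi r)%:E)%E)
  (p1 : 1 < p).
Implicit Types (x y z : X) (f : X -> R) (r s t l : R).

Let p0 : 0 < p. Proof. exact: lt_trans p1. Qed.

Lemma Phi_gt0 r : 0 < r <= r0 -> 0 < Phi r.
Proof.
move=> /andP[rp rr]; have := doubling rp (lexx r) rr.
rewrite divff ?gt_eqF// mulr1 => /andP[H _].
rewrite lt_neqAle Phi0 ?in_itv/= ?(ltW rp)// andbT.
by apply/eqP => E; move: H; rewrite -E invr0 mulr0 leNgt c0.
Qed.

(** Constant comparing the measure of a ball of radius r / 8 with Phi r. *)
Let b := c / (C * 8 `^ alpha).

Let b0 : 0 < b.
Proof. by rewrite divr_gt0// mulr_gt0// powR_gt0. Qed.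

Lemma mball8 x r : 0 < r < r0 -> ((b * Phi r)%:E <= m (ball x (r / 8)))%E.
Proof.
move=> /andP[rp rr].
have r8 : 0 < r / 8 < r0 by rewrite divr_gt0//=; lra.
have /andP[H _] := mballP x r8; apply: le_trans H; rewrite lee_fin.
have r8' : 0 < r / 8 by case/andP: r8.
have rr' : r / 8 <= r by lra.
have /andP[_] := doubling r8' rr' (ltW rr).
rewrite (_ : r / (r / 8) = 8); last by field; rewrite gt_eqF.
have P8 : 0 < Phi (r / 8) by apply: Phi_gt0; lra.
rewrite ler_pdivrMr// => H.
rewrite /b -mulrA ler_pM2l// mulrC ler_pdivrMr ?mulr_gt0 ?powR_gt0//.
by rewrite mulrC.
Qed.

Lemma ball_sigma_finite : sigma_finite setT m.
Proof.
have [E cE dE] := hsep; have [e Ee] := countable_enum point cE.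
have r2 : 0 < r0 / 2 by rewrite divr_gt0.
exists (fun n => ball (e n) (r0 / 2)).
  apply/seteqP; split => // x _.
  have [z [xz Ez]] := dE _ (ex_intro _ x (ballxx x r2)) (mball_open x _).
  have [n _ nz] := Ee z Ez; exists n => //=; rewrite nz; exact: ball_sym.
move=> n; split; first exact: ball_borel.
have r2r : 0 < r0 / 2 < r0 by lra.
by have /andP[_ /le_lt_trans] := mballP (e n) r2r; apply; exact: ltry.
Qed.

Let ms : {sigma_finite_measure set (borel X) -> \bar R} := sigma_finite_of ball_sigma_finite.

(** The inner integral of the energy, without normalization by the volume of the
    ball: bounds on the measures of balls are applied once, in [energy_bounds]. *)
Definition inner f r x : \bar R := \int[m]_(y in ball x r) (`|f y - f x| `^ p)%:E.

Lemma inner_ge0 f r x : (0 <= inner f r x)%E.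
Proof. by apply: integral_ge0 => y _; rewrite lee_fin powR_ge0. Qed.

Lemma ball_integral_measurable r (H : borel X * borel X -> \bar R) :
  measurable_fun setT H -> (forall w, (0 <= H w)%E) ->
  measurable_fun setT ((fun x => \int[m]_(y in ball x r) H (x, y))%E : borel X -> \bar R).
Proof.
move=> mH H0; pose D := [set w : borel X * borel X | mdist w.1 w.2 < r].
have mD : measurable D.
  have := @mdist_lt_measurable R X _ _ (borel X) (borel X) idfun idfun setT r hsep.
  rewrite (_ : [set _ | _] = D); last by apply/seteqP; split => w /=; [case|].
  by apply => x q; rewrite ?setTI; exact: ball_borel.
pose F (w : borel X * borel X) : \bar R := (H w * (\1_D w)%:E)%E.
have mF : measurable_fun setT F.
  by apply: emeasurable_funM => //; apply/measurable_EFinP; exact: measurable_indic.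
have F0 w : (0 <= F w)%E by rewrite mule_ge0// lee_fin.
have := @measurable_fun_fubini_tonelli_F _ _ (borel X) (borel X) R ms F mF F0.
congr (measurable_fun _ _); apply/funext => x; rewrite /fubini_F/=.
rewrite [RHS]integral_mkcond; apply: eq_integral => y _.
rewrite patchE /F/= /D indicE.
have [K|K] := pselect (ball x r y).
  by rewrite !mem_set ?mule1//= -mball.
by rewrite !memNset ?mule0//= -mball.
Qed.

Lemma inner_measurable f r : measurable_fun setT (f : borel X -> R) ->
  measurable_fun setT (inner f r : borel X -> \bar R).
Proof.
move=> mf.
apply: (@ball_integral_measurable r (fun w => (`|f w.2 - f w.1| `^ p)%:E)).
  apply/measurable_EFinP; apply: (measurableT_comp (measurable_powR p)).
  apply: measurableT_comp => //; apply: measurable_funB; apply: (measurableT_comp mf).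
    exact: measurable_snd.
  exact: measurable_fst.
by move=> w; rewrite lee_fin powR_ge0.
Qed.

Lemma mball_measurable r :
  measurable_fun setT ((fun x => m (ball x r)) : borel X -> \bar R).
Proof.
have := @ball_integral_measurable r (fun=> 1%:E)%E (@measurable_cst _ _ _ _ _ _) (fun=> lee01).
congr (measurable_fun _ _); apply/funext => x.
by rewrite integral_cst ?mul1e//; exact: ball_borel.
Qed.

Lemma dist_powR_le (u v w : R) :
  `|u - v| `^ p <= 2 `^ (p - 1) * (`|w - u| `^ p + `|w - v| `^ p).
Proof.
have := @sum_powR_le R p 2 (fun i => if i == 0%N then w - u else w - v) p1 isT.
rewrite !big_ord_recl !big_ord0/= !addr0; apply: le_trans.
rewrite ge0_ler_powR ?nnegrE ?addr_ge0// ?(ltW p0)//.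
by rewrite (_ : u - v = (w - v) - (w - u)) ?(le_trans (ler_normB _ _))//; [rewrite addrC|ring].
Qed.

(** Average over y in B the inequality comparing f x and f x' through f y. *)
Lemma two_point f (B : set X) d x r x' r' : measurable_fun setT (f : borel X -> R) ->
  measurable (B : set (borel X)) -> (d%:E <= m B)%E -> B `<=` ball x r ->
  B `<=` ball x' r' ->
  ((`|f x - f x'| `^ p * d)%:E <= (2 `^ (p - 1))%:E * (inner f r x + inner f r' x'))%E.
Proof.
move=> mf mB dB Br Br'.
have mh z : measurable_fun setT (fun y : borel X => (`|f y - f z| `^ p)%:E).
  apply/measurable_EFinP; apply: (measurableT_comp (measurable_powR p)).
  by apply: measurableT_comp => //; exact: measurable_funB.
have mhB z : measurable_fun (B : set (borel X)) (fun y => (`|f y - f z| `^ p)%:E).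
  exact: measurable_funTS.
have P z y : (0 <= (`|f y - f z| `^ p)%:E)%E by rewrite lee_fin powR_ge0.
apply: (@le_trans _ _ (\int[m]_(y in B) (`|f x - f x'| `^ p)%:E)%E).
  by rewrite integral_cst// EFinM lee_wpmul2l// lee_fin powR_ge0.
apply: (@le_trans _ _ (\int[m]_(y in B) ((2 `^ (p - 1))%:E *
    ((`|f y - f x| `^ p)%:E + (`|f y - f x'| `^ p)%:E)))%E).
  apply: ge0_le_integral => //.
  - by apply: emeasurable_funM => //; apply: emeasurable_funD.
  - by move=> y By; rewrite -EFinD -EFinM lee_fin dist_powR_le.
rewrite ge0_integralZl_EFin//; last 2 first.
- by move=> y By; rewrite adde_ge0.
- by apply: emeasurable_funD.
rewrite lee_wpmul2l ?lee_fin ?powR_ge0// ge0_integralD// leeD// /inner.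
  by apply: ge0_subset_integral => //; [exact: ball_borel|exact: measurable_funTS].
by apply: ge0_subset_integral => //; [exact: ball_borel|exact: measurable_funTS].
Qed.

Definition tube (phi : R -> X) l r : set X :=
  (\bigcup_(t in `[0%R, l]%classic) ball (phi t) r)%classic.

Lemma tube_borel phi l r : measurable (tube phi l r : set (borel X)).
Proof. by apply: open_borel; apply: bigcup_open => t _; exact: mball_open. Qed.

(** Telescoping along a grid of step between r / 4 and r / 2. The balls of radius
    r / 8 around the grid points are disjoint, so their energies add up; in each of
    them some point has inner energy at most the mean, and neighbouring points are
    compared by [two_point]. *)
Lemma chain f (phi : R -> X) l r : measurable_fun setT (f : borel X -> R) ->
  geodesic phi l -> 0 < l -> 0 < r < r0 -> r <= 2 * l ->
  exists x x', [/\ ball (phi 0) (r / 8) x, ball (phi l) (r / 8) x' &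
    ((`|f x' - f x| `^ p * (r `^ (p - 1) * (b * Phi r) ^+ 2))%:E <=
     (2 `^ p * (4 * l) `^ (p - 1))%:E * \int[m]_(x in tube phi l r) inner f r x)%E].
Proof.
move=> mf gp l0 rr0 r2l; have /andP[rp rr] := rr0.
pose k := (Num.truncn (2 * l / r)).+1; pose h := l / k%:R.
have k0 : 0 < k%:R :> R by rewrite ltr0n.
have k1 : 2 * l < k%:R * r by rewrite -ltr_pdivrMr// truncnS_gt.
have k2 : k%:R * r <= 4 * l.
  have : (Num.truncn (2 * l / r))%:R <= 2 * l / r by rewrite truncn_le// divr_ge0 ?mulr_ge0// ltW.
  rewrite ler_pdivlMr// => H; rewrite /k -natr1 mulrDl mul1r; lra.
have hk : k%:R * h = l by rewrite /h mulrC divfK// gt_eqF.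
(* the step lies between r / 4 and r / 2: balls of radius r / 8 around grid points
   are disjoint, and those of radius r around points of neighbouring ones overlap *)
have h2 : h <= r / 2 by rewrite /h ler_pdivrMr//; lra.
have h4 : r / 4 <= h by rewrite /h ler_pdivlMr//; lra.
have hp : 0 < h by rewrite divr_gt0.
have ih i : (i <= k)%N -> 0 <= i%:R * h <= l.
  by move=> ik; rewrite mulr_ge0 ?(ltW hp)//= -hk ler_pM2r// ler_nat.
have P0 : 0 < b * Phi r by rewrite mulr_gt0// Phi_gt0// rp ltW.
pose B i : set X := ball (phi (i%:R * h)) (r / 8).
have mB i : measurable (B i : set (borel X)) by exact: ball_borel.
have mi := inner_measurable r mf.
pose J i : \bar R := (\int[m]_(x in B i) inner f r x)%E.
have J0 i : (0 <= J i)%E by apply: integral_ge0 => x _; exact: inner_ge0.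
have exu i : exists x : X, B i x /\ (inner f r x * (b * Phi r)%:E <= J i)%E.
  have mBi : measurable_fun (B i : set (borel X)) (inner f r) by exact: measurable_funTS.
  have [x Bx Hx] := exists_le_mean (mB i) P0 (mball8 _ rr0) mBi (fun x _ => inner_ge0 f r x).
  by exists x.
have [u Hu] := choice exu.
have du i : mdist (phi (i%:R * h)) (u i) < r / 8 by rewrite -mball; have [] := Hu i.
have step i : (i < k)%N -> ((`|f (u i) - f (u i.+1)| `^ p * (b * Phi r) ^+ 2)%:E <=
    (2 `^ (p - 1))%:E * (J i + J i.+1))%E.
  move=> ik; have iS : phi (i.+1%:R * h) = phi (i%:R * h + h) by rewrite -natr1 mulrDl mul1r.
  have dS : mdist (phi (i%:R * h)) (phi (i.+1%:R * h)) = h.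
    rewrite gp ?ih//; last exact: ltnW.
    by rewrite distrC -mulrBl -natrB// subSnn mul1r gtr0_norm.
  have B1 : B i `<=` ball (u i) r.
    move=> y; rewrite /B !mball => yi; have := metric_triangle (u i) (phi (i%:R * h)) y.
    by rewrite (metric_sym (u i) (phi _)); have := du i; lra.
  have B2 : B i `<=` ball (u i.+1) r.
    move=> y; rewrite /B !mball => yi; have := metric_triangle (u i.+1) (phi (i%:R * h)) y.
    have := metric_triangle (u i.+1) (phi (i.+1%:R * h)) (phi (i%:R * h)).
    by rewrite (metric_sym (u i.+1) (phi (i.+1%:R * h))) (metric_sym (phi (i.+1%:R * h)) (phi (i%:R * h))) dS;
      have := du i.+1; lra.
  have H := two_point mf (mB i) (mball8 _ rr0) B1 B2.
  rewrite expr2 mulrA EFinM.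
  apply: (@le_trans _ _ (((2 `^ (p - 1))%:E * (inner f r (u i) + inner f r (u i.+1))) * (b * Phi r)%:E)%E).
    by rewrite lee_wpmul2r// lee_fin ltW.
  rewrite -muleA lee_wpmul2l ?lee_fin ?powR_ge0// ge0_muleDl ?inner_ge0//.
  by apply: leeD; [have [] := Hu i|have [] := Hu i.+1].
pose s := index_iota 0 k.+1.
have sumJ : (\sum_(i <- s) J i <= \int[m]_(x in tube phi l r) inner f r x)%E.
  apply: sum_integral_le => //.
  - exact: iota_uniq.
  - exact: tube_borel.
  - apply/trivIsetP => i j /= si sj ij; rewrite !mem_index_iota !ltnS/= in si sj.
    apply/seteqP; split => // y []; rewrite /B !mball => yi yj.
    have := metric_triangle (phi (i%:R * h)) y (phi (j%:R * h)).
    rewrite gp ?ih// (metric_sym y) -mulrBl normrM (gtr0_norm hp).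
    suff H : 1 <= `|i%:R - j%:R| :> R by have : h <= `|i%:R - j%:R| * h; [rewrite ler_peMl// ltW|lra].
    have [lij|lji|E] := ltngtP i j; last by rewrite E eqxx in ij.
      by rewrite distrC -natrB ?(ltnW lij)// normr_nat ler1n subn_gt0.
    by rewrite -natrB ?(ltnW lji)// normr_nat ler1n subn_gt0.
  - move=> i; rewrite mem_index_iota ltnS /= => ik y yi; exists (i%:R * h).
      by rewrite /= in_itv/= ih.
    by move: yi; rewrite /B !mball; lra.
  - exact: measurable_funTS.
  - by move=> x _; exact: inner_ge0.
have sum1 : (\sum_(i < k) J i <= \int[m]_(x in tube phi l r) inner f r x)%E.
  by apply: le_trans sumJ; rewrite big_mkord [leRHS]big_ord_recr; exact: leeDl.
have sum2 : (\sum_(i < k) J i.+1 <= \int[m]_(x in tube phi l r) inner f r x)%E.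
  by apply: le_trans sumJ; rewrite big_mkord [leRHS]big_ord_recl; exact: leeDr.
exists (u 0%N), (u k); split.
- by rewrite mball; have := du 0%N; rewrite mul0r.
- by rewrite mball; have := du k; rewrite hk.
have tele : `|f (u k) - f (u 0%N)| `^ p <= k%:R `^ (p - 1) * \sum_(j < k) `|f (u j) - f (u j.+1)| `^ p.
  apply: le_trans (@sum_powR_le R p k (fun j => f (u j) - f (u j.+1)) p1 isT).
  rewrite ge0_ler_powR ?nnegrE ?sumr_ge0 ?(ltW p0)//.
  rewrite -(telescope_sumr (fun i => f (u i)))// big_mkord.
  by apply: (le_trans (ler_norm_sum _ _ _)); apply: ler_sum => j _; rewrite distrC.
set I := (\int[m]_(x in tube phi l r) inner f r x)%E in sum1 sum2 *.
have S1 : ((\sum_(j < k) `|f (u j) - f (u j.+1)| `^ p * (b * Phi r) ^+ 2)%:E <= (2 `^ p)%:E * I)%E.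
  rewrite -sumEFin; apply: (@le_trans _ _ (\sum_(j < k) ((2 `^ (p - 1))%:E * (J j + J j.+1)))%E).
    by apply: lee_sum => j _; exact: step.
  rewrite -ge0_sume_distrr; last by move=> j _; exact: adde_ge0.
  rewrite big_split/=.
  apply: (@le_trans _ _ ((2 `^ (p - 1))%:E * (I + I))%E).
    by rewrite lee_wpmul2l ?lee_fin ?powR_ge0// leeD.
  rewrite -(mulr_powRB1 (ler0n _ 2) p0) (mulrC 2) EFinM -muleA.
  rewrite lee_wpmul2l ?lee_fin ?powR_ge0//.
  by rewrite (_ : 2%:E = 1%:E + 1%:E :> \bar R)%E ?ge0_muleDl ?mul1e ?lee_fin.
apply: (@le_trans _ _ (((4 * l) `^ (p - 1))%:E * (\sum_(j < k) `|f (u j) - f (u j.+1)| `^ p * (b * Phi r) ^+ 2)%:E)%E).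
  rewrite -EFinM lee_fin -mulr_suml mulrA [X in _ <= X]mulrA.
  rewrite ler_wpM2r ?exprn_ge0 ?(ltW P0)//.
  apply: (@le_trans _ _ (k%:R `^ (p - 1) * (\sum_(j < k) `|f (u j) - f (u j.+1)| `^ p) * r `^ (p - 1))).
    by rewrite ler_wpM2r ?powR_ge0.
  rewrite mulrAC -powRM ?(ltW k0) ?(ltW rp)//.
  rewrite ler_wpM2r ?sumr_ge0//.
  by rewrite ge0_ler_powR ?nnegrE ?subr_ge0 ?mulr_ge0 ?(ltW k0) ?(ltW rp) ?(ltW p1) ?(ltW l0).
by rewrite [2 `^ p * _]mulrC EFinM -muleA lee_wpmul2l ?lee_fin ?powR_ge0.
Qed.

Lemma mean_inner_measurable f r : measurable_fun setT (f : borel X -> R) -> 0 < r < r0 ->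
  measurable_fun setT ((fun x => (m (ball x r))^-1 * inner f r x)%E : borel X -> \bar R).
Proof.
move=> mf rr0; have /andP[rp rr] := rr0.
have cP : 0 < c * Phi r by rewrite mulr_gt0// Phi_gt0// rp ltW.
apply: emeasurable_funM; last exact: inner_measurable.
apply: (eq_measurable_fun (fun x : borel X => (fine (m (ball x r)) `^ (- 1))%:E)).
  move=> x _ /=; have /andP[lb ub] := mballP x rr0.
  have mfin : m (ball x r) \is a fin_num.
    by rewrite ge0_fin_numE// (le_lt_trans ub)// ltry.
  rewrite -[in RHS](fineK mfin) inver powR_inv1 ?fine_ge0// gt_eqF//.
  by rewrite fine_gt0// (lt_le_trans _ lb) ?lte_fin//= (le_lt_trans ub)// ltry.
apply/measurable_EFinP; apply: (measurableT_comp (measurable_powR _)).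
by apply: measurableT_comp => //; exact: mball_measurable.
Qed.

Lemma energy_bounds f r : measurable_fun setT (f : borel X -> R) -> 0 < r < r0 ->
  ((c * (r `^ (p - 1) * Phi r ^+ 2))%:E * KS_energy m Phi p f r <=
    \int[m]_x inner f r x /\
   \int[m]_x inner f r x <=
    (C * (r `^ (p - 1) * Phi r ^+ 2))%:E * KS_energy m Phi p f r)%E.
Proof.
move=> mf rr0; have /andP[rp rr] := rr0.
have P0 : 0 < Phi r by rewrite Phi_gt0// rp ltW.
have q0 : 0 < r `^ (p - 1) by rewrite powR_gt0.
have mi := inner_measurable r mf.
have cP : 0 < c * Phi r by rewrite mulr_gt0.
have CP : 0 < C * Phi r by rewrite mulr_gt0.
have bl x : (((C * Phi r)^-1)%:E * inner f r x <= (m (ball x r))^-1 * inner f r x)%E.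
  have /andP[lb ub] := mballP x rr0.
  rewrite lee_wpmul2r ?inner_ge0// -[leLHS](_ : ((C * Phi r)%:E^-1)%E = _).
    by rewrite lee_pV2// inE ?measure_ge0// lee_fin ltW.
  by rewrite inver gt_eqF.
have bu x : ((m (ball x r))^-1 * inner f r x <= ((c * Phi r)^-1)%:E * inner f r x)%E.
  have /andP[lb ub] := mballP x rr0.
  rewrite lee_wpmul2r ?inner_ge0// -[leRHS](_ : ((c * Phi r)%:E^-1)%E = _).
    by rewrite lee_pV2// inE ?measure_ge0// lee_fin ltW.
  by rewrite inver gt_eqF.
have i0 x : (0 <= inner f r x)%E by exact: inner_ge0.
have I0 : (0 <= \int[m]_x inner f r x)%E by exact: integral_ge0.
have W0 x : (0 <= (m (ball x r))^-1 * inner f r x)%E by rewrite mule_ge0 ?inve_ge0.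
set W := fun x => ((m (ball x r))^-1 * inner f r x)%E in bl bu W0.
have mono (h : borel X -> \bar R) (k : R) : measurable_fun setT h -> (forall x, 0 <= h x)%E ->
    0 <= k -> (\int[m]_x (k%:E * h x) = k%:E * \int[m]_x h x)%E.
  by move=> mh h0 k0; rewrite ge0_integralZl_EFin.
have EW : KS_energy m Phi p f r = ((Psi Phi p r)^-1%:E * \int[m]_x W x)%E by [].
have Psi0 : 0 < Psi Phi p r by rewrite mulr_gt0.
have key (k : R) : 0 < k ->
    ((k * (r `^ (p - 1) * Phi r ^+ 2))%:E * KS_energy m Phi p f r =
     (k * Phi r)%:E * \int[m]_x W x)%E.
  move=> k0; rewrite EW muleA -EFinM; congr (_%:E * _)%E.
  by rewrite /Psi; field; rewrite !gt_eqF.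
have mW : measurable_fun setT (W : borel X -> \bar R) by exact: mean_inner_measurable.
rewrite !key//; split.
  rewrite -(mono _ _ mW)// ?(ltW cP)//; apply: ge0_le_integral => //.
  - by move=> x _; rewrite mule_ge0 ?W0// lee_fin ltW.
  - by apply: emeasurable_funM.
  - move=> x _; apply: (@le_trans _ _ ((c * Phi r)%:E * (((c * Phi r)^-1)%:E * inner f r x))%E).
      by apply: lee_wpmul2l; [rewrite lee_fin ltW|exact: bu].
    by rewrite muleA -EFinM divff ?gt_eqF// mul1e.
rewrite -(mono _ _ mW)// ?(ltW CP)//; apply: ge0_le_integral => //.
- by apply: emeasurable_funM.
- move=> x _; apply: (@le_trans _ _ ((C * Phi r)%:E * (((C * Phi r)^-1)%:E * inner f r x))%E).
    by rewrite muleA -EFinM divff ?gt_eqF// mul1e.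
  by apply: lee_wpmul2l; [rewrite lee_fin ltW|exact: bl].
Qed.

(** The constant of [chain], divided by the one comparing the measures of balls. *)
Definition chain_cst := 2 `^ p * 4 `^ (p - 1) / b ^+ 2.

Lemma chain_cst_gt0 : 0 < chain_cst.
Proof. by apply: divr_gt0; [rewrite mulr_gt0 ?powR_gt0|exact: exprn_gt0]. Qed.

(** By continuity, the points near the endpoints in [chain] can be replaced by the
    endpoints for small r, at the price of any number A smaller than the
    oscillation. A = 0 is the trivial case, in which the oscillation may vanish. *)
Lemma arc_energy f (phi : R -> X) l A : continuous f -> geodesic phi l -> 0 < l ->
  0 <= A -> (0 < A -> A < `|f (phi l) - f (phi 0)|) ->
  \forall r \near 0^'+,
    ((A `^ p / l `^ (p - 1) * (r `^ (p - 1) * Phi r ^+ 2))%:E <=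
     chain_cst%:E * \int[m]_(x in tube phi l r) inner f r x)%E.
Proof.
move=> cf gp l0; rewrite le_eqVlt => /predU1P[<- _|A0 /(_ A0) lA].
  apply: filterS (nbhs_right_gt 0) => r r0'.
  rewrite powR0 ?gt_eqF// !mul0r mule_ge0 ?lee_fin ?(ltW chain_cst_gt0)//.
  by apply: integral_ge0 => x _; exact: inner_ge0.
pose e := (`|f (phi l) - f (phi 0)| - A) / 2.
have e0 : 0 < e by rewrite divr_gt0// subr_gt0.
have near_f x : exists2 d, 0 < d & forall y, ball x d y -> `|f x - f y| < e.
  by have /cvgrPdist_lt/(_ e e0)/nbhs_ballP[d d0 H] := cf x; exists d.
have [d1 d10 H1] := near_f (phi 0); have [d2 d20 H2] := near_f (phi l).
near=> r.
have rp : 0 < r by near: r; exact: nbhs_right_gt.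
have rr : r < r0 by near: r; exact: nbhs_right_lt.
have rd1 : r < d1 by near: r; exact: nbhs_right_lt.
have rd2 : r < d2 by near: r; exact: nbhs_right_lt.
have r2l : r < 2 * l by near: r; apply: nbhs_right_lt; rewrite mulr_gt0.
have rr0 : 0 < r < r0 by rewrite rp.
have [x [x' [xb xb' H]]] := chain (continuous_borel cf) gp l0 rr0 (ltW r2l).
have Ax : A <= `|f x' - f x|.
  have /H1 B1 : ball (phi 0) d1 x by move: xb; rewrite !mball; lra.
  have /H2 B2 : ball (phi l) d2 x' by move: xb'; rewrite !mball; lra.
  have : `|f (phi l) - f (phi 0)| <= `|f (phi l) - f x'| + `|f x' - f x| + `|f (phi 0) - f x|.
    rewrite (_ : f (phi l) - f (phi 0) = (f (phi l) - f x') + (f x' - f x) - (f (phi 0) - f x)); last by ring.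
    by apply: (le_trans (ler_normB _ _)); rewrite lerD2r ler_normD.
  by rewrite /e in B1 B2; lra.
set I := (\int[m]_(x in tube phi l r) inner f r x)%E in H *.
have {}H : ((A `^ p * (r `^ (p - 1) * (b * Phi r) ^+ 2))%:E <=
   (2 `^ p * (4 * l) `^ (p - 1))%:E * I)%E.
  apply: le_trans H; rewrite lee_fin; apply: ler_wpM2r.
    by apply: mulr_ge0; [exact: powR_ge0|exact: sqr_ge0].
  by rewrite ge0_ler_powR ?nnegrE ?(ltW A0) ?(ltW p0).
pose q := (l `^ (p - 1) * b ^+ 2)^-1.
have lp0 : 0 < l `^ (p - 1) by rewrite powR_gt0.
have q0 : 0 <= q by rewrite invr_ge0; apply: mulr_ge0; [exact: powR_ge0|exact: sqr_ge0].
have := @lee_wpmul2l _ q%:E _ _ _ H; rewrite lee_fin => /(_ q0).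
rewrite muleA -!EFinM; congr (_%:E <= _%:E * _)%E; rewrite /q.
  by field; rewrite !gt_eqF.
rewrite powRM// ?(ltW l0)// /chain_cst.
by field; rewrite !gt_eqF.
Unshelve. all: by end_near. Qed.

Lemma arcs_separated (phi psi : R -> X) l l' : geodesic phi l -> geodesic psi l' ->
  0 <= l -> 0 <= l' -> (phi @` `[0, l] `&` psi @` `[0, l'] = set0)%classic ->
  \forall r \near 0^'+, tube phi l r `&` tube psi l' r = set0.
Proof.
move=> gp gs l0 l0' dis.
have ca := geodesic_image_compact gp l0 (@segment_compact _ 0 l) (@subset_refl _ _).
have ca' := geodesic_image_compact gs l0' (@segment_compact _ 0 l') (@subset_refl _ _).
have [e e0 He] := compacts_separated ca ca' dis.
near=> r; have re : r < e / 2 by near: r; apply: nbhs_right_lt; rewrite divr_gt0.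
apply/seteqP; split => // y [[s sI ys] [t tI yt]].
have := He _ _ (imageP phi sI) (imageP psi tI).
move: ys yt; rewrite !mball => ys yt.
have := metric_triangle (phi s) y (psi t); rewrite (metric_sym y); lra.
Unshelve. all: by end_near. Qed.

(** Disjoint compact arcs have disjoint tubes at small scales. The normalization
    r^(p-1) Phi(r)^2 cancels, and r is chosen along the lower limit. *)
Lemma closed_arcs_energy (N : nat) f (phi : nat -> R -> X) (l A : nat -> R) (L : R) :
  continuous f ->
  (forall i, (i < N)%N -> geodesic (phi i) (l i) /\ 0 < l i) ->
  (forall i, (i < N)%N -> 0 <= A i /\
     (0 < A i -> A i < `|f (phi i (l i)) - f (phi i 0)|)) ->
  (forall i j, (i < j < N)%N ->
     (phi i @` `[0, l i] `&` phi j @` `[0, l j] = set0)%classic) ->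
  (limf_einf (KS_energy m Phi p f) 0^'+ <= L%:E)%E ->
  \sum_(i < N) A i `^ p / l i `^ (p - 1) <= chain_cst * C * L.
Proof.
move=> cf gl AH dis EL.
have near1 : \forall r \near 0^'+, forall i : 'I_N,
    ((A i `^ p / l i `^ (p - 1) * (r `^ (p - 1) * Phi r ^+ 2))%:E <=
     chain_cst%:E * \int[m]_(x in tube (phi i) (l i) r) inner f r x)%E.
  apply: filter_forall => i; have [gi li] := gl i (ltn_ord i).
  by have [A0 AA] := AH i (ltn_ord i); exact: arc_energy.
have near2 : \forall r \near 0^'+, forall i j : 'I_N, (i < j)%N ->
    tube (phi i) (l i) r `&` tube (phi j) (l j) r = set0.
  apply: filter_forall => i; apply: filter_forall => j.
  have [gi li] := gl i (ltn_ord i); have [gj lj] := gl j (ltn_ord j).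
  have [ij|ij] := boolP (i < j)%N; last by apply: filterE.
  have := arcs_separated gi gj (ltW li) (ltW lj) (dis i j _); rewrite ij ltn_ord => /(_ isT).
  by apply: filterS.
have Kp := chain_cst_gt0.
have KC : 0 < chain_cst * C by exact: mulr_gt0.
apply/ler_addgt0Pr => e e0.
have LL : (L%:E < (L + e / (chain_cst * C))%:E)%E by rewrite lte_fin ltrDl divr_gt0.
have nW : \forall r \near 0^'+, 0 < r < r0 /\ (forall i : 'I_N,
    ((A i `^ p / l i `^ (p - 1) * (r `^ (p - 1) * Phi r ^+ 2))%:E <=
     chain_cst%:E * \int[m]_(x in tube (phi i) (l i) r) inner f r x)%E) /\
   (forall i j : 'I_N, (i < j)%N -> tube (phi i) (l i) r `&` tube (phi j) (l j) r = set0).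
  by apply: filterS3 (nbhs_right_gt 0) (nbhs_right_lt r00)
    (filterI near1 near2) => r -> -> [].
have [r [rr0 [H1 H2]] Er] := liminf_lt_ex EL LL nW.
have mf := continuous_borel cf; have mi := inner_measurable r mf.
have i0 x : (0 <= inner f r x)%E by exact: inner_ge0.
pose D := r `^ (p - 1) * Phi r ^+ 2.
have D0 : 0 < D.
  by case/andP: rr0 => rp rr; rewrite mulr_gt0 ?powR_gt0 ?exprn_gt0// Phi_gt0// rp ltW.
have sumT : (\sum_(i <- index_enum 'I_N) \int[m]_(x in tube (phi i) (l i) r) inner f r x <=
    \int[m]_x inner f r x)%E.
  apply: sum_integral_le => //.
  - exact: index_enum_uniq.
  - by move=> i; exact: tube_borel.
  - apply/trivIsetP => i j _ _; rewrite neq_ltn => /orP[] ij; first exact: H2.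
    by rewrite setIC; exact: H2.
have [_ Eu] := energy_bounds mf rr0.
have : (((\sum_(i < N) A i `^ p / l i `^ (p - 1)) * D)%:E <=
    (chain_cst * (C * D) * (L + e / (chain_cst * C)))%:E)%E.
  rewrite mulr_suml -sumEFin.
  apply: (@le_trans _ _ (chain_cst%:E * \int[m]_x inner f r x)%E).
    apply: (@le_trans _ _ (\sum_(i < N) (chain_cst%:E * \int[m]_(x in tube (phi i) (l i) r) inner f r x))%E).
      by apply: lee_sum => i _; exact: H1.
    rewrite -ge0_sume_distrr; last by move=> i _; exact: integral_ge0.
    by apply: lee_wpmul2l => //; rewrite lee_fin ltW.
  rewrite -(mulrA chain_cst) (EFinM chain_cst); apply: lee_wpmul2l.
    by rewrite lee_fin ltW.
  rewrite (EFinM (C * D)).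
  apply: (le_trans Eu); apply: lee_wpmul2l (ltW Er); rewrite lee_fin.
  by rewrite mulr_ge0 ?(ltW C0) ?(ltW D0).
rewrite lee_fin (_ : _ * (C * D) * _ = (chain_cst * C * L + e) * D) ?ler_pM2r//.
by field; rewrite !gt_eqF.
Qed.

(** Shrinking the arcs slightly makes them disjoint compact arcs, changes the
    oscillations by a factor close to 1 and only shortens the lengths. *)
Lemma open_arcs_energy (N : nat) f (phi : nat -> R -> X) (l : nat -> R) (L : R) :
  continuous f ->
  (forall i, (i < N)%N -> geodesic (phi i) (l i) /\ 0 < l i) ->
  (forall i j, (i < j < N)%N ->
     (phi i @` `]0, l i[ `&` phi j @` `]0, l j[ = set0)%classic) ->
  (limf_einf (KS_energy m Phi p f) 0^'+ <= L%:E)%E ->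
  \sum_(i < N) `|f (phi i (l i)) - f (phi i 0)| `^ p / l i `^ (p - 1) <=
    chain_cst * C * L.
Proof.
move=> cf gl dis EL.
pose df i := `|f (phi i (l i)) - f (phi i 0)|.
set K := chain_cst * C * L.
have df0 i : 0 <= df i by exact: normr_ge0.
have claim th : 0 <= th < 1 ->
    \sum_(i < N) (th * df i) `^ p / l i `^ (p - 1) <= K.
  move=> /andP[th0 th1].
  have exd i : exists d, (i < N)%N -> [/\ 0 < d, 2 * d < l i &
      (0 < th * df i -> th * df i < `|f (phi i (l i - d)) - f (phi i d)|)].
    have [iN|] := boolP (i < N)%N; last by exists 0.
    have [gi li] := gl i iN.
    have [d0|dn0] := eqVneq (df i) 0.
      exists (l i / 4) => _; split; [by rewrite divr_gt0|lra|].
      by rewrite d0 mulr0 ltxx.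
    have dp : 0 < df i by rewrite lt_neqAle eq_sym dn0 df0.
    pose e := (1 - th) * df i / 2.
    have e0 : 0 < e by rewrite divr_gt0 ?mulr_gt0 ?subr_gt0.
    have near_f x : exists2 d, 0 < d & forall y, ball x d y -> `|f x - f y| < e.
      by have /cvgrPdist_lt/(_ e e0)/nbhs_ballP[d d0 H] := cf x; exists d.
    have [d1 d10 H1] := near_f (phi i 0); have [d2 d20 H2] := near_f (phi i (l i)).
    pose d := Num.min (Num.min d1 d2 / 2) (l i / 4).
    have d0 : 0 < d by rewrite /d !lt_min !divr_gt0 ?lt_min ?d10 ?d20.
    have dl : d <= l i / 4 by rewrite /d ge_min lexx orbT.
    have dd1 : d < d1.
      have : d <= Num.min d1 d2 / 2 by rewrite /d ge_min lexx.
      have : Num.min d1 d2 <= d1 by rewrite ge_min lexx.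
      by move: (Num.min _ _) => q; lra.
    have dd2 : d < d2.
      have : d <= Num.min d1 d2 / 2 by rewrite /d ge_min lexx.
      have : Num.min d1 d2 <= d2 by rewrite ge_min lexx orbT.
      by move: (Num.min _ _) => q; lra.
    exists d => _; split => //; first lra.
    move=> _.
    have B1 : `|f (phi i 0) - f (phi i d)| < e.
      by apply: H1; rewrite mball gi; rewrite ?sub0r ?normrN ?ger0_norm ?(ltW d0)//; lra.
    have B2 : `|f (phi i (l i)) - f (phi i (l i - d))| < e.
      apply: H2; rewrite mball gi; [|lra|lra].
      by rewrite opprB addrC subrK ger0_norm ?(ltW d0).
    have : df i <= `|f (phi i (l i)) - f (phi i (l i - d))| + `|f (phi i (l i - d)) - f (phi i d)| + `|f (phi i 0) - f (phi i d)|.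
      rewrite /df (_ : f (phi i (l i)) - f (phi i 0) = (f (phi i (l i)) - f (phi i (l i - d))) +
        (f (phi i (l i - d)) - f (phi i d)) - (f (phi i 0) - f (phi i d))); last by ring.
      by apply: (le_trans (ler_normB _ _)); rewrite lerD2r ler_normD.
    have : 2 * e = df i - th * df i by rewrite /e; field.
    by move: B1 B2; lra.
  have [d Hd] := choice exd.
  pose psi i t := phi i (d i + t).
  have := @closed_arcs_energy N f psi (fun i => l i - d i - d i) (fun i => th * df i) L cf.
  rewrite -/K => H; apply: le_trans (H _ _ _ EL) => {H}.
  - apply: ler_sum => i _; have [d0 dl _] := Hd i (ltn_ord i).
    rewrite ler_wpM2l ?powR_ge0// lef_pV2 ?posrE ?powR_gt0//; [|lra|lra].
    clear EL; rewrite ge0_ler_powR ?nnegrE ?subr_ge0 ?(ltW p1)//; lra.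
  - move=> i iN; have [gi li] := gl i iN; have [d0 dl _] := Hd i iN; split; last lra.
    by apply: (geodesic_shift gi); lra.
  - move=> i iN; have [d0 dl H'] := Hd i iN; split; first by rewrite mulr_ge0.
    by move=> /H'; rewrite /psi addr0 (_ : d i + (l i - d i - d i) = l i - d i)//; ring.
  - move=> i j /andP[ij jN]; have iN := ltn_trans ij jN.
    have [d0 dl _] := Hd i iN; have [d0' dl' _] := Hd j jN.
    have := dis i j; rewrite ij => /(_ jN) E; rewrite -subset0 -E => y [[s /= sI <-] [t /= tI ty]].
    move: sI tI; rewrite !in_itv/= => sI tI; split.
      by exists (d i + s) => //=; rewrite in_itv/=; lra.
    by exists (d j + t) => //=; rewrite in_itv/=; lra.
pose S := \sum_(i < N) df i `^ p / l i `^ (p - 1).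
have S0 : 0 <= S by apply: sumr_ge0 => i _; rewrite divr_ge0// powR_ge0.
rewrite -/S; apply/ler_addgt0Pr => e e0.
(* by the tangent inequality at 1, (1 - t)^p is at least 1 - p t; t is chosen so
   that p S t is at most e *)
pose t := e / (e + p * S + 1).
have q0 : 0 < e + p * S + 1 by rewrite ltr_pwDr// addr_ge0 ?mulr_ge0 ?(ltW p0) ?(ltW e0).
have t0 : 0 < t by rewrite divr_gt0.
have t1 : t < 1 by rewrite ltr_pdivrMr// mul1r -addrA ltrDl ltr_wpDl// mulr_ge0 ?(ltW p0).
have th01 : 0 <= 1 - t < 1 by lra.
have := claim _ th01.
have -> : \sum_(i < N) ((1 - t) * df i) `^ p / l i `^ (p - 1) = (1 - t) `^ p * S.
  rewrite mulr_sumr; apply: eq_bigr => i _; rewrite powRM ?mulrA//; lra.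
have th0 : 0 <= 1 - t by case/andP: th01.
have := powR_tangent p1 th0 (@ler01 R); rewrite !powR1 !mulr1 => H1 H2.
have H3 : (p * (1 - t) - (p - 1)) * S <= (1 - t) `^ p * S by rewrite ler_wpM2r//; lra.
have H4 : p * S * t <= e.
  by rewrite /t mulrCA ler_piMr ?(ltW e0)// ler_pdivrMr//; lra.
have := le_trans H3 H2; rewrite (_ : (_ - _) * S = S - p * S * t); last by ring.
lra.
Qed.

Lemma eq_dist_powR_measurable f x : measurable_fun setT (f : borel X -> R) ->
  measurable_fun setT (fun y : borel X => (`|f y - f x| `^ p)%:E).
Proof.
move=> mf; apply/measurable_EFinP; apply: (measurableT_comp (measurable_powR p)).
by apply: measurableT_comp => //; exact: measurable_funB.
Qed.

Lemma inner_ae f (g : X -> R) r x : measurable_fun setT (f : borel X -> R) ->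
  measurable_fun setT (g : borel X -> R) -> {ae m, forall x, f x = g x} ->
  f x = g x -> inner f r x = inner g r x.
Proof.
move=> mf mg fg fgx; apply: ae_eq_integral; first exact: ball_borel.
- by apply: measurable_funTS; exact: eq_dist_powR_measurable.
- by apply: measurable_funTS; exact: eq_dist_powR_measurable.
- apply: (ae_imp _ fg).
  by move=> y fgy _; rewrite fgx fgy.
Qed.

(** The energy only sees classes modulo m-negligible sets, so it may be computed on
    the continuous representative. *)
Lemma KS_energy_ae f (g : X -> R) r : measurable_fun setT (f : borel X -> R) ->
  measurable_fun setT (g : borel X -> R) -> 0 < r < r0 ->
  {ae m, forall x, f x = g x} -> KS_energy m Phi p f r = KS_energy m Phi p g r.
Proof.
move=> mf mg rr fg; rewrite /KS_energy.
suff -> : (\int[m]_x ((m (ball x r))^-1 * inner f r x) =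
  \int[m]_x ((m (ball x r))^-1 * inner g r x))%E by [].
apply: ae_eq_integral => //; [exact: mean_inner_measurable..|].
apply: (ae_imp _ fg).
by move=> x fgx _; rewrite (inner_ae r mf mg fg fgx).
Qed.

(** Call x good for u at scale r if it lies in B(u, r / 8) and its inner energy is at
    most a constant times r^(p-1) Phi(r); bounded energy provides good points
    everywhere. By [two_point], the values of f at good points of nearby centres,
    at the same or at consecutive dyadic scales, differ by at most a constant times
    r^((p-1)/p). So they converge geometrically, to a continuous function. Its
    agreement with f follows from Fatou's lemma, the inner energies of f tending
    to 0 in mean faster than Phi(r). *)
Lemma continuous_representative f : measurable_fun setT (f : borel X -> R) ->
  (limf_esup (KS_energy m Phi p f) 0^'+ < +oo)%E ->
  exists2 ft : X -> R, continuous ft & {ae m, forall x, ft x = f x}.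
Proof.
move=> mf /limsup_bound[M [r1 [M0 r10 HM]]].
pose rho := Num.min r0 r1 / 2.
have rho0 : 0 < rho by rewrite divr_gt0// lt_min r00.
have rhor0 : rho < r0.
  have : Num.min r0 r1 <= r0 by rewrite ge_min lexx.
  by have := rho0; rewrite /rho; move: (Num.min _ _) => w; lra.
have rhor1 : rho < r1.
  have : Num.min r0 r1 <= r1 by rewrite ge_min lexx orbT.
  by have := rho0; rewrite /rho; move: (Num.min _ _) => w; lra.
pose r k := rho * 2^-1 ^+ k.
have rS k : r k.+1 = r k / 2 by rewrite /r exprS; ring.
have rp k : 0 < r k by rewrite mulr_gt0// exprn_gt0.
have rrho k : r k <= rho by rewrite /r ler_piMr ?(ltW rho0)// exprn_ile1// ?invr_ge0//; lra.
have rr0 k : 0 < r k < r0 by rewrite rp (le_lt_trans (rrho k)).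
have rr1 k : 0 < r k < r1 by rewrite rp (le_lt_trans (rrho k)).
have P0 k : 0 < Phi (r k) by apply: Phi_gt0; have /andP[-> /ltW] := rr0 k.
pose M' := C * M / b.
have M'0 : 0 < M' by apply: divr_gt0 => //; exact: mulr_gt0.
have I_le k : (\int[m]_x inner f (r k) x <=
    (M' * (r k `^ (p - 1) * Phi (r k)) * (b * Phi (r k)))%:E)%E.
  have [_ H] := energy_bounds mf (rr0 k); apply: (le_trans H).
  rewrite (_ : M' * _ * _ = C * (r k `^ (p - 1) * Phi (r k) ^+ 2) * M); last first.
    by rewrite /M'; move: b b0 => w w0; field; rewrite gt_eqF.
  rewrite [leRHS]EFinM; apply: lee_wpmul2l; last exact: HM.
  by rewrite lee_fin (mulr_ge0 (ltW C0))// mulr_ge0 ?powR_ge0 ?sqr_ge0.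
(* x is good for u at scale r k *)
pose G k u x := ball u (r k / 8) x /\
  (inner f (r k) x <= (M' * (r k `^ (p - 1) * Phi (r k)))%:E)%E.
have Gex k u : exists x, G k u x.
  have bP : 0 < b * Phi (r k) by exact: mulr_gt0.
  have mBi : measurable_fun (ball u (r k / 8) : set (borel X)) (inner f (r k)).
    by apply: measurable_funTS; exact: inner_measurable.
  have [x Bx Hx] := exists_le_mean (ball_borel u (r k / 8)) bP (mball8 _ (rr0 k)) mBi
    (fun x _ => inner_ge0 f (r k) x).
  exists x; split => //; rewrite -(@lee_pmul2r _ (b * Phi (r k))%:E) ?lte_fin//.
  apply: le_trans Hx _; rewrite -EFinM; apply: le_trans (I_le k).
  apply: ge0_subset_integral => //; [exact: ball_borel|exact: inner_measurable|].
  by move=> y _; exact: inner_ge0.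
(* D covers the two possible ratios of consecutive scales, 1 and 2 *)
pose D := C * (1 + 2 `^ alpha).
have D0 : 0 < D by rewrite mulr_gt0// ltr_pwDl// powR_ge0.
pose K1 := 2 `^ (p - 1) * M' * (D + 1) / b.
have K10 : 0 < K1.
  exact: divr_gt0 (mulr_gt0 (mulr_gt0 (powR_gt0 _ (ltr0Sn _ 1)) M'0) (addr_gt0 D0 ltr01)) b0.
have GG k k' u u' x x' : k' = k \/ k' = k.+1 -> mdist u u' < r k / 8 ->
    G k u x -> G k' u' x' -> `|f x - f x'| `^ p <= K1 * r k `^ (p - 1).
  move=> kk uu [xb xi] [xb' xi'].
  have [rk1 rk2] : r k' <= r k /\ r k / 2 <= r k'.
    by have := rp k; case: kk => ->; rewrite ?rS; lra.
  have PD : Phi (r k) <= D * Phi (r k').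
    have [_ rkr0] := andP (rr0 k).
    have /andP[_] := doubling (rp k') rk1 (ltW rkr0).
    rewrite ler_pdivrMr// => H; apply: le_trans H _; rewrite ler_pM2r// /D ler_pM2l//.
    case: kk => ->; first by rewrite divff ?gt_eqF// powR1 lerDl powR_ge0.
    rewrite rS (_ : r k / (r k / 2) = 2) ?lerDr//; field.
    by rewrite gt_eqF.
  have B1 : ball u' (r k' / 8) `<=` ball x (r k).
    move=> y; move: xb; rewrite !mball => xb yb.
    have := metric_triangle x u y; have := metric_triangle u u' y.
    by rewrite (metric_sym x u); have := rp k; lra.
  have B2 : ball u' (r k' / 8) `<=` ball x' (r k').
    move=> y; move: xb'; rewrite !mball => xb' yb.
    have := metric_triangle x' u' y.
    by rewrite (metric_sym x' u'); have := rp k'; lra.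
  have := two_point mf (ball_borel _ _) (mball8 u' (rr0 k')) B1 B2.
  have H : ((2 `^ (p - 1))%:E * (inner f (r k) x + inner f (r k') x') <=
    (2 `^ (p - 1) * (M' * (r k `^ (p - 1) * Phi (r k)) + M' * (r k' `^ (p - 1) * Phi (r k'))))%:E)%E.
    by rewrite EFinM EFinD; apply: lee_wpmul2l; [rewrite lee_fin powR_ge0|exact: leeD].
  move=> /le_trans/(_ H); rewrite lee_fin => {}H.
  have bP : 0 < b * Phi (r k') by exact: mulr_gt0.
  rewrite -(ler_pM2r bP); apply: le_trans H _.
  rewrite (_ : K1 * _ * _ = 2 `^ (p - 1) * (M' * (r k `^ (p - 1) * (D * Phi (r k'))) +
    M' * (r k `^ (p - 1) * Phi (r k')))); last first.
    by rewrite /K1; move: b b0 => w w0; field; rewrite gt_eqF.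
  apply: ler_wpM2l; first exact: powR_ge0.
  apply: lerD; rewrite ler_pM2l//; first by rewrite ler_wpM2l ?powR_ge0.
  by rewrite ler_wpM2r ?(ltW (P0 k'))// ge0_ler_powR ?nnegrE ?subr_ge0 ?(ltW p1) ?(ltW (rp _)).
pose q' : R := 2^-1 `^ (p - 1); pose q := q' `^ p^-1.
have q'0 : 0 < q' by rewrite powR_gt0// invr_gt0.
have pm1 : 0 < p - 1 by rewrite subr_gt0.
have q'1 : q' < 1.
  have <- : 1 `^ (p - 1) = 1 :> R by rewrite powR1.
  by rewrite gt0_ltr_powR// ?nnegrE ?invr_ge0//; lra.
have q0 : 0 < q by rewrite powR_gt0.
have q1 : q < 1.
  have <- : 1 `^ p^-1 = 1 :> R by rewrite powR1.
  by rewrite gt0_ltr_powR ?invr_gt0// ?nnegrE ?(ltW q'0).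
have qp k : (q ^+ k) `^ p = q' ^+ k.
  by rewrite powR_exprn ?(ltW q0)// -powRrM mulVf ?gt_eqF// powRr1// ltW.
have rq k : r k `^ (p - 1) = rho `^ (p - 1) * q' ^+ k.
  by rewrite powRM ?exprn_ge0 ?(ltW rho0) ?invr_ge0// powR_exprn// invr_ge0.
pose K2 := (K1 * rho `^ (p - 1)) `^ p^-1.
have K20 : 0 <= K2 by exact: powR_ge0.
have K2p : K1 * rho `^ (p - 1) = K2 `^ p.
  rewrite -powRrM mulVf ?gt_eqF// powRr1//.
  exact: mulr_ge0 (ltW K10) (powR_ge0 _ _).
have GG' k k' u u' x x' : k' = k \/ k' = k.+1 -> mdist u u' < r k / 8 ->
    G k u x -> G k' u' x' -> `|f x - f x'| <= K2 * q ^+ k.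
  move=> kk uu Gx Gx'; have := GG _ _ _ _ _ _ kk uu Gx Gx'.
  rewrite rq mulrA K2p -qp -powRM ?exprn_ge0 ?(ltW q0)//.
  move=> H; rewrite leNgt; apply/negP => lt; move: H; apply/negP; rewrite -ltNge.
  by rewrite gt0_ltr_powR ?nnegrE ?mulr_ge0 ?exprn_ge0 ?(ltW q0).
have exu u : exists xs : nat -> X, forall k, G k u (xs k).
  by have [xs Hxs] := choice (fun k => Gex k u); exists xs.
have [xs Hxs] := choice exu.
have q01 : 0 < q < 1 by rewrite q0.
pose T := K2 / (1 - q).
have exl u : exists l, forall k, `|f (xs u k) - l| <= T * q ^+ k.
  apply: geometric_limit => // k; apply: GG' (Hxs u k) (Hxs u k.+1); first by right.
  by rewrite mdistxx divr_gt0.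
have [ft Hft] := choice exl.
have qcvg : q ^+ k @[k --> \oo] --> (0 : R) by apply: cvg_expr; rewrite gtr0_norm.
have q'cvg : q' ^+ k @[k --> \oo] --> (0 : R) by apply: cvg_expr; rewrite gtr0_norm.
exists ft.
  move=> u; apply/cvgrPdist_lt => e e0.
  have : (2 * T + K2) * q ^+ k @[k --> \oo] --> (0 : R).
    by rewrite -(mulr0 (2 * T + K2)); apply: cvgMr.
  move=> /cvgrPdist_lt/(_ e e0)[k _ /(_ k (leqnn k))] /=; rewrite sub0r normrN => ke.
  apply/nbhs_ballP; exists (r k / 8) => [|v]; first by rewrite /= divr_gt0.
  rewrite mball => uv; apply: le_lt_trans ke; apply: le_trans (ler_norm _).
  have := Hft u k; have := Hft v k.
  have := GG' _ _ _ _ _ _ (or_introl (erefl k)) uv (Hxs u k) (Hxs v k).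
  rewrite (_ : ft u - ft v = (f (xs v k) - ft v) - (f (xs u k) - ft u) + (f (xs u k) - f (xs v k))); last by ring.
  move=> h1 h2 h3; apply: le_trans (ler_normD _ _) _.
  have := ler_normB (f (xs v k) - ft v) (f (xs u k) - ft u).
  by move: h1 h2 h3; rewrite mulrDl -mulrA; lra.
pose h k y : \bar R := (((Phi (r k))^-1)%:E * inner f (r k) y)%E.
have mh k : measurable_fun setT (h k : borel X -> \bar R).
  by apply: emeasurable_funM => //; exact: inner_measurable.
have h0 k y : (0 <= h k y)%E by rewrite mule_ge0 ?inner_ge0// lee_fin invr_ge0 ltW.
pose A := M' * b * rho `^ (p - 1) * Phi rho.
have hle k : (\int[m]_y h k y <= (A * q' ^+ k)%:E)%E.
  rewrite ge0_integralZl_EFin//; [|by move=> y _; exact: inner_ge0|exact: inner_measurable|by rewrite invr_ge0 ltW].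
  apply: (@le_trans _ _ (((Phi (r k))^-1)%:E * (M' * (r k `^ (p - 1) * Phi (r k)) * (b * Phi (r k)))%:E)%E).
    by apply: lee_wpmul2l; [rewrite lee_fin invr_ge0 ltW|exact: I_le].
  rewrite -EFinM lee_fin rq [leLHS](_ : _ = M' * b * rho `^ (p - 1) * q' ^+ k * Phi (r k)); last first.
    by field; rewrite gt_eqF.
  rewrite /A [leRHS]mulrAC ler_wpM2l//.
    exact: mulr_ge0 (mulr_ge0 (mulr_ge0 (ltW M'0) (ltW b0)) (powR_ge0 _ _)) (exprn_ge0 _ (ltW q'0)).
  by apply: Phind => //; rewrite in_itv/= ?(ltW (rp _)) ?(ltW rho0) ?(ltW rhor0)//; case/andP: (rr0 k) => _ /ltW.
have li0 y : (0 <= limn_einf (h^~ y))%E.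
  by apply: (limn_einf_ge (cvg_cst 0)) => k; exact: h0.
have mli : measurable_fun setT ((fun y => limn_einf (h^~ y)) : borel X -> \bar R).
  apply: measurableT_comp => //; apply: measurable_fun_limn_esup => k.
  exact: measurableT_comp.
have inf0 : (\int[m]_y `|limn_einf (h^~ y)| = 0)%E.
  rewrite (eq_integral (fun y : borel X => limn_einf (h^~ y))); last first.
    by move=> y _; rewrite gee0_abs.
  apply/eqP; rewrite eq_le integral_ge0// andbT.
  apply: le_trans (fatou m measurableT mh (fun k y _ => h0 k y)) _.
  apply/lee_addgt0Pr => e e0; rewrite add0e; apply: limn_einf_le.
  have : A * q' ^+ k @[k --> \oo] --> (0 : R).
    by rewrite -(mulr0 A); apply: cvgMr.
  move=> /cvgrPdist_lt/(_ e e0); apply: filterS => k.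
  rewrite sub0r normrN => /ltW ke; apply: le_trans (hle k) _.
  by rewrite lee_fin (le_trans (ler_norm _)).
have := (ae_eq_integral_abs m measurableT mli).1 inf0; apply: ae_imp => y.
move=> /(_ I) hy; apply/eqP; apply: contraT => neq.
pose e := `|f y - ft y|.
have e0 : 0 < e by rewrite normr_gt0 subr_eq0 eq_sym.
(* a k bounds h k y from below, by the tangent inequality at e, and tends to a
   positive limit *)
pose a k := (b / 2 `^ (p - 1)) * (e `^ p - p * e `^ (p - 1) * T * q ^+ k) -
  M' * rho `^ (p - 1) * q' ^+ k.
have acvg : a k @[k --> \oo] --> b / 2 `^ (p - 1) * e `^ p.
  rewrite -[X in _ --> X](_ : (b / 2 `^ (p - 1)) * (e `^ p - p * e `^ (p - 1) * T * 0) -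
    M' * rho `^ (p - 1) * 0 = _); last by rewrite !mulr0 !subr0.
  apply: cvgB; last exact: cvgMr.
  by apply: cvgMr; apply: cvgB; [exact: cvg_cst|exact: cvgMr].
have ah k : ((a k)%:E <= h k y)%E.
  have [xb xi] := Hxs y k; set x := xs y k in xb xi.
  have B1 : ball y (r k / 8) `<=` ball y (r k).
    by move=> z; rewrite !mball; have := rp k; lra.
  have B2 : ball y (r k / 8) `<=` ball x (r k).
    move=> z; move: xb; rewrite !mball => xb zb; have := metric_triangle x y z.
    by rewrite (metric_sym x y); have := rp k; lra.
  have := two_point mf (ball_borel _ _) (mball8 y (rr0 k)) B1 B2.
  have := inner_ge0 f (r k) y; rewrite /h.
  case: (inner f (r k) y) => [v|_ _|//]; last by rewrite gt0_muley ?leey// lte_fin invr_gt0.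
  rewrite lee_fin => v0.
  have Hx : ((2 `^ (p - 1))%:E * (v%:E + inner f (r k) x) <=
    (2 `^ (p - 1) * (v + M' * (r k `^ (p - 1) * Phi (r k))))%:E)%E.
    by rewrite EFinM EFinD; apply: lee_wpmul2l; [rewrite lee_fin powR_ge0|exact: leeD].
  move=> /le_trans/(_ Hx); rewrite -EFinM !lee_fin => {Hx}.
  have tan := powR_tangent p1 (normr_ge0 (f y - f x)) (ltW e0).
  have dist : e - T * q ^+ k <= `|f y - f x|.
    have := Hft y k; rewrite /e -/x (_ : f y - ft y = (f y - f x) + (f x - ft y)); last by ring.
    by have := ler_normD (f y - f x) (f x - ft y); lra.
  have Ppos : 0 <= p * e `^ (p - 1) by rewrite mulr_ge0 ?powR_ge0 ?(ltW p0).
  have := ler_wpM2l Ppos dist; rewrite mulrBr -(mulrA p) -{2}(powRr1 (ltW e0)).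
  rewrite -powRD; last by rewrite subrK (gt_eqF p0).
  rewrite subrK => dist'.
  have {tan dist dist'} low : e `^ p - p * e `^ (p - 1) * T * q ^+ k <= `|f y - f x| `^ p.
    by rewrite -(mulrA _ T); lra.
  rewrite /a -(mulrA M') -rq => H.
  apply: (@le_trans _ _ (b / 2 `^ (p - 1) * `|f y - f x| `^ p - M' * r k `^ (p - 1))).
    rewrite lerD2r; apply: ler_wpM2l low.
    by apply: divr_ge0; [exact: ltW|exact: powR_ge0].
  have t0 : 0 < 2 `^ (p - 1) :> R by rewrite powR_gt0.
  rewrite lerBlDr -(ler_pM2r (P0 k)) -(ler_pM2l t0).
  rewrite [leLHS](_ : _ = `|f y - f x| `^ p * (b * Phi (r k))); last first.
    by move: b => w; field; rewrite gt_eqF.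
  apply: le_trans H _; rewrite ler_pM2l// mulrDl [X in _ <= X + _](_ : _ = v).
    by rewrite mulrA.
  by field; rewrite gt_eqF.
have := limn_einf_ge acvg ah; rewrite hy lee_fin leNgt.
rewrite mulr_gt0 ?powR_gt0//.
by apply: divr_gt0 => //; rewrite powR_gt0.
Qed.

End energy.

(** * Short geodesics in uniform local trees *)

Section uniform_local_trees.
Context {R : realType} {X : pointedMetricType R}.
Variables (iota : X -> R) (htree : local_tree iota) (iota0 : R).
Hypotheses (hunif : uniform_local_tree X iota0) (hiota : forall x : X, iota0 <= iota x).

Section local_trees.
Implicit Types (x y z u v : X) (phi psi gam : R -> X) (l s t r : R).

Lemma iota0_gt0 : 0 < iota0. Proof. by case: hunif. Qed.

Lemma geodesic_exists x y : mdist x y < iota x ->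
  exists phi, [/\ geodesic phi (mdist x y), phi 0 = x & phi (mdist x y) = y].
Proof.
move=> xy; have [ix [tx _]] := htree x.
have [||[phi /isom_geodesic[? ? ? _]] _] := tx x y.
- by rewrite mball mdistxx.
- by rewrite mball.
- by exists phi.
Qed.

Lemma geodesic_exists_short x y : mdist x y < iota0 ->
  exists phi, [/\ geodesic phi (mdist x y), phi 0 = x & phi (mdist x y) = y].
Proof. by move=> xy; apply: geodesic_exists; apply: lt_le_trans (hiota x). Qed.

Lemma geodesic_unique phi psi l : 0 <= l < iota (phi 0) ->
  geodesic phi l -> geodesic psi l -> phi 0 = psi 0 -> phi l = psi l ->
  forall t, 0 <= t <= l -> phi t = psi t.
Proof.
move=> /andP[l0 li] gp gq e0 el t tl; have [ix [tx _]] := htree (phi 0).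
have ll : 0 <= l <= l by rewrite l0 lexx.
have dl : mdist (phi 0) (phi l) = l by rewrite (geodesic_dist0 gp).
have [||_ uq] := tx (phi 0) (phi l).
- by rewrite mball mdistxx.
- by rewrite mball dl.
apply: uq; last by rewrite in_itv/= dl.
- by apply: geodesic_isom => //; exact: geodesic_ball.
- rewrite e0 el in li *; apply: geodesic_isom => //; exact: geodesic_ball.
Qed.

Lemma segment_geodesic phi l : 0 <= l < iota (phi 0) -> geodesic phi l ->
  segment_at iota (phi 0) (phi 0) (phi l) = phi @` `]0, l[.
Proof.
move=> l0i gp; have /andP[l0 li] := l0i.
have dl : mdist (phi 0) (phi l) = l by rewrite (geodesic_dist0 gp) ?l0 ?lexx.
apply/seteqP; split => z.
  move=> [psi /isom_geodesic[gq q0 ql _] [t]]; rewrite dl => tl <-.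
  rewrite dl in gq ql; exists t => //; apply: (geodesic_unique l0i gp gq) => //.
  by move: tl; rewrite /= in_itv/=; lra.
move=> [t tl <-]; exists phi; last by rewrite dl; exists t.
by apply: geodesic_isom => //; exact: geodesic_ball.
Qed.

Lemma segment_at_geodesic x u v : ball x (iota x) u -> ball x (iota x) v ->
  exists phi, [/\ geodesic phi (mdist u v), phi 0 = u, phi (mdist u v) = v &
    segment_at iota x u v = phi @` `]0, mdist u v[].
Proof.
move=> xu xv; have [ix [tx _]] := htree x.
have [[phi ip] uq] := tx u v xu xv.
have [gp p0 pl pA] := isom_geodesic ip; exists phi; split => //.
apply/seteqP; split => z.
  move=> [psi iq [t tl <-]]; exists t => //; apply: uq => //.
  by move: tl; rewrite /= !in_itv/=; lra.
by move=> [t tl <-]; exists phi => //; exists t.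
Qed.

(** A short piece of phi around phi t is one of the segments that make up the
    skeleton. *)
Lemma geodesic_skeleton phi l t : geodesic phi l -> 0 < t < l ->
  skeleton iota (phi t).
Proof.
move=> gp /andP[t0 tl]; have i0 := iota0_gt0.
pose s := Num.min (Num.min t (l - t)) (iota0 / 4).
have s0 : 0 < s by rewrite !lt_min t0 subr_gt0 tl divr_gt0.
have [st sl si] : [/\ s <= t, s <= l - t & s <= iota0 / 4].
  by rewrite /s !ge_min !lexx/= !orbT.
have gq := @geodesic_shift _ _ phi l (t - s) (t + s) gp.
move: gq => /(_ _ _); rewrite (_ : t + s - (t - s) = 2 * s); last by ring.
move=> gq; have {}gq : geodesic (fun w : R => phi (t - s + w)) (2 * s) by apply: gq; lra.
set psi := (fun w => _) in gq.
have sE := @segment_geodesic psi (2 * s).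
have hl : 0 <= 2 * s < iota (psi 0) by have := hiota (psi 0); lra.
exists (psi 0) => //; exists (psi (2 * s)).
  by rewrite mball (geodesic_dist0 gq); lra.
rewrite sE//; exists s; first by rewrite /= in_itv/=; lra.
by rewrite /psi; congr phi; ring.
Qed.

Lemma skeleton_geodesic z : skeleton iota z ->
  exists phi l t, [/\ geodesic phi l, 0 < t < l & phi t = z].
Proof.
move=> [x _ [y _ [phi /isom_geodesic[gp _ _ _] [t]]]].
rewrite /= in_itv/= => tl <-.
by exists phi, (mdist x y), t.
Qed.

(** Choose v1 and v2 in V very close to points a and b of a geodesic on both sides
    of z. Two applications of [tree_geodesic_through], one at each end, show that
    replacing a by v1 and b by v2 keeps z on the geodesic. Hence the generating
    segments form a basis of neighbourhoods of the skeleton along geodesics, and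
    they alone see every open set. *)
Lemma dense_segment (V : set X) z e : countable_dense_in_skeleton iota V ->
  skeleton iota z -> 0 < e -> exists v1 v2, [/\ V v1, V v2, mdist v1 v2 < iota0,
    segment_at iota v1 v1 v2 z & segment_at iota v1 v1 v2 `<=` ball z e].
Proof.
move=> [_ _ dV] /skeleton_geodesic[phi [l [t [gp /andP[t0 tl] ptz]]]] e0.
have i0 := iota0_gt0.
pose m := Num.min (Num.min t (l - t)) (Num.min iota0 e).
have m0 : 0 < m by rewrite !lt_min t0 subr_gt0 tl i0.
have [mt ml mi me] : [/\ m <= t, m <= l - t, m <= iota0 & m <= e].
  by rewrite /m !ge_min !lexx/= !orbT.
(* a and b lie at distance s from z and are moved by less than s, so that
   everything happens in the ball of radius m around z *)
pose s := m / 8; have s0 : 0 < s by rewrite divr_gt0.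
have ms : m = 8 * s by rewrite /s; field.
pose a := phi (t - s); pose b := phi (t + s).
have Sa : skeleton iota a by apply: (geodesic_skeleton gp); lra.
have Sb : skeleton iota b by apply: (geodesic_skeleton gp); lra.
have za : mdist z a = s.
  rewrite -ptz /a gp; [|lra|lra].
  by rewrite (_ : t - (t - s) = s) ?gtr0_norm//; ring.
have zb : mdist z b = s.
  rewrite -ptz /b gp; [|lra|lra].
  by rewrite opprD addrA subrr add0r normrN gtr0_norm.
have [v1 [Vv1 v1a]] := dV a Sa _ (nbhsx_ballx a s s0).
have [v2 [Vv2 v2b]] := dV b Sb _ (nbhsx_ballx b s s0).
rewrite mball metric_sym in v1a; rewrite mball metric_sym in v2b.
pose A := ball z iota0.
have tA : is_tree A by have [_ _] := hunif; exact.
have [gam1 [gg1 g10 g1l]] : exists gam, [/\ geodesic gam (mdist v1 a), gam 0 = v1 & gam (mdist v1 a) = a].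
  by apply: geodesic_exists_short; lra.
have [gam2 [gg2 g20 g2l]] : exists gam, [/\ geodesic gam (mdist v2 b), gam 0 = v2 & gam (mdist v2 b) = b].
  by apply: geodesic_exists_short; lra.
have gp' : geodesic (fun w : R => phi (t - s + w)) (2 * s).
  rewrite (_ : 2 * s = (t + s) - (t - s)); last by ring.
  by apply: geodesic_shift gp _ _; lra.
have in_A gam d w : geodesic gam d -> d < s -> gam d = w -> mdist z w = s ->
    forall c, 0 <= c <= d -> A (gam c).
  move=> gg ds gd zw c cd; rewrite /A mball (le_lt_trans (metric_triangle _ w _))//.
  rewrite zw -gd gg; [|lra|lra].
  by rewrite ger0_norm; lra.
have phiA c : 0 <= c <= 2 * s -> A (phi (t - s + c)).
  move=> cs; rewrite /A mball -ptz gp; [|lra|lra].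
  by rewrite (_ : t - _ = s - c); [rewrite (le_lt_trans (_ : _ <= s))// ?ler_norml; lra|ring].
have e1 : gam1 (mdist v1 a) = phi (t - s + 0) by rewrite addr0.
have e2 : s <= 2 * s by lra.
have [psi [ips [t1 t1l pt1]]] := @tree_geodesic_through R X A _ gam1 (2 * s) _ s tA gp' phiA gg1
  (in_A _ _ _ gg1 v1a g1l za) e1 (mdist_ge0 _ _) v1a e2.
set l1 := mdist (gam1 0) (phi (t - s + 2 * s)) in ips t1l.
have bE : phi (t - s + 2 * s) = b by rewrite /b; congr phi; ring.
have [gs ps0 psl psA] := isom_geodesic ips; rewrite -/l1 in gs psl psA.
have zE : phi (t - s + s) = z by rewrite subrK.
have l1t1 : l1 - t1 = s.
  rewrite -zb -zE -pt1 -bE -psl gs; [|lra|by rewrite (mdist_ge0 _ _) lexx].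
  by rewrite distrC ger0_norm//; lra.
have t10 : 0 < t1.
  rewrite lt_neqAle; case/andP: t1l => -> _; rewrite andbT.
  apply/eqP => t10; have : mdist z a < s.
    by rewrite -zE -pt1 -t10 ps0 g10.
  by rewrite za ltxx.
have gr := geodesic_rev gs.
have revA c : 0 <= c <= l1 -> A (psi (l1 - c)) by move=> cl; apply: psA; lra.
have e3 : gam2 (mdist v2 b) = psi (l1 - 0) by rewrite subr0 psl bE.
have e4 : s <= l1 by lra.
have [psi2 [ips2 [t2 t2l pt2]]] := @tree_geodesic_through R X A _ gam2 l1 _ s tA gr revA gg2
  (in_A _ _ _ gg2 v2b g2l zb) e3 (mdist_ge0 _ _) v2b e4.
set l2 := mdist (gam2 0) (psi (l1 - l1)) in ips2 t2l.
have [gs2 ps20 ps2l _] := isom_geodesic ips2; rewrite -/l2 in gs2 ps2l.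
have v1E : psi (l1 - l1) = v1 by rewrite subrr ps0 g10.
have pz : psi2 t2 = z by rewrite pt2 -l1t1 opprB addrC subrK pt1.
have gr2 := geodesic_rev gs2; set chi := (fun w => _) in gr2.
have c0 : chi 0 = v1 by rewrite /chi subr0 ps2l.
have cl : chi l2 = v2 by rewrite /chi subrr ps20 g20.
have l20 : 0 <= l2 by exact: mdist_ge0.
have l2E : mdist v1 v2 = l2 by rewrite metric_sym /l2 g20 v1E.
have l2s : l2 < 4 * s.
  rewrite -l2E (le_lt_trans (metric_triangle _ z _))//.
  have := metric_triangle v1 a z; have := metric_triangle z b v2.
  by rewrite (metric_sym a z) (metric_sym b v2) za zb; lra.
have li : 0 <= l2 < iota (chi 0) by have := hiota (chi 0); lra.
have sE := segment_geodesic li gr2; rewrite c0 cl in sE.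
have zc : chi (l2 - t2) = z by rewrite /chi opprB addrC subrK.
have t20 : 0 < t2.
  rewrite lt_neqAle; case/andP: t2l => -> _; rewrite andbT.
  apply/eqP => t20; have : mdist z b < s by rewrite -pz -t20 ps20 g20.
  by rewrite zb ltxx.
have t2l2 : t2 < l2.
  rewrite lt_neqAle; case/andP: t2l => _ ->; rewrite andbT.
  apply/eqP => t20'; have : mdist z a < s by rewrite -pz t20' ps2l v1E.
  by rewrite za ltxx.
exists v1, v2; split => //.
- by rewrite l2E; lra.
- by rewrite sE; exists (l2 - t2) => //; rewrite /= in_itv/=; lra.
- rewrite sE => w [c]; rewrite /= in_itv/= => cl2 <-.
  rewrite mball -zc gr2; [|lra|lra].
  by rewrite (le_lt_trans (_ : _ <= l2))// ?ler_norml; lra.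
Qed.

End local_trees.

Variables (V : set X) (hV : countable_dense_in_skeleton iota V).

(** * The skeleton and the length measure along geodesics *)

Section length_measure.
Local Notation S := (skeleton iota).
Local Notation T := (segment_space iota V).
Implicit Types (x y z : X) (phi psi : R -> X) (l s t r : R) (A B C U : set X).

Let seg x y : set X := segment_at iota x x y.
Let good x y := [/\ V x, V y & mdist x y < iota0].

Let seg_sub x y : good x y -> seg x y `<=` S.
Proof.
move=> [_ _ d] z sz; exists x => //; exists y; last exact: sz.
by rewrite mball (lt_le_trans d).
Qed.

Let seg_meas x y : good x y -> measurable (seg x y : set T).
Proof.
move=> [V1 V2 d]; apply: sub_sigma_algebra; exists x, y; split => //.
exact: lt_le_trans (hiota _).
Qed.

(** By [dense_segment], an open set of the skeleton is the countable union of the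
    generating segments it contains. *)
Lemma skeleton_open_measurable U : open U -> measurable (S `&` U : set T).
Proof.
move=> oU; have [_ cV _] := hV.
have [e Ve] := countable_enum point cV.
pose I (v : nat * nat) := good (e v.1) (e v.2) /\ seg (e v.1) (e v.2) `<=` U.
pose F v : set T := if `[< I v >] then seg (e v.1) (e v.2) else set0.
rewrite (_ : S `&` U = \bigcup_v F v); last first.
  apply/seteqP; split => z.
    move=> [Sz Uz]; have /nbhs_ballP[r r0 eU] := open_nbhs_nbhs (conj oU Uz).
    have [v1 [v2 [V1 V2 d12 sz sb]]] := dense_segment hV Sz r0.
    have [i _ iE] := Ve _ V1; have [j _ jE] := Ve _ V2.
    exists (i, j) => //; rewrite /F asboolT /I /= iE jE //; split => //.
    exact: subset_trans eU.
  move=> [v _]; rewrite /F; case: asboolP => // -[gv vU] zv.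
  by split; [exact: (seg_sub gv)|exact: vU].
apply: countable_bigcupT_measurable; first exact: countableP.
by move=> v; rewrite /F; case: asboolP => // -[gv _]; exact: seg_meas.
Qed.

Lemma skeleton_measurable : measurable (S : set T).
Proof. by rewrite -[S]setIT; apply: skeleton_open_measurable; exact: openT. Qed.

Lemma skeleton_closed_measurable C : closed C -> measurable (S `&` C : set T).
Proof.
move=> cC; rewrite (_ : S `&` C = S `\` (S `&` ~` C)); last first.
  apply/seteqP; split => z /= [Sz Cz]; split => //; first by move=> [_].
  by apply: contrapT => nC; apply: Cz.
apply: measurableD; first exact: skeleton_measurable.
by apply: skeleton_open_measurable; exact: closed_openC.
Qed.

Lemma metric_closed1 x : closed [set x].
Proof. exact/(compact_closed (@metric_hausdorff _ X))/compact_set1. Qed.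

Lemma geodesic_closed phi l : geodesic phi l -> 0 <= l -> closed (phi @` `[0, l]).
Proof.
move=> gp l0; apply: compact_closed; first exact: metric_hausdorff.
by apply: geodesic_image_compact gp l0 (@segment_compact _ _ _) _.
Qed.

Lemma open_segmentE phi l : geodesic phi l -> 0 <= l ->
  phi @` `]0, l[ = phi @` `[0, l] `\` [set phi 0] `\` [set phi l].
Proof.
move=> gp l0; apply/seteqP; split => [z [t]|z [[[t]]]]; rewrite /= in_itv/= => tl <-.
  split; [split|].
  - by exists t => //=; rewrite in_itv/=; lra.
  - move=> /= E; have := geodesic_dist0 gp (_ : 0 <= t <= l).
    by rewrite E mdistxx => /(_ _); lra.
  - move=> /= E; have := gp t l; rewrite E mdistxx.
    rewrite -normrN opprB ger0_norm; last by lra.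
    by lra.
move=> nt0 ntl; exists t => //=; rewrite in_itv/=; case/andP: tl.
rewrite !le_eqVlt => /predU1P[E|->]; first by case: nt0; rewrite -E.
by move=> /predU1P[E|->//]; case: ntl; rewrite E.
Qed.

Lemma geodesic_sub_skeleton phi l : geodesic phi l -> phi @` `]0, l[ `<=` S.
Proof.
by move=> gp z [t]; rewrite /= in_itv/= => tl <-; exact: (geodesic_skeleton gp tl).
Qed.

Lemma geodesic_measurable phi l : geodesic phi l -> 0 <= l ->
  measurable (phi @` `]0, l[ : set T).
Proof.
move=> gp l0.
rewrite (_ : phi @` `]0, l[ = (S `&` phi @` `[0, l]) `\` (S `&` [set phi 0]) `\` (S `&` [set phi l])).
  apply: measurableD; [apply: measurableD|].
  - by apply: skeleton_closed_measurable; exact: geodesic_closed.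
  - by apply: skeleton_closed_measurable; exact: metric_closed1.
  - by apply: skeleton_closed_measurable; exact: metric_closed1.
apply/seteqP; split => z.
  move=> zp; have Sz := geodesic_sub_skeleton gp zp.
  move: zp; rewrite open_segmentE// => -[[z0 z1] z2].
  by split; [split=> // -[_]|move=> -[_]].
by move=> [[[Sz zp] z0] z1]; rewrite open_segmentE//; split; [split|] => // E; [apply: z0|apply: z1].
Qed.

Lemma continuous_skeleton_measurable (f : X -> R) : continuous f ->
  measurable_fun (S : set T) f.
Proof.
move=> cf; apply: (measurability _ (RGenOpens.measurableE R)).
move=> _ [_ [a [b ->]] <-]; apply: skeleton_open_measurable.
apply: open_comp; last exact: interval_open.
by move=> x _; exact: cf.
Qed.

Lemma mdist_measurable x : measurable_fun (S : set T) (mdist x).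
Proof. by apply: continuous_skeleton_measurable; exact: mdist_continuous. Qed.

(** The segments with endpoints in V already cover, by [dense_segment]. Pairs of
    points of V too far apart contribute the empty arc, of length 0. *)
Lemma skeleton_cover : exists (phi : nat -> R -> X) (l : nat -> R),
  (forall n, geodesic (phi n) (l n) /\ 0 <= l n < iota0) /\
  S = \bigcup_n phi n @` `]0, l n[.
Proof.
have [_ cV _] := hV; have [e Ve] := countable_enum point cV.
have [c2 c2P] := countable_enum (0%N, 0%N) (countableP [set: nat * nat]).
pose g n := (c2 n).1; pose h n := (c2 n).2.
have gh i j : exists n, g n = i /\ h n = j.
  by have [n _ nE] := c2P (i, j) I; exists n; rewrite /g /h nE.
have i0 := iota0_gt0.
have H n : exists c : (R -> X) * R, [/\ geodesic c.1 c.2, 0 <= c.2 < iota0 &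
    mdist (e (g n)) (e (h n)) < iota0 ->
    seg (e (g n)) (e (h n)) = c.1 @` `]0, c.2[].
  have [d|d] := ltP (mdist (e (g n)) (e (h n))) iota0.
    have [phi [gp p0 pl]] := geodesic_exists_short d.
    exists (phi, mdist (e (g n)) (e (h n))); split => //=.
      by rewrite mdist_ge0.
    have li : 0 <= mdist (e (g n)) (e (h n)) < iota (phi 0).
      by rewrite p0 mdist_ge0 (lt_le_trans d).
    by have := segment_geodesic li gp; rewrite p0 pl.
  exists (fun=> point, 0); split => //=.
    move=> s t s0 t0; rewrite mdistxx (_ : s - t = 0) ?normr0//; lra.
  by rewrite lexx.
have [c Hc] := choice H.
exists (fun n => (c n).1), (fun n => (c n).2); split.
  by move=> n; have [] := Hc n.
apply/seteqP; split => z.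
  move=> Sz; have [v1 [v2 [V1 V2 d12 sz _]]] := dense_segment hV Sz ltr01.
  have [i _ iE] := Ve _ V1; have [j _ jE] := Ve _ V2; have [n [gi hj]] := gh i j.
  exists n => //; have [_ _ <-] := Hc n; rewrite gi hj iE jE//.
by move=> [n _]; have [gp _ _] := Hc n; exact: geodesic_sub_skeleton.
Qed.

End length_measure.

Variables (nu : {measure set (segment_space iota V) -> \bar R}) (hnu : is_length_measure nu).

Section length_measure_pushforward.
Local Notation S := (skeleton iota).
Local Notation T := (segment_space iota V).
Implicit Types (x y z : X) (phi psi : R -> X) (l s t r : R).
Local Notation mu := (@lebesgue_measure R).

(** Only segments shorter than the radius at their starting point have a
    prescribed length. *)
Let nu_short phi l s t : geodesic phi l -> 0 < s -> s < t -> t < l ->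
  t - s < iota0 -> nu (phi @` `]s, t[) = (t - s)%:E.
Proof.
move=> gp s0 st tl tsi; have [_ H] := hnu.
have g' : geodesic (fun w : R => phi (s + w)) (t - s) by apply: geodesic_shift gp _ _; lra.
have d : mdist (phi s) (phi t) = t - s by rewrite gp; [rewrite distrC ger0_norm; lra|lra|lra].
have li : 0 <= t - s < iota (phi (s + 0)) by have := hiota (phi (s + 0)); lra.
have := segment_geodesic li g'; rewrite addr0 (addrC s (t - s)) subrK => sE.
have := H (phi s) (phi t); rewrite d sE => <-.
- congr (nu _); apply/seteqP; split => z [w].
    rewrite /= in_itv/= => ws <-; exists (w - s); last by rewrite addrC subrK.
    by rewrite /= in_itv/=; lra.
  by rewrite /= in_itv/= => ws <-; exists (s + w) => //=; rewrite in_itv/=; lra.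
- by apply: (geodesic_skeleton gp); lra.
- by apply: (geodesic_skeleton gp); lra.
- by have := hiota (phi s); lra.
Qed.

(** A measurable left inverse of phi, through which nu is pushed forward. *)
Let psi_ phi : T -> R := (mdist (phi 0) : X -> R) \_ S.

Let psi_meas phi : measurable_fun setT (psi_ phi).
Proof.
apply/(measurable_restrictT _ _).1; first exact: (skeleton_measurable).
exact: (mdist_measurable).
Qed.

Let psiE phi l (B : set R) : geodesic phi l ->
  psi_ phi @^-1` B `&` phi @` `]0, l[ = phi @` (B `&` `]0, l[).
Proof.
move=> gp; apply/seteqP; split => z.
  move=> [Bz [t tl tz]]; exists t => //; split => //.
  have tl' := tl; rewrite /= in_itv/= in tl'.
  move: Bz; rewrite /psi_/= patchE -tz mem_set; last exact: (geodesic_skeleton gp tl').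
  by rewrite (geodesic_dist0 gp)//; lra.
move=> [t [Bt tl] tz]; split; last by exists t.
have tl' := tl; rewrite /= in_itv/= in tl'.
rewrite /psi_/= patchE -tz mem_set; last exact: (geodesic_skeleton gp tl').
by rewrite (geodesic_dist0 gp)//; lra.
Qed.

Lemma geodesic_image_measurable phi l (B : set R) : geodesic phi l -> 0 <= l ->
  measurable B -> measurable (phi @` (B `&` `]0, l[) : set T).
Proof.
move=> gp l0 mB; rewrite -psiE//; apply: measurableI.
  by rewrite -[X in measurable X]setTI; exact: psi_meas.
exact: (geodesic_measurable).
Qed.

(** The pushforward of nu by the distance to phi 0 agrees with Lebesgue measure on
    short intervals, then by additivity on all half-open intervals away from the
    endpoints; uniqueness of Lebesgue measure extends this to Borel sets. *)
Lemma nu_geodesic_image phi l (B : set R) : geodesic phi l -> 0 <= l ->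
  measurable B -> nu (phi @` (B `&` `]0, l[)) = mu (B `&` `]0, l[).
Proof.
move=> gp l0 mB.
have mseg := geodesic_measurable gp l0.
pose m1 : {measure set (measurableTypeR R) -> \bar R} :=
  measure_function_pushforward__canonical__measure_function_Measure (mrestr nu mseg)
    (psi_meas phi : measurable_fun setT (psi_ phi : T -> measurableTypeR R)).
have m1E (A : set R) : m1 A = nu (phi @` (A `&` `]0, l[)).
  by rewrite -psiE.
have m1mu (A : set R) : A `<=` `]0, l[ -> m1 A = nu (phi @` A).
  by move=> Al; rewrite m1E (setIidl Al).
have i0 := iota0_gt0.
have m1oo s t : 0 < s -> s < t -> t < l -> t - s < iota0 -> m1 `]s, t[%classic = (t - s)%:E.
  move=> s0 st tl tsi; rewrite m1mu ?(nu_short gp)//.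
  by move=> w; rewrite /= !in_itv/=; lra.
have m1pt t : 0 < t < l -> m1 [set t] = 0%E.
  move=> tl; apply/eqP; rewrite eq_le measure_ge0 andbT.
  apply/lee_addgt0Pr => e e0; rewrite add0e.
  pose d := Num.min (Num.min (t / 2) ((l - t) / 2)) (Num.min (iota0 / 4) (e / 2)).
  have d0 : 0 < d by rewrite !lt_min !divr_gt0//; lra.
  have [d1 d2 d3 d4] : [/\ d <= t / 2, d <= (l - t) / 2, d <= iota0 / 4 & d <= e / 2].
    by rewrite /d !ge_min !lexx/= !orbT.
  apply: (@le_trans _ _ (m1 `]t - d, t + d[%classic)).
    apply: le_measure; rewrite ?inE//; by move=> w ->; rewrite /= in_itv/=; lra.
  by rewrite m1oo ?lee_fin; lra.
have m1oc n : forall s t, 0 < s -> s < t -> t < l -> t - s < iota0 * n.+1%:R ->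
    m1 `]s, t]%classic = (t - s)%:E.
  elim: n => [|n IH] s t s0 st tl ts.
    rewrite (_ : `]s, t]%classic = `]s, t[%classic `|` [set t]); last first.
      apply/seteqP; split => w /=; rewrite !in_itv/=; last by case => [|->]; lra.
      by rewrite (le_eqVlt w) => /andP[->] /predU1P[->|->]; [right|left].
    transitivity (m1 `]s, t[%classic + m1 [set t])%E; last first.
      by rewrite m1pt ?m1oo ?adde0//; lra.
    apply: measureU => //.
    by apply/seteqP; split => // w /= []; rewrite in_itv/= => + wt; rewrite wt; lra.
  pose c := (s + t) / 2.
  have sc : s < c by rewrite /c; lra.
  have ct : c < t by rewrite /c; lra.
  have n2 : iota0 * n.+2%:R <= 2 * (iota0 * n.+1%:R).
    rewrite mulrCA ler_pM2l// -natrM ler_nat; lia.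
  rewrite (_ : `]s, t]%classic = `]s, c]%classic `|` `]c, t]%classic); last first.
    apply/seteqP; split => w /=; rewrite !in_itv/=; last by case; lra.
    by case: (leP w c) => ? ?; [left|right]; lra.
  transitivity (m1 `]s, c]%classic + m1 `]c, t]%classic)%E.
    by apply: measureU => //; apply/seteqP; split => // w /=; rewrite !in_itv/=; lra.
  by rewrite !IH//; [rewrite -EFinD; congr EFin; ring|rewrite /c; lra..].
have {}m1oc s t : 0 < s -> s <= t -> t < l -> m1 `]s, t]%classic = mu `]s, t]%classic.
  rewrite le_eqVlt => s0 /predU1P[->|st] tl; first by rewrite set_itv_ge ?bnd_simp ?ltxx// !measure0.
  rewrite (m1oc (Num.truncn ((t - s) / iota0))) ?lebesgue_measure_itv/= ?lte_fin ?st//.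
  by rewrite mulrC -ltr_pdivrMr// truncnS_gt.
have m1cd c d : 0 < c -> d < l -> forall A : set R, measurable A ->
    m1 (A `&` `]c, d]) = mu (A `&` `]c, d]).
  move=> c0 dl A mA.
  have mcd : measurable (`]c, d]%classic : set (measurableTypeR R)) by exact: measurable_itv.
  pose m2 : {measure set (measurableTypeR R) -> \bar R} :=
    measure_add (mrestr m1 mcd) (mrestr mu (measurableC mcd)).
  have m2E (E : set R) : m2 E = (m1 (E `&` `]c, d]) + mu (E `&` ~` `]c, d]%classic))%E.
    exact: measure_addE.
  have := @lebesgue_measure_unique R m2 _ (A `&` `]c, d]) (measurableI _ _ mA mcd).
  rewrite m2E -setIA setIid -[in X in (_ + X)%E]setIA setICr setI0 measure0 adde0 => <- //.
  move=> _ [[a b] _ <-]/=; rewrite m2E.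
  have -> : `]a, b]%classic `&` `]c, d]%classic = `]Num.max a c, Num.min b d]%classic.
    by apply/seteqP; split => w /=; rewrite !in_itv/= gt_max le_min; lra.
  have [mm|mm] := leP (Num.max a c) (Num.min b d).
    rewrite m1oc//; last 2 first.
    - by rewrite lt_max c0 orbT.
    - by rewrite gt_min dl orbT.
    have -> : `]Num.max a c, Num.min b d]%classic = `]a, b]%classic `&` `]c, d]%classic.
      by apply/seteqP; split => w /=; rewrite !in_itv/= gt_max le_min; lra.
    rewrite addeC -setDE -measureDI//.
  have -> : `]Num.max a c, Num.min b d]%classic = set0.
    by apply/seteqP; split => // w; rewrite /= in_itv/=; lra.
  rewrite measure0 add0e; congr (mu _); apply/seteqP; split => w /=; last by case.
  rewrite !in_itv/= => wab; split => // wcd.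
  by move: mm; rewrite gt_min !lt_max; lra.
pose D n : set R := `]l / n.+3%:R, l - l / n.+3%:R]%classic.
have [l00|lp] : l = 0 \/ 0 < l by move: l0; rewrite le_eqVlt => /predU1P[->|]; [left|right].
  by rewrite l00 set_itv_ge ?bnd_simp ?ltxx// setI0 image_set0 !measure0.
have DU : \bigcup_n (B `&` D n) = B `&` `]0, l[.
  rewrite -setI_bigcupr; congr (_ `&` _); apply/seteqP; split => w.
    move=> [n _]; rewrite /D/= !in_itv/= => /andP[w1 w2].
    have ln : 0 < l / n.+3%:R by rewrite divr_gt0// ltr0n.
    by move: (l / _) w1 w2 ln => q; lra.
  rewrite /= in_itv/= => /andP[w0 wl].
  pose m := Num.min w (l - w).
  have m0 : 0 < m by rewrite lt_min w0 subr_gt0.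
  exists (Num.truncn (l / m)) => //; rewrite /D/= in_itv/=.
  have : l / (Num.truncn (l / m)).+3%:R < m.
    rewrite ltr_pdivrMr ?ltr0n// mulrC -ltr_pdivrMr// (lt_le_trans (truncnS_gt _))// ler_nat.
    exact: leqW (leqnSn _).
  by rewrite /m lt_min; move: (l / _) => q; lra.
have mD n : measurable (B `&` D n) by apply: measurableI => //; exact: measurable_itv.
have ndD : {homo (fun n => B `&` D n) : n m / (n <= m)%N >-> (n <= m)%O}.
  move=> n m nm; apply/subsetPset; apply: setIS => w; rewrite /D/= !in_itv/=.
  have : l / m.+3%:R <= l / n.+3%:R.
    by rewrite ler_pM2l// lef_pV2 ?posrE ?ltr0n// ler_nat !ltnS.
  by move: (l / m.+3%:R) (l / n.+3%:R) => q q'; lra.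
have mU : measurable (\bigcup_n (B `&` D n)) by exact: bigcupT_measurable.
have c1 : m1 (B `&` D n) @[n --> \oo] --> m1 (\bigcup_n (B `&` D n)).
  exact: nondecreasing_cvg_mu.
have c2 : mu (B `&` D n) @[n --> \oo] --> mu (\bigcup_n (B `&` D n)).
  exact: nondecreasing_cvg_mu.
have E : m1 (\bigcup_n (B `&` D n)) = mu (\bigcup_n (B `&` D n)).
  apply: (cvg_unique _ c1) => //; rewrite (_ : (fun n => m1 _) = (fun n => mu (B `&` D n)))//.
  apply/funext => n; apply: m1cd => //; first by rewrite divr_gt0// ltr0n.
  by rewrite ltrBlDr ltrDl divr_gt0// ltr0n.
by move: E; rewrite DU m1E -setIA setIid.
Qed.

(** Generating segments are closed arcs minus two points, and phi is continuous. *)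
Lemma geodesic_measurable_fun phi l : geodesic phi l -> 0 <= l ->
  measurable_fun (`]0, l[%classic : set R) (phi : R -> T).
Proof.
move=> gp l0; apply: (@measurability _ _ _ T _ _ (segments iota V)) => //.
move=> _ [A [x [y [Vx Vy d ->]]] <-].
have [gam [gg g0 gl]] := geodesic_exists d.
set l' := mdist x y in d gg gl.
have l'0 : 0 <= l' by exact: mdist_ge0.
have li : 0 <= l' < iota (gam 0) by rewrite l'0 g0.
have -> : segment_at iota x x y = gam @` `]0, l'[.
  by have := segment_geodesic li gg; rewrite g0 gl.
rewrite open_segmentE//.
have cp : continuous (phi \o clamp l) by exact: geodesic_clamp_continuous.
have mC (C : set X) : closed C -> measurable (`]0, l[%classic `&` phi @^-1` C : set R).
  move=> cC.
  have -> : `]0, l[%classic `&` phi @^-1` C = `]0, l[%classic `&` (phi \o clamp l) @^-1` C.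
    apply/seteqP; split => t [tl Ct]; split => //; have := tl; rewrite /= in_itv/= => tl'.
      by rewrite /= clamp_id//; lra.
    by move: Ct; rewrite /= clamp_id//; lra.
  apply: measurableI => //; apply: closed_measurable; exact: preimage_closed.
rewrite (_ : _ `&` _ = (`]0, l[ `&` phi @^-1` (gam @` `[0, l'])) `\`
   (`]0, l[ `&` phi @^-1` [set gam 0]) `\` (`]0, l[ `&` phi @^-1` [set gam l'])).
  apply: measurableD; [apply: measurableD|]; apply: mC; last 2 first.
  - exact: metric_closed1.
  - exact: metric_closed1.
  - exact: geodesic_closed.
apply/seteqP; split => [t [tl [[a b] c]]|t [[[tl a] b] c]].
  by split; [split; [split|case]|case].
by split => //; split; [split => // E; apply: b|move=> E; apply: c].
Qed.

(** On subsets of the arc, nu is the image of Lebesgue measure under phi by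
    [nu_geodesic_image]. *)
Lemma ge0_integral_geodesic phi l (H : T -> \bar R) : geodesic phi l -> 0 <= l ->
  measurable_fun (phi @` `]0, l[ : set T) H ->
  (forall z, (phi @` `]0, l[) z -> (0 <= H z)%E) ->
  (\int[nu]_(z in (phi @` `]0%R, l[)%classic) H z = \int[mu]_(t in `]0%R, l[) H (phi t))%E.
Proof.
move=> gp l0 mH H0; pose D : set T := phi @` `]0, l[.
pose phi' (t : R) : T := if t \in (`]0, l[%classic : set R) then phi t else phi 0.
have mD : measurable D := geodesic_measurable gp l0.
have nD0 : ~ D (phi 0).
  by rewrite /D open_segmentE// => -[[_ /(_ erefl)]].
have phiE (A : set T) : A `<=` D -> phi' @^-1` A = (`]0, l[ `&` phi @^-1` A) `&` `]0, l[.
  move=> AD; apply/seteqP; split => t; rewrite /phi' /=.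
    by case: ifPn => [/set_mem tl At//|_ /AD].
  by move=> [[tl At] _]; rewrite mem_set.
have mphi' : measurable_fun setT phi'.
  move=> _ E mE; rewrite setTI.
  have mP := geodesic_measurable_fun gp l0 (measurable_itv _) mE.
  have [E0|E0] := pselect (E (phi 0)).
    rewrite (_ : _ @^-1` _ = (`]0, l[ `&` phi @^-1` E) `|` ~` `]0, l[%classic).
      by apply: measurableU => //; exact: measurableC.
    apply/seteqP; split => t; rewrite /phi' /=.
      by case: ifPn => [/set_mem tl Et|/negP tl _]; [left|right => tl'; apply: tl; exact: mem_set].
    by case=> [[tl Et]|ntl]; [rewrite mem_set|rewrite memNset].
  rewrite (_ : _ @^-1` _ = `]0, l[ `&` phi @^-1` E)//.
  apply/seteqP; split => t; rewrite /phi' /=.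
    by case: ifPn => [/set_mem|].
  by move=> [tl Et]; rewrite mem_set.
rewrite -/D (eq_measure_integral (measure_function_pushforward__canonical__measure_function_Measure mu mphi')); last first.
  move=> A mA AD; have mP := geodesic_measurable_fun gp l0 (measurable_itv _) mA.
  transitivity (mu (phi' @^-1` A)); last by [].
  rewrite phiE// -(nu_geodesic_image gp l0 mP); congr (nu _).
  apply/seteqP; split => z.
    by move=> Az; have [t tl tz] := AD z Az; exists t => //; split=> //; split => //=; rewrite tz.
  by move=> [t [[_ At] _] <-].
rewrite ge0_integral_pushforward//; last by move=> z; rewrite inE => /H0.
rewrite phiE// (_ : _ `&` _ = `]0, l[%classic); last first.
  by apply/seteqP; split => [t [[]]|t tl] //; do 2?split => //; exists t.
by apply: eq_integral => t tl; rewrite /phi' /= tl.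
Qed.

Lemma integral_geodesic phi l (H : T -> \bar R) : geodesic phi l -> 0 <= l ->
  measurable_fun (phi @` `]0, l[ : set T) H ->
  (\int[nu]_(z in (phi @` `]0%R, l[)%classic) H z = \int[mu]_(t in `]0%R, l[) H (phi t))%E.
Proof.
move=> gp l0 mH; rewrite integralE [RHS]integralE; congr (_ - _)%E.
- rewrite (@ge0_integral_geodesic phi l (H^\+)%E)//; last exact: measurable_funepos.
  apply: eq_integral => t _.
  exact: (congr1 (fun F => F t) (esym (funepos_comp _ phi))).
- rewrite (@ge0_integral_geodesic phi l (H^\-)%E)//; last exact: measurable_funeneg.
  apply: eq_integral => t _.
  exact: (congr1 (fun F => F t) (esym (funeneg_comp _ phi))).
Qed.

Lemma integrable_geodesic phi l (H : T -> \bar R) : geodesic phi l -> 0 <= l ->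
  measurable_fun (phi @` `]0, l[ : set T) H ->
  nu.-integrable (phi @` `]0, l[) H <-> mu.-integrable `]0, l[ (H \o phi).
Proof.
move=> gp l0 mH.
have mHp : measurable_fun (`]0, l[%classic : set R) (H \o phi).
  have := @measurable_comp _ _ _ _ _ _ (phi @` `]0, l[ : set T) H (`]0, l[%classic : set R) phi.
  apply => //; first exact: (geodesic_measurable).
  exact: geodesic_measurable_fun.
have E : (\int[nu]_(z in (phi @` `]0%R, l[)%classic) `|H z| = \int[mu]_(t in `]0%R, l[) `|H (phi t)|)%E.
  by rewrite (@ge0_integral_geodesic phi l (fun z => `|H z|%E))//; exact: measurableT_comp.
split => /integrableP[_ fin]; apply/integrableP; split => //; first by rewrite -E.
by rewrite E.
Qed.

End length_measure_pushforward.

(** * Gluing derivatives along geodesics into a weak gradient *)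

Section gradients.
Local Notation T := (segment_space iota V).
Local Notation S := (skeleton iota).
Local Notation mu := (@lebesgue_measure R).
Implicit Types (x y z : X) (f g h : X -> R) (phi psi : R -> X).

(** Along a geodesic nu is Lebesgue measure, so negligible sets pull back to
    negligible sets. *)
Lemma ae_geodesic (P : X -> Prop) phi l : {ae nu, forall z, P z} ->
  geodesic phi l -> 0 <= l -> {ae mu, forall t, 0 < t < l -> P (phi t)}.
Proof.
move=> [N [mN N0 PN]] gp l0.
pose B := (`]0, l[ `&` (phi : R -> T) @^-1` N)%classic.
have mB : measurable B by exact: (geodesic_measurable_fun gp l0).
exists B; split => //; last first.
  move=> t /= nP; split; last by apply: PN => Pt; apply: nP.
  by rewrite /= in_itv/=; apply: contrapT => t0; apply: nP => /t0.
have mI := geodesic_image_measurable gp l0 mB.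
have BB : B `&` `]0, l[%classic = B by apply/setIidPl => t [].
apply/eqP; rewrite eq_le measure_ge0 andbT.
apply: (@le_trans _ _ (nu N)); last by rewrite N0.
have -> : mu B = nu [set phi x | x in B `&` `]0, l[%classic].
  by rewrite (nu_geodesic_image gp l0 mB) BB.
by apply: le_measure; rewrite ?inE// => _ [t [[_ Nt] _] <-].
Qed.

(** The pieces of phi and psi between two common points coincide by uniqueness of
    short geodesics; the direction sg records which end comes first. *)
Lemma geodesic_reparam phi l psi L a b t : geodesic phi l -> l < iota0 ->
  geodesic psi L -> 0 <= a -> a < t < b -> b <= L ->
  (phi @` `[0, l])%classic (psi a) -> (phi @` `[0, l])%classic (psi b) ->
  exists sg d, [/\ `|sg| = 1, 0 < d & forall s, `|s - t| < d ->
    0 <= mdist (phi 0) (psi t) + sg * (s - t) <= l /\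
    psi s = phi (mdist (phi 0) (psi t) + sg * (s - t))].
Proof.
move=> gp li gs a0 /andP[at' tb] bL [s0 /= s0l E0] [s1 /= s1l E1].
rewrite !in_itv/= in s0l s1l.
have D : `|s0 - s1| = b - a.
  have ab := lt_trans at' tb.
  rewrite -gp// E0 E1 gs; [|lra|lra].
  by rewrite distrC gtr0_norm ?subr_gt0.
have [sg sg1 Es] : exists2 sg : R, sg = 1 \/ sg = - 1 & s1 = s0 + sg * (b - a).
  case/orP: (le_total s0 s1) => ss.
    by exists 1; [left|rewrite -D distrC ger0_norm ?subr_ge0// mul1r addrC subrK].
  by exists (- 1); [right|rewrite -D ger0_norm ?subr_ge0// mulN1r opprB addrC subrK].
have sgn : `|sg| = 1 by case: sg1 => ->; rewrite ?normrN normr1.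
have inl u : 0 <= u <= b - a -> 0 <= s0 + sg * u <= l.
  by case: sg1 Es => -> Es; lra.
pose phi' u := phi (s0 + sg * u); pose psi' u := psi (a + u).
have gp' : geodesic phi' (b - a).
  move=> u v ub vb; rewrite gp ?inl//.
  by rewrite (_ : _ - _ = sg * (u - v)) ?normrM ?sgn ?mul1r//; ring.
have gs' : geodesic psi' (b - a) by apply: (geodesic_shift gs).
have ab0 : 0 <= b - a < iota (psi' 0).
  rewrite subr_ge0 ltW ?(lt_trans at')//= (lt_le_trans _ (hiota _))//.
  by apply: le_lt_trans li; rewrite -D ler_norml; lra.
have E u : 0 <= u <= b - a -> psi' u = phi' u.
  apply: (geodesic_unique ab0 gs' gp'); rewrite /psi' /phi'.
    by rewrite mulr0 !addr0.
  by rewrite -Es E1 (addrC a) subrK.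
have Et : psi t = phi (s0 + sg * (t - a)).
  by have := E (t - a); rewrite /psi' /phi' (addrC a) subrK => -> //; lra.
have tl : 0 <= s0 + sg * (t - a) <= l by apply: inl; lra.
exists sg, (Num.min (t - a) (b - t)); split => //; first by rewrite lt_min !subr_gt0 at'.
move=> s; rewrite lt_min !ltr_norml => /andP[/andP[h1 h2] /andP[h3 h4]].
rewrite Et (geodesic_dist0 gp tl) -addrA -mulrDr (_ : t - a + (s - t) = s - a); last by ring.
split; first by apply: inl; lra.
by have := E (s - a); rewrite /psi' /phi' (addrC a) subrK => -> //; lra.
Qed.

(** The exceptional parameters are the largest and the smallest one satisfying P.
    With P t saying that psi t lies on an arc, almost every t in the overlap is
    interior to it. *)
Lemma ae_between (P : R -> Prop) :
  {ae mu, forall t, P t -> exists a b, [/\ P a, P b & a < t < b]}.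
Proof.
pose Hi := [set t | P t /\ forall b, P b -> b <= t].
pose Lo := [set t | P t /\ forall b, P b -> t <= b].
have null (Q : set R) : (forall s t, Q s -> Q t -> s = t) -> mu.-negligible Q.
  move=> Q1; have [[t0 Qt0]|nQ] := pselect (exists t, Q t).
    exists [set t0]; split; [exact: measurable_set1|exact: lebesgue_measure_set1|].
    by move=> t Qt; exact: Q1.
  by exists set0; split => // t Qt; apply: nQ; exists t.
have nHi : mu.-negligible Hi.
  by apply: null => s t [Ps s1] [Pt t1]; apply/eqP; rewrite eq_le s1// t1.
have nLo : mu.-negligible Lo.
  by apply: null => s t [Ps s1] [Pt t1]; apply/eqP; rewrite eq_le s1// t1.
apply: negligibleS (negligibleU nHi nLo) => t /=; apply: contra_notP => nU Pt.
have [b Pb tb] : exists2 b, P b & t < b.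
  apply: contrapT => H; apply: nU; left; split => // b Pb; rewrite leNgt.
  by apply/negP => tb; apply: H; exists b.
have [a Pa at'] : exists2 a, P a & a < t.
  apply: contrapT => H; apply: nU; right; split => // a Pa; rewrite leNgt.
  by apply/negP => at'; apply: H; exists a.
by exists a, b; rewrite at'.
Qed.

Lemma ae_arc (P : R -> Prop) phi l : geodesic phi l -> 0 <= l ->
  {ae mu, forall t, 0 < t < l -> P t} ->
  {ae nu, forall z, (phi @` `]0, l[)%classic z -> P (mdist (phi 0) z)}.
Proof.
move=> gp l0 [N [mN N0 PN]].
exists (phi @` (N `&` `]0, l[))%classic; split.
- exact: (geodesic_image_measurable gp l0 mN).
- rewrite (nu_geodesic_image gp l0 mN).
  apply/eqP; rewrite eq_le measure_ge0 andbT -[leRHS]N0.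
  by apply: le_measure; rewrite ?inE//; exact: measurableI.
- move=> z /=; apply: contra_notP => nz [t tl tz].
  have t0 : 0 < t < l by move: tl; rewrite /= in_itv.
  rewrite -tz (geodesic_dist0 gp); last by lra.
  apply: contrapT => nP; apply: nz; exists t => //; split => //.
  by apply: PN => /= /(_ t0).
Qed.

(** k is a derivative of f along phi in the sense of absolute continuity. *)
Definition density f k phi l :=
  mu.-integrable setT (EFin \o k) /\
  forall t, 0 <= t <= l -> f (phi t) - f (phi 0) = \int[mu]_(s in `[0, t]) k s.

(** At interior points of the overlap phi and psi differ by a shift or a flip
    ([geodesic_reparam]), and derivatives are unique. *)
Lemma ae_transition f phi l k psi L kpsi : geodesic phi l -> 0 <= l < iota0 ->
  geodesic psi L -> 0 <= L -> density f k phi l -> density f kpsi psi L ->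
  {ae mu, forall t, 0 < t < L -> (phi @` `]0, l[)%classic (psi t) ->
    exists sg d, [/\ `|sg| = 1, 0 < d,
      forall s, `|s - t| < d ->
        0 <= mdist (phi 0) (psi t) + sg * (s - t) <= l /\
        psi s = phi (mdist (phi 0) (psi t) + sg * (s - t)) &
      kpsi t = sg * k (mdist (phi 0) (psi t))]}.
Proof.
move=> gp /andP[l0 li] gs L0 [ik Dk] [ikp Dkp].
have A1 := ae_between (fun t => 0 <= t <= L /\ (phi @` `[0, l])%classic (psi t)).
have A2 := @ae_has_deriv _ (f \o psi) kpsi L ikp Dkp.
have A3 := ae_geodesic (ae_arc gp l0 (@ae_has_deriv _ (f \o phi) k l ik Dk)) gs L0.
apply: ae_imp2 (ae_imp2 _ A2 A3) A1 => [t H1 H2|t H1 H2]; last exact: (conj H1 H2).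
move=> t0 tphi; have [D2 D3] := H1; have {}D2 := D2 t0; have {}D3 := D3 t0 tphi.
have [|a [b [[a0 pa] [b0 pb] tab]]] := H2.
  split; first by lra.
  case: tphi => s /= sl <-; exists s => //=.
  by move: sl; rewrite /= !in_itv/=; lra.
have [sg [d [sg1 d0 Hd]]] := @geodesic_reparam phi l psi L a b t gp li gs
  (andP a0).1 tab (andP b0).2 pa pb.
exists sg, d; split => //; apply: has_deriv_unique D2 _.
apply: has_deriv_flip sg1 d0 _ D3 => s /Hd[_ /= ->] //.
Qed.

Section gluing.
Variables (phi : nat -> R -> X) (l : nat -> R).
Hypotheses (hphi : forall n, geodesic (phi n) (l n) /\ 0 <= l n < iota0)
  (cover : S = (\bigcup_n (phi n @` `]0, l n[))%classic).

Let arc n : set X := (phi n @` `]0, l n[)%classic.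

Let arc_measurable n : measurable (arc n : set T).
Proof. by have [gp /andP[l0 _]] := hphi n; exact: (geodesic_measurable gp l0). Qed.

(** The arcs made disjoint: a point is attributed to the first arc through it. *)
Definition first_arc n : set T := seqDU arc n.

Lemma first_arc_measurable n : measurable (first_arc n).
Proof. exact: seqDU_measurable. Qed.

Lemma first_arc_sub n : first_arc n `<=` arc n.
Proof. exact: subset_seqDU. Qed.

Lemma first_arc_cover : S = \bigcup_n first_arc n.
Proof. by rewrite cover seqDU_bigcup_eq. Qed.

Definition arc_index z : nat := get [set n | first_arc n z].

Lemma arc_indexE n z : first_arc n z -> arc_index z = n.
Proof.
move=> nz; have H : first_arc (arc_index z) z by apply: (@getPex _ [set n | first_arc n z]); exists n.
by apply: (trivIset_seqDU arc) => //; exists z.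
Qed.

Lemma arc_index_measurable d (Y : measurableType d) (F : nat -> X -> Y) :
  (forall n, measurable_fun (first_arc n) (F n : T -> Y)) ->
  measurable_fun (S : set T) ((fun z => F (arc_index z) z) : T -> Y).
Proof.
move=> mF; rewrite first_arc_cover; apply/measurable_fun_bigcup.
  by move=> n; exact: first_arc_measurable.
move=> n; apply: eq_measurable_fun (mF n) => z; rewrite inE => nz.
by rewrite (arc_indexE nz).
Qed.

Lemma arc_index_in z : S z -> first_arc (arc_index z) z.
Proof.
by rewrite first_arc_cover => -[n _ nz]; rewrite (arc_indexE nz).
Qed.

(** Moving from z along phi n increases the distance to x. Testing the displacements
    1 / (j + 1) only keeps the condition measurable in z. *)
Definition outward n x z := exists N, forall j, (N <= j)%N ->
  mdist x z < mdist x (phi n (clamp (l n) (mdist (phi n 0) z + j.+1%:R^-1))).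

Definition orientation n x z : R := if `[< outward n x z >] then 1 else - 1.

Lemma norm_orientation n x z : `|orientation n x z| = 1.
Proof. by rewrite /orientation; case: ifP => _; rewrite ?normrN normr1. Qed.

Lemma orientation_measurable n x :
  measurable_fun (S : set T) (orientation n x : T -> R).
Proof.
have [gp /andP[l0 _]] := hphi n.
have mS := skeleton_measurable.
pose v j z := mdist x (phi n (clamp (l n) (mdist (phi n 0) z + j.+1%:R^-1))).
have cv j : continuous (v j).
  move=> z; apply: (@continuous_comp _ _ _ (fun z => mdist (phi n 0) z + j.+1%:R^-1)
    (mdist x \o (phi n \o clamp (l n)))).
    by apply: continuousD; [exact: mdist_continuous|exact: cst_continuous].
  apply: continuous_comp; first exact: geodesic_clamp_continuous.
  exact: mdist_continuous.
have mv j : measurable_fun (S : set T) (v j : T -> R).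
  exact: (continuous_skeleton_measurable (cv j)).
have mx := mdist_measurable x.
apply: measurable_fun_if => //.
apply: (measurable_fun_bool true).
rewrite (_ : _ `&` _ = \bigcup_N \bigcap_(j in [set j | (N <= j)%N]) (S `&` [set z | mdist x z < v j z])).
  apply: bigcupT_measurable => N; apply: bigcap_measurable => [|j _]; first by exists N => /=.
  exact: (measurable_fun_ltr mx (mv j) mS (Y := [set true])).
apply/seteqP; split => z /=.
  by move=> [Sz /asboolP[N HN]]; exists N => // j /HN.
move=> [N _ HN]; have [Sz _] := HN N (leqnn N); split => //.
by apply/asboolP; exists N => j /HN[].
Qed.

(** Along a geodesic psi issued from x the distance to x grows at unit speed, so
    the orientation of an arc at psi t is its direction relative to psi. *)
Lemma orientation_transition n psi L t sg d : geodesic psi L -> 0 < t < L ->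
  `|sg| = 1 -> 0 < d ->
  (forall s, `|s - t| < d -> 0 <= mdist (phi n 0) (psi t) + sg * (s - t) <= l n /\
     psi s = phi n (mdist (phi n 0) (psi t) + sg * (s - t))) ->
  orientation n (psi 0) (psi t) = sg.
Proof.
move=> gs /andP[t0 tL] sg1 d0 H.
have sgE : sg = 1 \/ sg = - 1.
  by case: (lerP 0 sg) sg1 => s0; [rewrite ger0_norm//; left|rewrite ltr0_norm// => <-; right; rewrite opprK].
pose d' := Num.min d (Num.min t (L - t)).
have d'0 : 0 < d' by rewrite !lt_min d0 t0 subr_gt0.
have [N _ HN] := near_infty_natSinv_lt (PosNum d'0).
have key j : (N <= j)%N -> mdist (psi 0) (phi n (clamp (l n)
    (mdist (phi n 0) (psi t) + j.+1%:R^-1))) = t + sg * j.+1%:R^-1.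
  move=> Nj; have := HN j Nj; rewrite /= !lt_min => /and3P[jd jt jL].
  have e0 : 0 < j.+1%:R^-1 :> R by rewrite invr_gt0.
  move: (j.+1%:R^-1) e0 jd jt jL => e e0 jd jt jL.
  have st : `|t + sg * e - t| < d by rewrite addrC addKr normrM sg1 mul1r gtr0_norm.
  have [i1] := H _ st.
  rewrite (_ : sg * (t + sg * e - t) = e) in i1 *; last first.
    by case: sgE => ->; ring.
  by move=> i2; rewrite clamp_id// -i2 (geodesic_dist0 gs)//; case: sgE => ->; lra.
have dt : mdist (psi 0) (psi t) = t by rewrite (geodesic_dist0 gs)//; lra.
have e0 j : 0 < j.+1%:R^-1 :> R by rewrite invr_gt0.
rewrite /orientation; case: sgE => E; rewrite E in key *.
  rewrite asboolT//; exists N => j Nj; rewrite key// dt mul1r ltrDl//.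
rewrite asboolF// => -[M HM]; have := HM (maxn M N) (leq_maxl _ _).
by rewrite key ?leq_maxr// dt mulN1r ltNge gerBl ltW.
Qed.

Section assembled_gradient.
Variables (f : X -> R) (k : nat -> R -> R).
Hypothesis kdens : forall n, density f (k n) (phi n) (l n).

(** The derivative along the first arc through z, with the sign it gets when the arc
    is run through away from x. The position of z on the arc is read off its
    distance to the starting point. *)
Definition glued_gradient x z : R := orientation (arc_index z) x z *
  k (arc_index z) (mdist (phi (arc_index z) 0) z).

Definition glued_abs_gradient z : R := `|k (arc_index z) (mdist (phi (arc_index z) 0) z)|.

Lemma norm_glued_gradient x z : `|glued_gradient x z| = glued_abs_gradient z.
Proof. by rewrite normrM norm_orientation mul1r. Qed.

Lemma glued_gradient_measurable x : measurable_fun (S : set T) (glued_gradient x : T -> R).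
Proof.
have mS := skeleton_measurable.
apply: (arc_index_measurable (F := fun n z => orientation n x z * k n (mdist (phi n 0) z))) => n.
have sS : first_arc n `<=` S by rewrite first_arc_cover => z nz; exists n.
apply: (measurable_funS mS sS); apply: measurable_funM.
  exact: orientation_measurable.
have [ik _] := kdens n.
apply: (measurable_comp (F := [set: R])) => //.
  by apply/measurable_EFinP; exact: measurable_int ik.
exact: (mdist_measurable).
Qed.

Lemma glued_gradient_along psi L kpsi : geodesic psi L -> 0 <= L ->
  density f kpsi psi L ->
  {ae mu, forall t, 0 < t < L -> kpsi t = glued_gradient (psi 0) (psi t)}.
Proof.
move=> gs L0 dpsi.
have A n : {ae mu, forall t, 0 < t < L -> arc n (psi t) ->
    kpsi t = orientation n (psi 0) (psi t) * k n (mdist (phi n 0) (psi t))}.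
  have [gp ln] := hphi n.
  apply: ae_imp (ae_transition gp ln gs L0 (kdens n) dpsi) => t H tL /(H tL).
  move=> [sg [d [sg1 d0 Hd ->]]]; congr (_ * _).
  by rewrite (orientation_transition gs tL sg1 d0 Hd).
apply: ae_imp (ae_foralln A) => t H tL; apply: H => //.
apply: first_arc_sub; apply: arc_index_in.
exact: (geodesic_skeleton gs tL).
Qed.

Lemma density_integral kpsi psi L t : density f kpsi psi L -> 0 <= t <= L ->
  (\int[mu]_(s in `]0%R, t[) (kpsi s)%:E = (f (psi t) - f (psi 0))%:E)%E.
Proof.
move=> [ik Dk] tL; rewrite (Dk t tL) /Rintegral.
have mk : measurable_fun setT (EFin \o kpsi) by exact: measurable_int ik.
rewrite fineK; last first.
  by apply: integrable_fin_num => //; apply: integrableS ik.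
by rewrite (integral_itv_bndoo (f := EFin \o kpsi) true false)//; exact: measurable_funTS.
Qed.

Lemma skeleton_fun_along (G : X -> R) psi L : geodesic psi L -> 0 <= L ->
  measurable_fun (S : set T) (G : T -> R) -> measurable_fun `]0, L[%classic (G \o psi).
Proof.
move=> gs L0 mG.
have mS := skeleton_measurable.
apply: (measurable_comp (F := (S : set T))) mG _ => //.
  exact: (geodesic_sub_skeleton gs).
exact: (geodesic_measurable_fun gs L0).
Qed.

(** On every geodesic, |glued_gradient| is almost everywhere the absolute value of
    the density there, hence integrable on segments; on those issued from x, it has
    the right sign and integrates to the increments of f. *)
Lemma glued_gradientP :
  (forall psi L, geodesic psi L -> 0 <= L -> exists kpsi, density f kpsi psi L) ->
  is_abs_gradient nu f glued_abs_gradient.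
Proof.
move=> ac; have mS := skeleton_measurable.
have mg x := glued_gradient_measurable x.
have mh : measurable_fun (S : set T) (glued_abs_gradient : T -> R).
  rewrite (_ : glued_abs_gradient = Num.norm \o glued_gradient point).
    exact: measurableT_comp.
  by apply/funext => z; rewrite /= norm_glued_gradient.
split => //; first by move=> z _; exact: normr_ge0.
move=> x; exists (glued_gradient x); last first.
  by apply: aeW => z _; exact: norm_glued_gradient.
have mseg psi L (w : X) : geodesic psi L -> measurable_fun
    (psi @` `]0, L[ : set T)%classic (EFin \o glued_gradient w : T -> \bar R).
  move=> gs; apply: (measurable_funS mS).
    exact: (geodesic_sub_skeleton gs).
  by apply/measurable_EFinP.
split; first split.
- apply: (measurable_funS mS) => //; exact: subIsetl.
- move=> u v xu xv.
  have [psi [gs _ _ ->]] := segment_at_geodesic xu xv.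
  have L0 : 0 <= mdist u v by exact: mdist_ge0.
  have [kpsi dpsi] := ac _ _ gs L0.
  apply/(integrable_geodesic gs L0 (mseg _ _ x gs)).
  apply/integrableP; split.
    by apply/measurable_EFinP; exact: skeleton_fun_along.
  have [ik _] := dpsi.
  have ik' : mu.-integrable `]0, mdist u v[%classic (EFin \o kpsi) by exact: integrableS ik.
  have /integrableP[mk] := ik'; congr (_ < _)%E; apply: ae_eq_integral => //.
  + exact: measurableT_comp.
  + by apply: measurableT_comp => //; apply/measurable_EFinP; exact: skeleton_fun_along.
  + apply: ae_imp (glued_gradient_along gs L0 dpsi) => t H tI /=.
    have tL : 0 < t < mdist u v by move: tI; rewrite /= in_itv.
    by rewrite (H tL) !norm_glued_gradient.
- move=> u xu.
  have [psi [gs p0 pL ->]] := segment_at_geodesic (ballxx x (htree x).1) xu.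
  have L0 : 0 <= mdist x u by exact: mdist_ge0.
  have [kpsi dpsi] := ac _ _ gs L0.
  rewrite (integral_geodesic gs L0 (mseg _ _ x gs)).
  have LL : 0 <= mdist x u <= mdist x u by rewrite L0 lexx.
  have := density_integral dpsi LL; rewrite pL p0 => <-.
  have [ik _] := dpsi.
  apply: ae_eq_integral => //.
  + by apply: measurable_funTS; exact: measurable_int ik.
  + by apply/measurable_EFinP; exact: skeleton_fun_along.
  + apply: ae_imp (glued_gradient_along gs L0 dpsi) => t H tI /=.
    have tL : 0 < t < mdist x u by move: tI; rewrite /= in_itv.
    by rewrite (H tL) p0.
Qed.

End assembled_gradient.
End gluing.

(** A version of the weak gradient seen from phi 0, restricted to phi, is a density
    of f along phi. *)
Lemma abs_gradient_density f h phi l : is_abs_gradient nu f h -> geodesic phi l ->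
  0 <= l < iota0 -> exists2 k, density f k phi l &
    {ae mu, forall t, 0 < t < l -> `|k t| = h (phi t)}.
Proof.
move=> [_ _ /(_ (phi 0))[g [[mg ig] Dg] gh]] gp /andP[l0 li].
have lx : l < iota (phi 0) by exact: lt_le_trans (hiota _).
have dphi t : 0 <= t <= l -> mdist (phi 0) (phi t) = t by exact: geodesic_dist0.
have seg t : 0 <= t <= l ->
    segment_at iota (phi 0) (phi 0) (phi t) = (phi @` `]0, t[)%classic.
  move=> /andP[t0 tl]; have gt : geodesic phi t by move=> a b ? ?; apply: gp; lra.
  by apply: (segment_geodesic _ gt); rewrite t0 (le_lt_trans tl).
have inb t : 0 <= t <= l -> ball (phi 0) (iota (phi 0)) (phi t).
  by move=> tl; rewrite mball dphi//; case/andP: tl => _ /le_lt_trans; apply.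
have ll : 0 <= l <= l by rewrite l0 lexx.
pose k := (g \o phi) \_ `]0, l[%classic.
have ig0 : nu.-integrable (phi @` `]0, l[ : set T)%classic (EFin \o g : T -> \bar R).
  by rewrite -(seg l ll); apply: ig; [rewrite mball mdistxx; case: (htree (phi 0))|exact: inb].
have mgp t : 0 <= t <= l -> measurable_fun (phi @` `]0, t[ : set T)%classic (EFin \o g : T -> \bar R).
  move=> tl; apply: measurable_funS (measurable_int _ ig0).
    exact: (geodesic_measurable gp l0).
  move=> _ [s /= st <-]; exists s => //=; move: st; rewrite !in_itv/=; lra.
have igp : mu.-integrable `]0, l[%classic (EFin \o (g \o phi)).
  exact/(integrable_geodesic gp l0 (mgp l ll)).
have ik : mu.-integrable setT (EFin \o k).
  have := (@integrable_mkcond _ _ R mu `]0, l[%classic (EFin \o (g \o phi)) (measurable_itv _)).1 igp.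
  by rewrite restrict_EFin.
exists k.
  split => //.
  move=> t tl; have [t0 t1] := andP tl.
  have gt : geodesic phi t by move=> a b ? ?; apply: gp; lra.
  have := Dg (phi t) (inb t tl); rewrite (seg t tl).
  rewrite (integral_geodesic gt t0 (mgp t tl)) => E.
  apply: EFin_inj; rewrite E /Rintegral.
  have -> : (\int[mu]_(x in `[0%R, t]) (k x)%:E = \int[mu]_(x in `]0%R, t[) (g (phi x))%:E)%E.
    have mk : measurable_fun `]0, t[%classic (EFin \o k).
      by apply: measurable_funTS; exact: measurable_int ik.
    rewrite (integral_itv_bndoo (f := EFin \o k) true false)//.
    apply: eq_integral => s; rewrite inE /= in_itv/= => s0t.
    by rewrite /k patchE mem_set//= in_itv/=; lra.
  by rewrite -E.
have := ae_geodesic gh gp l0; apply: ae_imp => t H tl; rewrite -(H tl).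
  by rewrite /k patchE mem_set//= in_itv.
split; first exact: (geodesic_skeleton gp tl).
by apply: inb; lra.
Qed.

(** * Energy along disjoint arcs bounds the gradient *)

Section arcs_energy.
Variables (p : R) (p1 : 1 < p).

(** The property provided by [open_arcs_energy]; from here on, it is all that is
    used of the energy. *)
Definition arcs_energy_le f (B : R) := forall N (phi : nat -> R -> X) (l : nat -> R),
  (forall i, (i < N)%N -> geodesic (phi i) (l i) /\ 0 < l i) ->
  (forall i j, (i < j < N)%N ->
     (phi i @` `]0, l i[ `&` phi j @` `]0, l j[ = set0)%classic) ->
  \sum_(i < N) `|f (phi i (l i)) - f (phi i 0)| `^ p / l i `^ (p - 1) <= B.

Lemma arcs_energy_fin f B (J : finType) (P : pred J) (phi : J -> R -> X) (l : J -> R) :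
  arcs_energy_le f B -> (forall j, P j -> geodesic (phi j) (l j) /\ 0 < l j) ->
  (forall i j, P i -> P j -> i != j ->
     (phi i @` `]0, l i[ `&` phi j @` `]0, l j[ = set0)%classic) ->
  \sum_(j | P j) `|f (phi j (l j)) - f (phi j 0)| `^ p / l j `^ (p - 1) <= B.
Proof.
move=> fB gl dis; rewrite -big_enum /=.
case E : (enum P) => [|j0 s].
  have := fB 0%N (fun _ _ => point) (fun=> 0); rewrite big_ord0 big_nil; apply => //.
  by move=> i j; rewrite andbC.
rewrite -E (big_nth j0) big_mkord.
have P_ i : (i < size (enum P))%N -> P (nth j0 (enum P) i).
  by move=> /(mem_nth j0); rewrite mem_enum.
apply: (fB _ (fun i => phi (nth j0 (enum P) i)) (fun i => l (nth j0 (enum P) i))).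
  by move=> i /P_/gl.
move=> i j /andP[ij jN]; have iN := ltn_trans ij jN.
by apply: dis; [exact: P_|exact: P_|rewrite nth_uniq ?enum_uniq// ltn_eqF].
Qed.

Lemma geodesic_mesh psi L n : geodesic psi L -> 0 < L ->
  forall i, (i < n.+1)%N -> geodesic (fun t => psi (i%:R * mesh L n + t)) (mesh L n).
Proof.
move=> gs L0 i iN s t; have m0 : 0 < mesh L n by rewrite divr_gt0.
have mL : n.+1%:R * mesh L n = L by rewrite /mesh mulrC divfK.
have : i%:R * mesh L n + mesh L n <= L.
  by rewrite -[leRHS]mL -[X in _ + X]mul1r -mulrDl natr1 ler_pM2r// ler_nat.
have : 0 <= i%:R * mesh L n by rewrite mulr_ge0// ltW.
move=> h1 h2 sm tm; rewrite gs; [|lra|lra].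
by congr (`|_|); ring.
Qed.

(** Cutting psi into equal arcs verifies the hypothesis of [riesz_density]. *)
Lemma arcs_energy_density f B psi L : continuous f -> arcs_energy_le f B ->
  geodesic psi L -> 0 <= L -> exists k, density f k psi L.
Proof.
move=> cf fB gs; rewrite le_eqVlt => /predU1P[<-|L0].
  exists (fun=> 0); split; first exact: integrable0.
  move=> t; rewrite -eq_le => /eqP <-.
  by rewrite subrr /Rintegral integral0.
pose F := f \o (psi \o clamp L).
have cF : continuous F.
  move=> t; apply: continuous_comp; last exact: cf.
  exact: (geodesic_clamp_continuous gs (ltW L0)).
have [|k [ik Dk]] := riesz_density (K := B) L0 p1 cF.
  move=> n; rewrite -/(mesh L n).
  have m0 : 0 < mesh L n by rewrite divr_gt0.
  have mL : n.+1%:R * mesh L n = L by rewrite /mesh mulrC divfK.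
  have := fB n.+1 (fun i t => psi (i%:R * mesh L n + t)) (fun=> mesh L n).
  have inL i : (i <= n.+1)%N -> 0 <= i%:R * mesh L n <= L.
    by move=> iN; rewrite mulr_ge0 ?(ltW m0)//= -[leRHS]mL ler_pM2r// ler_nat.
  move=> H; apply: le_trans (H _ _).
  - apply: ler_sum => i _; rewrite /F /= addr0.
    rewrite !clamp_id ?inL//; last exact: ltnW.
    by rewrite -natr1 mulrDl mul1r.
  - by move=> i iN; split => //; exact: geodesic_mesh.
  - move=> i j /andP[ij jN]; apply/seteqP; split => // y.
    move=> [[s + <-] [t + /esym E]]; rewrite /= !in_itv/= => /andP[s0 s1] /andP[t0 t1].
    have iN : (i < n.+1)%N := ltn_trans ij jN.
    have iS : i%:R * mesh L n + mesh L n <= j%:R * mesh L n.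
      by rewrite -[X in _ + X]mul1r -mulrDl natr1 ler_pM2r// ler_nat.
    have := inL _ (ltnW iN); have := inL _ jN; rewrite -natr1 mulrDl mul1r => hj hi.
    have : mdist (psi (i%:R * mesh L n + s)) (psi (j%:R * mesh L n + t)) = 0.
      by rewrite E mdistxx.
    rewrite gs; [|lra|lra]; move/eqP; rewrite normr_eq0 subr_eq0 => /eqP.
    lra.
exists k; split => // t tL; have := Dk t tL.
by rewrite /F /= !clamp_id//; rewrite lexx ltW.
Qed.

(** For a fine mesh, the cells meeting compact pieces of different arcs are disjoint
    arcs, because these pieces are at a positive distance from each other. *)
Lemma compact_slopes_energy f B N (phi : nat -> R -> X) (l : nat -> R)
    (k : nat -> R -> R) (K : nat -> set R) : arcs_energy_le f B ->
  (forall i, geodesic (phi i) (l i)) ->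
  (forall i, density f (k i) (phi i) (l i)) ->
  (forall i, compact (K i)) -> (forall i, K i `<=` `]0, l i[) ->
  (forall i j, i != j -> (phi i @` K i `&` phi j @` K j = set0)%classic) ->
  (\sum_(i < N) \int[mu]_(t in K i) (`|k i t| `^ p)%:E <= B%:E)%E.
Proof.
move=> fB gp Dk cK Kl dis.
(* arcs of length 0 carry no point; any positive length does for them *)
pose l' i := if 0 < l i then l i else 1.
have l'0 i : 0 < l' i by rewrite /l'; case: ifP.
have Kpos i t : K i t -> 0 < l i.
  by move=> /Kl; rewrite /= in_itv/= => /andP[]; exact: lt_trans.
have l'E i t : K i t -> l' i = l i by rewrite /l' => /Kpos ->.
apply: (@slopes_fatou _ p N (fun i => f \o phi i) (fun i => k i) (fun i => l' i)
  (fun i => K i)) => //.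
- by move=> i; exact: compact_measurable.
- by move=> i t Kt; rewrite (l'E i t Kt); exact: Kl.
- by move=> i; have [ik _] := Dk i; apply/measurable_EFinP; exact: measurable_int ik.
- move=> i; have [ik D] := Dk i.
  apply: ae_imp (@ae_has_deriv _ (f \o phi i) (k i) (l i) ik D) => t H Kt; apply: H.
  by have := Kl i t Kt; rewrite /= in_itv.
have sep (i j : 'I_N) : \forall n \near \oo, i != j ->
    forall s t u v, K i u -> K j v -> `|s - u| < mesh (l' i) n -> `|t - v| < mesh (l' j) n ->
      0 <= s <= l i -> 0 <= t <= l j -> phi i s <> phi j t.
  have [ij|ij] := eqVneq i j; first by apply: nearW.
  have cim a : compact (phi a @` K a).
    have [la|la] := lerP (l a) 0.
      rewrite (_ : K a = set0) ?image_set0; first exact: compact0.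
      by rewrite -subset0 => t Kt; move: (Kpos a t Kt); rewrite ltNge la.
    apply: (geodesic_image_compact (gp a) (ltW la) (cK a)).
    by move=> t /Kl; rewrite /= !in_itv/=; lra.
  have [e e0 He] := compacts_separated (cim i) (cim j) (dis i j ij).
  have small a : \forall n \near \oo, mesh (l' a) n < e / 2.
    have q0 : 0 < e / 2 / l' a by rewrite !divr_gt0.
    apply: filterS (near_infty_natSinv_lt (PosNum q0)) => n /=.
    by rewrite ltr_pdivlMr// mulrC.
  apply: filterS2 (small i) (small j) => n ni nj _ s t u v Ku Kv su tv sl tl E.
  have := He _ _ (imageP (phi i) Ku) (imageP (phi j) Kv).
  have ul := Kl i u Ku; have vl := Kl j v Kv; rewrite /= !in_itv/= in ul vl.
  have := metric_triangle (phi i u) (phi i s) (phi j v).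
  rewrite [in mdist (phi i s) _]E !gp; [|lra..].
  by rewrite (distrC u s); lra.
have /filterS : \forall n \near \oo, forall i j : 'I_N, i != j ->
    forall s t u v, K i u -> K j v -> `|s - u| < mesh (l' i) n -> `|t - v| < mesh (l' j) n ->
      0 <= s <= l i -> 0 <= t <= l j -> phi i s <> phi j t.
  by apply: filter_forall => i; apply: filter_forall => j; exact: sep.
apply=> n Hn; rewrite pair_big_dep/=.
pose P (q : 'I_N * 'I_n.+1) := `[< cell (l' q.1) n q.2 `&` K q.1 !=set0 >].
have inL (i : 'I_N) (j : nat) : (j < n.+1)%N -> l' i = l i ->
    0 <= j%:R * mesh (l i) n /\ j%:R * mesh (l i) n + mesh (l i) n <= l i.
  move=> jn E; have m0 : 0 < mesh (l i) n by rewrite divr_gt0// -E.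
  split; first by rewrite mulr_ge0 ?(ltW m0).
  have mL : n.+1%:R * mesh (l i) n = l i by rewrite /mesh mulrC divfK.
  by rewrite -[leRHS]mL -[X in _ + X]mul1r -mulrDl natr1 ler_pM2r// ler_nat.
have lP q : P q -> l' q.1 = l q.1 by move=> /asboolP[t [_ /l'E]].
have := @arcs_energy_fin f B _ P (fun q t => phi q.1 (q.2%:R * mesh (l q.1) n + t))
  (fun q => mesh (l q.1) n) fB.
move=> H; apply: le_trans (H _ _).
- apply: ler_sum => q Pq; rewrite /slope_energy (lP q Pq) /= addr0.
  by rewrite -natr1 mulrDl mul1r.
- move=> q Pq; have lq : 0 < l q.1 by rewrite -(lP q Pq).
  by split; [apply: geodesic_mesh => //|rewrite divr_gt0].
move=> [i a] [j b'] Pq Pq' qq; apply/seteqP; split => // y.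
move=> [[s + <-] [t + /esym E]]; rewrite /= !in_itv/= => /andP[s0 s1] /andP[t0 t1].
have /= li := lP _ Pq; have /= lj := lP _ Pq'.
have [ha1 ha2] := inL i a (ltn_ord a) li; have [hb1 hb2] := inL j b' (ltn_ord b') lj.
move/asboolP: Pq => [/= u [cu Ku]]; move/asboolP: Pq' => [/= v [cv Kv]].
rewrite /cell /= !in_itv/= li lj -!natr1 !mulrDl !mul1r in cu cv.
have [ij|ij] := eqVneq i j; last first.
  by apply: (Hn i j ij _ _ u v Ku Kv _ _ _ _ E); rewrite ?li ?lj ?ltr_norml; lra.
subst j; have ab : a != b' :> nat.
  by apply: contra qq => /eqP ab; apply/eqP; congr (_, _); exact: val_inj.
have : mdist (phi i (a%:R * mesh (l i) n + s)) (phi i (b'%:R * mesh (l i) n + t)) = 0.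
  by rewrite E mdistxx.
rewrite gp; [|lra|lra]; move/eqP; rewrite normr_eq0 subr_eq0 => /eqP.
have m0 : 0 < mesh (l i) n by lra.
have step (c d : nat) : (c < d)%N -> c%:R * mesh (l i) n + mesh (l i) n <= d%:R * mesh (l i) n.
  by move=> cd; rewrite -[X in _ + X]mul1r -mulrDl natr1 ler_pM2r// ler_nat.
by case: (ltngtP a b') ab => // /step; lra.
Qed.

(** Decompose the skeleton into the disjoint measurable parts of countably many
    geodesics, exhaust finitely many of these parts by compact sets and apply
    [compact_slopes_energy]. *)
Lemma abs_gradient_energy f h B : arcs_energy_le f B -> is_abs_gradient nu f h ->
  (\int[nu]_(z in S) (h z `^ p)%:E <= B%:E)%E.
Proof.
move=> fB gh; have [mh h0 _] := gh.
have mS := skeleton_measurable.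
have [phi [l [hphi cover]]] := skeleton_cover.
pose A n := first_arc phi l n.
have mA n : measurable (A n) := first_arc_measurable hphi n.
have AS : S = \bigcup_n A n := first_arc_cover cover.
have exk n : exists k : R -> R, density f k (phi n) (l n) /\
    {ae mu, forall t, 0 < t < l n -> `|k t| = h (phi n t)}.
  by have [gp ln] := hphi n; have [k Dk hk] := abs_gradient_density gh gp ln; exists k.
have [k Hk] := choice exk.
have mw : measurable_fun (S : set T) ((fun z => (h z `^ p)%:E) : T -> \bar R).
  by apply/measurable_EFinP; exact: (measurableT_comp (measurable_powR p)).
have w0 z : (0 <= (h z `^ p)%:E)%E by rewrite lee_fin powR_ge0.
have AS' n : A n `<=` S by rewrite AS => z nz; exists n.
pose D n := (`]0, l n[ `&` (phi n : R -> T) @^-1` A n)%classic.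
have mD n : measurable (D n).
  have [gp /andP[l0 _]] := hphi n.
  exact: (geodesic_measurable_fun gp l0).
have mk n : measurable_fun setT (k n).
  by have [[ik _] _] := Hk n; apply/measurable_EFinP; exact: measurable_int ik.
have mkp n : measurable_fun (D n) (fun t => (`|k n t| `^ p)%:E).
  apply: measurable_funTS; apply/measurable_EFinP.
  apply: (measurableT_comp (measurable_powR p)); exact: measurableT_comp.
have step n : (\int[nu]_(z in A n) (h z `^ p)%:E =
    \int[mu]_(t in D n) (`|k n t| `^ p)%:E)%E.
  have [gp /andP[l0 li]] := hphi n.
  have -> : A n = (phi n @` `]0, l n[ : set T)%classic `&` A n.
    by apply/esym/setIidPr; exact: first_arc_sub.
  have mgeo := geodesic_measurable gp l0.
  have geoS := geodesic_sub_skeleton gp.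
  rewrite integral_mkcondr (ge0_integral_geodesic gp l0); last 2 first.
  - apply/(measurable_restrict _ _ mgeo) => //.
    by apply: (measurable_funS mS) mw => z [_ /AS'].
  - by move=> z _; rewrite patchE; case: ifP.
  transitivity (\int[mu]_(t in D n) (h (phi n t) `^ p)%:E)%E.
    rewrite [RHS]integral_mkcondr; apply: eq_integral => t _.
    by rewrite !patchE; congr (if _ then _ else _); apply/idP/idP; rewrite !inE.
  apply: ae_eq_integral.
  - exact: mD.
  - apply: (@measurable_funS _ _ _ _ `]0, l n[%classic) => //; first by move=> t [].
    apply/measurable_EFinP; apply: (measurableT_comp (measurable_powR p)).
    exact: (skeleton_fun_along gp l0 mh).
  - exact: mkp.
  - have [_ hk] := Hk n; apply: ae_imp hk => t H [tl _].
    by rewrite H//; move: tl; rewrite /= in_itv.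
rewrite AS ge0_integral_bigcup//; last 2 first.
- by rewrite -AS.
- exact: trivIset_seqDU.
apply: lime_le; first by apply: is_cvg_nneseries => n _ _; exact: integral_ge0.
apply: nearW => N; rewrite big_mkord.
rewrite (eq_bigr _ (fun (i : 'I_N) _ => step i)).
have exK n : exists K : nat -> set R, [/\ forall j, compact (K j), forall j, K j `<=` D n &
    (\int[mu]_(t in K j) (`|k n t| `^ p)%:E)%E @[j --> \oo] -->
    (\int[mu]_(t in D n) (`|k n t| `^ p)%:E)%E].
  apply: integral_compact_approx => //.
  - have [_ /andP[l0 _]] := hphi n.
    apply: (@le_lt_trans _ _ (mu `]0, l n[%classic)).
      by apply: le_measure; [apply: mem_set; exact: mD|apply: mem_set; exact: measurable_itv|move=> t []].
    by rewrite lebesgue_measure_itv/=; case: ifP => _; rewrite ?ltry.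
have [K HK] := choice exK.
have lim_sum : (\sum_(i < N) \int[mu]_(t in K i j) (`|k i t| `^ p)%:E)%E @[j --> \oo] -->
    (\sum_(i < N) \int[mu]_(t in D i) (`|k i t| `^ p)%:E)%E.
  apply: cvg_nnesum => i _; last by have [] := HK i.
  by apply: nearW => j; apply: integral_ge0 => t _; rewrite lee_fin powR_ge0.
rewrite -(cvg_lim _ lim_sum)//; apply: lime_le; first by apply/cvg_ex; eexists; exact: lim_sum.
apply: nearW => j; apply: (@compact_slopes_energy f B N phi l k (fun i => K i j)) => //.
- by move=> i; have [] := hphi i.
- by move=> i; have [] := Hk i.
- by move=> i; have [] := HK i.
- by move=> i t Kt; have [_ KD _] := HK i; have [] := KD j t Kt.
- move=> i i' ii; apply/seteqP; split => // z [[s Ks <-] [t Kt E]].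
  have [_ KD _] := HK i; have [_ KD' _] := HK i'.
  have [_ /= As] := KD j s Ks; have [_ /= At] := KD' j t Kt.
  move/eqP: ii; apply; apply: (trivIset_seqDU _ _ _ I I).
  by exists (phi i s); split; [exact: As|rewrite -E].
Qed.

Lemma nu_sigma_finite : sigma_finite setT nu.
Proof.
have [phi [l [hphi cover]]] := skeleton_cover.
have mS := skeleton_measurable.
exists (fun n => if n is i.+1 then (phi i @` `]0, l i[)%classic else ~` S).
  apply/seteqP; split => // z _; have [Sz|nSz] := pselect (S z).
    by move: (Sz); rewrite cover => -[n _ nz]; exists n.+1.
  by exists 0%N.
case=> [|n]; first by split; [exact: measurableC|case: hnu => -> _; exact: ltry].
have [gp /andP[l0 _]] := hphi n; split.
  exact: (geodesic_measurable gp l0).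
have := nu_geodesic_image gp l0 measurableT.
by rewrite setTI => ->; rewrite lebesgue_measure_itv/=; case: ifP => _; rewrite ?ltry.
Qed.

Let ns : {sigma_finite_measure set T -> \bar R} := sigma_finite_of nu_sigma_finite.

(** Hoelder's inequality on the geodesic from x to y, which stays in the ball. *)
Lemma dist_energy f h x y r : is_abs_gradient nu f h -> r <= iota0 -> mdist x y < r ->
  ((`|f y - f x| `^ p)%:E <=
   (r `^ (p - 1))%:E * \int[nu]_(z in S `&` ball x r) (h z `^ p)%:E)%E.
Proof.
move=> gh ri xy; have [mh h0 _] := gh.
have p0 : 0 < p := lt_trans ltr01 p1.
have mS := skeleton_measurable.
have w0 z : (0 <= (h z `^ p)%:E)%E by rewrite lee_fin powR_ge0.
have [d0|dn0] := eqVneq (mdist x y) 0.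
  rewrite (mdist_positivity _ _ d0) subrr normr0 powR0 ?gt_eqF//.
  by apply: mule_ge0; [rewrite lee_fin powR_ge0|exact: integral_ge0].
have L0 : 0 < mdist x y by rewrite lt_neqAle eq_sym dn0 mdist_ge0.
have xyi : mdist x y < iota0 by exact: lt_le_trans ri.
have [psi [gs psi0 psi1]] := geodesic_exists_short xyi.
move: (mdist x y) L0 xy xyi gs psi1 {dn0} => L L0 Lr Li gs psi1.
have LL : 0 <= L < iota0 by rewrite ltW.
have [k [ik Dk] hk] := abs_gradient_density gh gs LL.
have := Dk L; rewrite psi0 psi1 lexx (ltW L0) => /(_ isT) ->.
have ikL : mu.-integrable `[0, L]%classic (EFin \o k) by exact: integrableS ik.
have ikn : mu.-integrable `[0, L]%classic (EFin \o (fun t => `|k t|)) by exact: integrable_abse ikL.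
have muL : mu `[0, L]%classic = L%:E.
  by rewrite lebesgue_measure_itv/= lte_fin L0 sube0.
have N0 (t : R) : `[0, L]%classic t -> 0 <= `|k t| by [].
have Hm := @integral_powR_mean _ _ R mu p L `[0, L]%classic (fun t => `|k t|) p1 (measurable_itv _) muL N0 ikn.
apply: (@le_trans _ _ (((\int[mu]_(t in `[0, L]) `|k t|) `^ p)%:E)).
  rewrite lee_fin ge0_ler_powR ?nnegrE ?(ltW p0)//.
    by apply: Rintegral_ge0.
  by apply: le_normr_Rintegral.
apply: (le_trans Hm); apply: lee_pmul.
- by rewrite lee_fin powR_ge0.
- by apply: integral_ge0 => t _; rewrite lee_fin powR_ge0.
- by rewrite lee_fin ge0_ler_powR ?nnegrE ?subr_ge0 ?(ltW p1) ?(ltW L0) ?(ltW Lr) ?(ltW (lt_trans L0 Lr)).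
have mkp : measurable_fun setT (fun t => (`|k t| `^ p)%:E).
  apply/measurable_EFinP; apply: (measurableT_comp (measurable_powR p)).
  by apply: measurableT_comp => //; apply/measurable_EFinP; exact: measurable_int ik.
rewrite (integral_itv_bndoo (f := fun t => (`|k t| `^ p)%:E) true false); last first.
  exact: measurable_funTS.
have geoS := geodesic_sub_skeleton gs.
have mgeo := geodesic_measurable gs (ltW L0).
have mw : measurable_fun (S : set T) ((fun z => (h z `^ p)%:E) : T -> \bar R).
  by apply/measurable_EFinP; exact: (measurableT_comp (measurable_powR p)).
have -> : (\int[mu]_(t in `]0%R, L[) (`|k t| `^ p)%:E =
    \int[nu]_(z in (psi @` `]0%R, L[)%classic) (h z `^ p)%:E)%E.
  rewrite (ge0_integral_geodesic gs (ltW L0))//; last first.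
    exact: (measurable_funS mS geoS).
  apply: ae_eq_integral => //.
  - exact: measurable_funTS.
  - apply/measurable_EFinP; apply: (measurableT_comp (measurable_powR p)).
    exact: (skeleton_fun_along gs (ltW L0) mh).
  - by apply: ae_imp hk => t H /=; rewrite in_itv/= => tL; rewrite H.
apply: ge0_subset_integral => //.
- exact: (skeleton_open_measurable (mball_open _ _)).
- by apply: (measurable_funS mS) mw => z [].
- move=> z zp; split; first exact: geoS.
  case: zp => t + <-; rewrite /= in_itv/= => tL; rewrite -psi0 mball (geodesic_dist0 gs); lra.
Qed.

(** * The gradient bounds the energy *)

Section volume.
Hypothesis hsep : separable X.
Variable m : {measure set (borel X) -> \bar R}.
Variables (r0 : R) (Phi : R -> R) (alpha c C : R).
Hypotheses (r00 : 0 < r0) (Phi0 : {in `[0, r0], forall r, 0 <= Phi r})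
  (c0 : 0 < c) (C0 : 0 < C)
  (doubling : forall r s, 0 < r -> r <= s -> s <= r0 ->
     c * (s / r) <= Phi s / Phi r <= C * (s / r) `^ alpha)
  (mballP : forall x r, 0 < r < r0 ->
     ((c * Phi r)%:E <= m (ball x r) <= (C * Phi r)%:E)%E).

Let ms : {sigma_finite_measure set (borel X) -> \bar R} :=
  sigma_finite_of (ball_sigma_finite hsep r00 mballP).

(** Integrate [dist_energy] over y in B(x,r) and over x. After exchanging the
    integrals, each point z of the skeleton carries the weight m(B(z,r)), which is
    comparable to Phi(r). *)
Lemma energy_le_gradient f h r : continuous f -> is_abs_gradient nu f h ->
  0 < r < r0 -> r <= iota0 ->
  (KS_energy m Phi p f r <= (C ^+ 2 / c)%:E * \int[nu]_(z in S) (h z `^ p)%:E)%E.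
Proof.
move=> cf gh rr0 ri; have [mh h0 _] := gh; have /andP[rp rr] := rr0.
have mS := skeleton_measurable.
have mf := continuous_borel cf.
have w0 z : (0 <= (h z `^ p)%:E)%E by rewrite lee_fin powR_ge0.
have mw : measurable_fun (S : set T) ((fun z => (h z `^ p)%:E) : T -> \bar R).
  by apply/measurable_EFinP; exact: (measurableT_comp (measurable_powR p)).
have P0 : 0 < Phi r by apply: (Phi_gt0 Phi0 c0 doubling); rewrite rp ltW.
have q0 : 0 < r `^ (p - 1) by rewrite powR_gt0.
have CP : 0 < C * Phi r by rewrite mulr_gt0.
pose D := [set w : borel X * T | S w.2 /\ mdist w.1 w.2 < r].
have mD : measurable D.
  apply: (@mdist_lt_measurable R X _ _ (borel X) T idfun idfun S r hsep).
    by move=> x q; exact: ball_borel.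
  move=> x q; exact: (skeleton_open_measurable (mball_open _ _)).
pose hS : T -> \bar R := (fun z => (h z `^ p)%:E) \_ S.
have mhS : measurable_fun setT hS by exact/(measurable_restrictT _ mS).
have hS0 z : (0 <= hS z)%E by rewrite /hS patchE; case: ifP.
pose F (w : borel X * T) : \bar R := (hS w.2 * (\1_D w)%:E)%E.
have mF : measurable_fun setT F.
  apply: emeasurable_funM.
    exact: (measurableT_comp mhS measurable_snd).
  by apply/measurable_EFinP; exact: measurable_indic.
have F0 w : (0 <= F w)%E by rewrite mule_ge0// lee_fin.
pose J := (\int[nu]_(z in S) (h z `^ p)%:E)%E.
have J0 : (0 <= J)%E by exact: integral_ge0.
have Fx x : (\int[nu]_z F (x, z) = \int[nu]_(z in S `&` ball x r) (h z `^ p)%:E)%E.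
  rewrite [RHS]integral_mkcond; apply: eq_integral => z _.
  rewrite /F /hS !patchE indicE /=.
  have [[Sz xz]|H] := pselect ((S `&` ball x r) z).
    by rewrite !mem_set ?mule1//; split => //; rewrite -mball.
  rewrite (memNset H); case: ifP => [/set_mem Sz|_]; last by rewrite mul0e.
  by rewrite memNset ?mule0// => -[_ /=]; rewrite -mball => ?; apply: H.
have Fz z : (\int[m]_x F (x, z) <= hS z * (C * Phi r)%:E)%E.
  rewrite /F /= /hS patchE; case: ifP => [/set_mem Sz|nS]; last first.
    by under eq_integral do rewrite mul0e; rewrite integral0 mul0e.
  have -> : (\int[m]_x ((h z `^ p)%:E * (\1_D (x, z))%:E) =
      \int[m]_(x in ball z r) (h z `^ p)%:E)%E.
    rewrite [RHS]integral_mkcond; apply: eq_integral => x _; rewrite patchE indicE.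
    have [zx|zx] := pselect (ball z r x).
      by rewrite !mem_set ?mule1//; split => //=; rewrite metric_sym -mball.
    by rewrite !memNset ?mule0// => -[_ /=]; rewrite metric_sym -mball.
  rewrite integral_cst; last exact: ball_borel.
  by apply: lee_wpmul2l => //; have /andP[] := mballP z rr0.
have E1 x : (inner m p f r x <= (C * Phi r * r `^ (p - 1))%:E * \int[nu]_z F (x, z))%E.
  have [_ ub] := andP (mballP x rr0).
  have K0 : (0 <= (r `^ (p - 1))%:E * \int[nu]_z F (x, z))%E.
    by apply: mule_ge0; [rewrite lee_fin ltW|exact: integral_ge0].
  apply: (@le_trans _ _ (\int[m]_(y in ball x r) ((r `^ (p - 1))%:E * \int[nu]_z F (x, z)))%E).
    apply: ge0_le_integral => //.
    + exact: ball_borel.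
    + by apply: measurable_funTS; exact: eq_dist_powR_measurable.
    + by move=> y; rewrite mball Fx => xy; exact: dist_energy.
  rewrite integral_cst; last exact: ball_borel.
  by rewrite (EFinM (C * Phi r)) -[leRHS]muleA [leRHS]muleC; exact: lee_wpmul2l.
have mI : measurable_fun setT ((fun x => \int[nu]_z F (x, z)) : borel X -> \bar R)%E.
  exact: (@measurable_fun_fubini_tonelli_F _ _ (borel X) T R ns F mF F0).
have E2 : (\int[m]_x inner m p f r x <= ((C * Phi r) ^+ 2 * r `^ (p - 1))%:E * J)%E.
  apply: (@le_trans _ _ (\int[m]_x ((C * Phi r * r `^ (p - 1))%:E * \int[nu]_z F (x, z)))%E).
    apply: ge0_le_integral => //.
    + by move=> x _; exact: inner_ge0.
    + exact: (inner_measurable hsep p r00 mballP r mf).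
    + exact: emeasurable_funM.
  rewrite ge0_integralZl_EFin//; last 2 first.
  + by move=> x _; exact: integral_ge0.
  + by rewrite mulr_ge0 ?(ltW CP) ?(ltW q0).
  rewrite (_ : (C * Phi r) ^+ 2 * r `^ (p - 1) = (C * Phi r * r `^ (p - 1)) * (C * Phi r)); last by ring.
  rewrite (EFinM (C * Phi r * r `^ (p - 1))).
  rewrite -muleA; apply: lee_wpmul2l.
    by rewrite lee_fin mulr_ge0 ?(ltW CP) ?(ltW q0).
  rewrite (@fubini_tonelli _ _ (borel X) T R ms ns F mF F0).
  apply: (@le_trans _ _ (\int[nu]_z (hS z * (C * Phi r)%:E))%E).
    apply: ge0_le_integral => //.
    + by move=> z _; exact: integral_ge0.
    + exact: (@measurable_fun_fubini_tonelli_G _ _ (borel X) T R ms F mF F0).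
    + exact: emeasurable_funM.
  rewrite ge0_integralZr// ?lee_fin ?(ltW CP)// muleC /J [in leRHS]integral_mkcond.
  exact: lexx.
have [H _] := energy_bounds hsep p r00 Phi0 c0 C0 doubling mballP mf rr0.
have cD : 0 < c * (r `^ (p - 1) * Phi r ^+ 2) by rewrite !mulr_gt0// exprn_gt0.
have cD' : (0 <= ((c * (r `^ (p - 1) * Phi r ^+ 2))^-1)%:E :> \bar R)%E.
  by rewrite lee_fin invr_ge0 ltW.
have := lee_wpmul2l cD' (le_trans H E2).
move: (KS_energy m Phi p f r) => E.
rewrite !muleA -!EFinM mulVf ?gt_eqF// mul1e => /le_trans; apply.
rewrite le_eqVlt; apply/orP; left; apply/eqP; congr (_%:E * _)%E.
by field; rewrite !gt_eqF.
Qed.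

End volume.
End arcs_energy.
End gradients.
End uniform_local_trees.

Theorem theorem3p7 (R : realType) (p : R) (hp : 1 < p)
  (X : pointedMetricType R)
  (hlc : locally_compact [set: X])
  (hconn : connected [set: X])
  (hsep : separable X)
  (iota : X -> R) (htree : local_tree iota)
  (iota0 : R) (hunif : uniform_local_tree X iota0)
  (hiota : forall x : X, iota0 <= iota x)
  (V : set X) (hV : countable_dense_in_skeleton iota V)
  (nu : {measure set (segment_space iota V) -> \bar R})
  (hnu : is_length_measure nu)
  (m : {measure set (borel X) -> \bar R})
  (hradon : radon m) (hsupp : full_support m)
  (r0 : R) (Phi : R -> R) (hvol : uniform_volume_control m r0 Phi) :
  KS m Phi p = W1p m nu p /\
  exists c C r1 : R,
    [/\ 0 < c, 0 < C, 0 < r1 <= r0 &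
      forall f : X -> R, KS m Phi p f ->
        (c%:E * ereal_sup (KS_energy m Phi p f @` `]0%R, r1]%classic)
           <= \int[nu]_(z in skeleton iota) (abs_gradient m nu p f z `^ p)%:E
           <= C%:E * limf_einf (KS_energy m Phi p f) (0 : R)^'+)%E].
Proof.
have [r00 Phi0 Phind [alpha [c [C [_ c0 C0 doubling mballP]]]]] := hvol.
have i0 : 0 < iota0 by case: hunif.
pose K1 := chain_cst alpha c C p * C; pose K2 := C ^+ 2 / c.
have K10 : 0 < K1 by rewrite mulr_gt0// chain_cst_gt0.
have K20 : 0 < K2 by rewrite divr_gt0// exprn_gt0.
(* at scales up to r1 the volume bounds hold and geodesics are unique *)
pose r1 := Num.min r0 iota0 / 2.
have min0 : 0 < Num.min r0 iota0 by rewrite lt_min r00.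
have r10 : 0 < r1 by rewrite divr_gt0.
have r1m : r1 < Num.min r0 iota0 by rewrite /r1; lra.
have /andP[r1r0 r1i] : (r1 < r0) && (r1 < iota0) by rewrite -lt_min.
have near_r1 : \forall r \near (0 : R)^'+, 0 < r < r0.
  by apply: filterS2 (nbhs_right_gt 0) (nbhs_right_lt r00) => r -> ->.
have near_r1' : \forall r \near (0 : R)^'+, 0 < r <= r1.
  by apply: filterS2 (nbhs_right_gt 0) (nbhs_right_lt r10) => r -> /ltW ->.
have mKS f : (f : borel X -> R) \in Lfun m p%:E -> measurable_fun setT (f : borel X -> R).
  by move=> fL; exact: (set_mem (sub_Lfun_mfun fL)).
have E_ae f ft r : measurable_fun setT (f : borel X -> R) -> continuous ft ->
    {ae m, forall x, ft x = f x} -> 0 < r < r0 ->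
    KS_energy m Phi p ft r = KS_energy m Phi p f r.
  move=> mf cft fE rr; apply: (KS_energy_ae hsep p r00 Phi0 c0 doubling mballP) => //.
  exact: continuous_borel.
have upper ft h (L : R) : continuous ft -> is_abs_gradient nu ft h ->
    (limf_einf (KS_energy m Phi p ft) 0^'+ <= L%:E)%E ->
    (\int[nu]_(z in skeleton iota) (h z `^ p)%:E <= (K1 * L)%:E)%E.
  move=> cft gh EL; apply: (abs_gradient_energy htree hunif hiota hV hnu hp _ gh).
  move=> N phi l gl dis.
  exact: (open_arcs_energy hsep r00 Phi0 c0 C0 doubling mballP hp cft gl dis EL).
have lower ft h r : continuous ft -> is_abs_gradient nu ft h -> 0 < r <= r1 ->
    (KS_energy m Phi p ft r <= K2%:E * \int[nu]_(z in skeleton iota) (h z `^ p)%:E)%E.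
  move=> cft gh /andP[rp rr1].
  apply: (energy_le_gradient htree hunif hiota hV hnu hp hsep r00 Phi0 c0 C0 doubling mballP) => //.
    by rewrite rp (le_lt_trans rr1).
  exact: le_trans rr1 (ltW r1i).
have E0 f r : 0 < r < r0 -> (0 <= KS_energy m Phi p f r)%E.
  move=> /andP[rp rr]; apply: mule_ge0.
    by rewrite lee_fin invr_ge0 mulr_ge0 ?powR_ge0// Phi0// in_itv/= !ltW.
  by apply: integral_ge0 => x _; apply: mule_ge0; [rewrite inve_ge0|exact: inner_ge0].
have J0 h : (0 <= \int[nu]_(z in skeleton iota) (h z `^ p)%:E)%E.
  by apply: integral_ge0 => z _; rewrite lee_fin powR_ge0.
have KSW f : KS m Phi p f -> W1p m nu p f.
  move=> [fL Ef]; split => //; have mf := mKS f fL.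
  have [ft cft fE] := continuous_representative hsep r00 Phi0 Phind c0 C0 doubling mballP hp mf Ef.
  exists ft => //.
  have [M [r2 [M0 r20 HM]]] := limsup_bound Ef.
  have EL : (limf_einf (KS_energy m Phi p ft) 0^'+ <= M%:E)%E.
    apply: limf_einf_le; apply: filterS3 near_r1 (nbhs_right_gt 0) (nbhs_right_lt r20).
    by move=> r rr rp rr2; rewrite (E_ae f ft)//; apply: HM; rewrite rp.
  have ac psi L : geodesic psi L -> 0 <= L -> exists k, density ft k psi L.
    apply: (arcs_energy_density hp cft) => N phi l gl dis.
    exact: (open_arcs_energy hsep r00 Phi0 c0 C0 doubling mballP hp cft gl dis EL).
  have [phi [l [hphi cover]]] := skeleton_cover htree hunif hiota hV.
  have exk n : exists k, density ft k (phi n) (l n).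
    by have [gp /andP[l0 _]] := hphi n; exact: ac.
  have [k Hk] := choice exk.
  have gh := glued_gradientP htree hunif hiota hV hnu hphi cover Hk ac.
  split; first by split=> // x; case: gh => _ _ /(_ x)[g gg _]; exists g.
  eexists; first exact: gh.
  exact: le_lt_trans (upper _ _ _ cft gh EL) (ltry _).
have KSWE : KS m Phi p = W1p m nu p.
  apply/seteqP; split => f; first exact: KSW.
  move=> [fL [ft fE [[cft _] [h gh Jfin]]]]; split => //.
  have mf := mKS f fL.
  apply: (@le_lt_trans _ _ (K2%:E * \int[nu]_(z in skeleton iota) (h z `^ p)%:E)%E).
    apply: limf_esup_le; apply: filterS2 near_r1 near_r1' => r rr rr1.
    by rewrite -(E_ae f ft)//; exact: lower.
  by apply: lte_mul_pinfty => //; rewrite lee_fin ltW.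
split => //; exists K2^-1, K1, r1; split => //.
- by rewrite invr_gt0.
- by rewrite r10 ltW.
move=> f fKS; have [fL Ef] := fKS; have mf := mKS f fL.
have [ft [fE [[cft _] _] gh]] : exists ft, [/\ {ae m, forall x, ft x = f x}, ACp nu p ft &
    is_abs_gradient nu ft (abs_gradient m nu p f)].
  apply: (@getPex _ [set h | exists ft, [/\ {ae m, forall x, ft x = f x}, ACp nu p ft &
    is_abs_gradient nu ft h]]).
  have [_ [ft fE ACft]] := KSW f fKS.
  by have [_ [h gh _]] := ACft; exists h, ft.
apply/andP; split.
  set J := (\int[nu]_(z in _) _)%E.
  apply: (@le_trans _ _ (K2^-1%:E * (K2%:E * J))%E); last first.
    by rewrite muleA -EFinM mulVf ?gt_eqF// mul1e.
  apply: lee_wpmul2l; first by rewrite lee_fin invr_ge0 ltW.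
  apply: ge_ereal_sup => _ [r + <-]; rewrite /= in_itv/= => rr1.
  rewrite -(E_ae f ft)//; first exact: lower.
  by case/andP: rr1 => -> /le_lt_trans ->.
have upper' (L : \bar R) : (0 <= L)%E -> (limf_einf (KS_energy m Phi p ft) 0^'+ <= L)%E ->
    (\int[nu]_(z in skeleton iota) (abs_gradient m nu p f z `^ p)%:E <= K1%:E * L)%E.
  case: L => [L _ EL|_ _|//]; first by rewrite -EFinM; exact: upper EL.
  by rewrite gt0_muley ?leey// lte_fin.
apply: upper'; first by apply: limf_einf_ge; apply: filterS near_r1 => r; exact: E0.
by apply: limf_einf_mono; apply: filterS near_r1 => r rr; rewrite (E_ae f ft).
Qed.
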